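(* Let $p$ be a non-degenerate super-critical offspring distribution with finite mean whose generating function $f$ satisfies $f(R_c)=+\infty$, where $R_c$ is the radius of convergence of $f$. If $\tau^\theta$ converges locally in distribution as $\theta\to+\infty$, then the limit is the distribution of $\tau^\infty$.
   Context: $\mathbb N=\{0,1,2,\dots\}$, $\mathbb N^*=\{1,2,\dots\}$. Trees. Let $\mathcal U=\bigcup_{n\ge0}(\mathbb N^* )^n$ with $(\mathbb N^* )^0=\{\partial\}$; $|u|=n$ if $u\in(\mathbb N^* )^n$. A tree $\mathbf t$ is a subset of $\mathcal U$ containing the root $\partial$, closed under taking prefixes, such that for every $u\in\mathbf t$ there is $k_u(\mathbf t)\in\mathbb N\cup\{\infty\}$ (number of children) with, for $i\in\mathbb N^*$, $ui\in\mathbf t\iff 1\le i\le k_u(\mathbf t)$. Set $k_u(\mathbf t)=-1$ if $u\notin\mathbf t$, and $z_n(\mathbf t)=\#\{u\in\mathbf t:|u|=n\}$. Local convergence in distribution of random trees $T_n$ to $T$ means convergence in distribution of $(k_u(T_n))_{u\in\mathcal U}$ to $(k_u(T))_{u\in\mathcal U}$ for finite-dimensional marginals, where $\{-1\}\cup\mathbb N\cup\{\infty\}$ has the topology of the one-point compactification of the discrete set $\{-1\}\cup\mathbb N$. $p=(p(k),k\in\mathbb N)$ has generating function $f$ and mean $\mu=f'(1)$; super-critical means $\mu>1$. $\mathfrak a$ and $\mathfrak b\in\mathbb N\cup\{\infty\}$ are the infimum and supremum of the support of $p$; non-degenerate means $\mathfrak a<\mathfrak b$. $\tau$ is the Galton–Watson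 tree with offspring distribution $p$, $Z_n=z_n(\tau)$. $\mathfrak c\in[0,1)$ is the extinction probability, the root in $[0,1)$ of $f(s)=s$. $f(R_c)=+\infty$ is understood with $f(+\infty)=+\infty$ if $R_c=+\infty$. Seneta–Heyde norming: $c_0\in(-1/\log\mathfrak c,\infty)$ ($c_0>0$ if $\mathfrak c=0$) and $(c_n)$ positive with $f(e^{-1/c_{n+1}})=e^{-1/c_n}$. $Z_n/c_n\to W\ge0$ a.s.; $W$ has law $\mathfrak c\,\delta_0(dt)+w(t)\mathbf 1_{\{t>0\}}dt$ with $w$ positive continuous on $(0,\infty)$. $w^{*i}$ is the $i$-fold convolution of $w$. If $\mathfrak c>0$, $\mathfrak p(n)=\mathfrak c^{n-1}p(n)$. For $\ell\ge1$ with $f^{(\ell)}(\mathfrak c)>0$, $\mathfrak p_{[\ell]}(k)=\binom k\ell\frac{\ell!}{f^{(\ell)}(\mathfrak c)}\mathfrak c^{k-\ell}p(k)$, $k\ge\ell$ (with $0^0=1$). For $\theta>0$, $r\in\mathbb N^*$, $s\in(\mathbb N^* )^r$, $|s|_1=\sum_i s_i$: $\rho_{\theta,r}(s)=\mu\,\frac{w^{*|s|_1}(\mu\theta)}{w^{*r}(\theta)}\prod_{i=1}^r\frac{f^{(s_i)}(\mathfrak c)}{s_i!}$, a probability distribution on $(\mathbb N^* )^r$. $\tau^\theta$, $\theta\in(0,\infty)$, is the tree, types being forgotten, of the following two-type random tree. The root has type s. A type e vertex has only type e children, their number having law $\mathfrak p$, independently of everything at lower or same height. With $\mathcal S_h$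 the set of type s vertices at generation $h$, conditionally on the tree and types up to generation $h$: the numbers $(\kappa^{\rm s}(u),u\in\mathcal S_h)$ of type s children have law $\rho_{\mu^h\theta,\#\mathcal S_h}$; and given $\kappa^{\rm s}(u)=s_u$, $u\in\mathcal S_h$, independently for each $u$, the total number of children of $u$ has law $\mathfrak p_{[s_u]}$ and the $s_u$ children of type s are chosen uniformly among them, the others being of type e. $\tau^\infty$: set $\lambda_c=\sup\{\lambda\in\mathbb R:\mathbb E[e^{\lambda W}]<\infty\}$, and $\zeta_h=\mathbb E[e^{\lambda_c\mu^{-h}W}]\in(0,\infty]$ ($\zeta_h=\infty$ for all $h$ if $\lambda_c=\infty$). $\tau^\infty$ is the time-inhomogeneous Galton–Watson tree where vertices at generation $h$ have, independently, $k$ children with probability $\zeta_{h+1}^kp(k)/\zeta_h$, $k\in\mathbb N$, if $\zeta_h<\infty$, and exactly $\mathfrak b\in\mathbb N\cup\{\infty\}$ children if $\zeta_h=\infty$. *)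

(* Defs.v *)
From HB Require Import structures.
From mathcomp Require Import all_boot all_order all_algebra finmap.
From mathcomp Require Import all_classical all_reals all_analysis.
Import Order.TTheory GRing.Theory Num.Theory numFieldNormedType.Exports.

Set Implicit Arguments.
Unset Strict Implicit.
Unset Printing Implicit Defensive.

Local Open Scope classical_set_scope.
Local Open Scope ring_scope.

(* Words over N^* = {1, 2, ...}; the letter i : nat encodes i.+1, so that the
   children of u are rcons u 0, rcons u 1, ... The root is [::]. *)
Definition word := seq nat.

Record tree := Tree {
  vertices : set word;
  tree_root : vertices [::];
  tree_prefix : forall u i, vertices (rcons u i) -> vertices u;
  (* the number of children k, with None standing for infinity *)
  tree_children : forall u, vertices u -> exists k : option nat,
    forall i, vertices (rcons u i) <-> (if k is Some n then (i < n)%N else True)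
}.

(* The one-point compactification of the discrete set {-1} U N:
   None is infinity, Some None is -1 and Some (Some k) is k. *)
Definition child_count :=
  one_point_compactification (discrete_topology (option nat)).
Definition count_infty : child_count := None.
Definition count_absent : child_count := Some None.
Definition count_nat (k : nat) : child_count := Some (Some k).

Definition count_val (R : realType) (x : child_count) : \bar R :=
  match x with
  | None => +oo%E
  | Some None => (-1)%:E
  | Some (Some k) => k%:R%:E
  end.

Definition nb_children (t : tree) (u : word) : child_count :=
  let C := [set i | vertices t (rcons u i)] in
  if ~~ `[< vertices t u >] then count_absent
  else if `[< finite_set C >] then count_nat #|` fset_set C|%fset
  else count_infty.

Definition gen_size (R : realType) (n : nat) (t : tree) : \bar R :=
  counting [set u | vertices t u /\ size u = n].

Section generating_function.
Context {R : realType}.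
Implicit Type p : nat -> R.

Definition is_distribution p : Prop :=
  (forall k, 0 <= p k) /\ (\sum_(0 <= k <oo) (p k)%:E = 1)%E.

(* Meaningful only where the series converges. *)
Definition gf p (s : R) : R := limn (pseries p s).

Definition mean p : \bar R := (\sum_(0 <= k <oo) (k%:R * p k)%:E)%E.

Definition supp_inf p : \bar R := ereal_inf [set k%:R%:E | k in [set k | 0 < p k]].
Definition supp_sup p : \bar R := ereal_sup [set k%:R%:E | k in [set k | 0 < p k]].

Definition cvg_radius p : \bar R :=
  ereal_sup [set r%:E | r in [set r | 0 <= r /\ cvgn (pseries p r)]].

(* The value of the generating function at s in [0, +oo], possibly infinite. *)
Definition gf_ereal p (s : \bar R) : \bar R :=
  if s is r%:E then (\sum_(0 <= k <oo) (p k * r ^+ k)%:E)%E else +oo%E.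

(* c stands for the extinction probability. *)
Definition is_extinction_root p (c : R) : Prop :=
  [/\ 0 <= c, c < 1 & gf p c = c].

Definition seneta_heyde p (c : R) (a : nat -> R) : Prop :=
  [/\ (if c == 0 then 0 < a 0%N else - (ln c)^-1 < a 0%N),
      forall n, 0 < a n &
      forall n, gf p (expR (- (a n.+1)^-1)) = expR (- (a n)^-1)].

(* Used for c > 0 only: if c = 0, there is almost surely no type e vertex. *)
Definition pfrak p (c : R) (n : nat) : R := c ^+ n / c * p n.

(* Zero for k < l, as 'C(k, l) = 0 then. *)
Definition pbracket p (c : R) (l k : nat) : R :=
  'C(k, l)%:R * (l`!%:R / derive1n l (gf p) c) * c ^+ (k - l) * p k.

(* Convolution of functions on (0, +oo). *)
Definition convol (f g : R -> R) (x : R) : R :=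
  (\int[lebesgue_measure]_(y in `]0%R, x[) (f y * g (x - y)))%R.

(* The n-fold convolution of w, for n >= 1. *)
Definition convol_pow (w : R -> R) (n : nat) : R -> R := iter n.-1 (convol w) w.

(* s is an element of (N^* )^r with r = size s. *)
Definition rho p (c : R) (w : R -> R) (theta : R) (s : seq nat) : R :=
  let mu := fine (mean p) in
  mu * (convol_pow w (sumn s) (mu * theta) / convol_pow w (size s) theta) *
  \prod_(i <- s) (derive1n i (gf p) c / i`!%:R).

End generating_function.

Section random_trees.
Context {R : realType} {d : measure_display} {Omega : measurableType d}.
Variable P : probability Omega R.

Definition random_tree (T : Omega -> tree) : Prop :=
  forall u x, measurable [set o | nb_children (T o) u = x].

(* The events that depend only on the tree up to generation h. *)
Definition tree_past (T : Omega -> tree) (h : nat) : set (set Omega) :=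
  <<s [set [set o | vertices (T o) u] | u in [set u | (size u <= h)%N]] >>.

(* T is a time-inhomogeneous Galton-Watson tree: given the tree up to
   generation h, the numbers of children of the vertices of generation h are
   independent with law q h. Infinite numbers of children are allowed, so this
   is expressed on finite families G of such vertices. *)
Definition is_inhom_GW (q : nat -> child_count -> R) (T : Omega -> tree) : Prop :=
  random_tree T /\
  forall (h : nat) (A : set Omega) (G : seq word) (x : word -> child_count),
    tree_past T h A -> uniq G ->
    (forall u, u \in G -> size u = h) ->
    (forall o u, A o -> u \in G -> vertices (T o) u) ->
    (P (A `&` [set o | forall u, u \in G -> nb_children (T o) u = x u])
     = P A * (\prod_(u <- G) q h (x u))%:E)%E.

Definition is_GW (p : nat -> R) (T : Omega -> tree) : Prop :=
  is_inhom_GW (fun _ x => if x is Some (Some k) then p k else 0) T.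

(* W is the almost sure limit of Z_n / a_n, and w the continuous density of its
   law on (0, +oo). *)
Definition is_SH_limit (a : nat -> R) (T : Omega -> tree)
    (W : {RV P >-> R}) : Prop :=
  {ae P, forall o,
    (fun n => gen_size R n (T o) * ((a n)^-1)%:E)%E @ \oo --> (W o)%:E}.

Definition is_limit_density (c : R) (W : {RV P >-> R}) (w : R -> R) : Prop :=
  [/\ forall t, 0 < t -> 0 < w t,
      forall t, 0 < t -> {for t, continuous w} &
      forall A : set R, measurable A ->
        (distribution P W A = c%:E * dirac (0%R : R) A +
          \int[lebesgue_measure]_(t in A `&` `]0%R, +oo[%classic) (w t)%:E)%E].

(* T is a random tree and S o is the set of its vertices of type s, those of
   type e being the other vertices of T o. *)
Definition random_typed_tree (T : Omega -> tree) (S : Omega -> set word) :=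
  [/\ random_tree T,
      forall u, measurable [set o | S o u],
      forall o, S o [::],
      forall o u, S o u -> vertices (T o) u &
      (* type e vertices have only type e children *)
      forall o u i, S o (rcons u i) -> S o u].

Definition typed_past (T : Omega -> tree) (S : Omega -> set word) (h : nat) :
    set (set Omega) :=
  <<s [set [set o | vertices (T o) u] | u in [set u | (size u <= h)%N]] `|`
      [set [set o | S o u] | u in [set u | (size u <= h)%N]] >>.

(* The event A, in the past of generation h, prescribes the set s of all type s
   vertices of generation h, and that e consists of type e vertices of this
   generation. A vertex u gets k u children; if it is in s, then J u is the set
   of (indices of) its children of type s. The factors are the law of the
   numbers of children of type s, that of the total numbers of children given
   these, the uniform choice of the positions, and the reproduction of the type
   e vertices. All these numbers are finite almost surely. *)
Definition is_tau_theta (p : nat -> R) (c : R) (w : R -> R) (theta : R)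
    (T : Omega -> tree) (S : Omega -> set word) : Prop :=
  random_typed_tree T S /\
  forall (h : nat) (A : set Omega) (s e : seq word)
         (k : word -> nat) (J : word -> {fset nat}),
    typed_past T S h A -> uniq s -> uniq e -> s != [::] ->
    (forall o, A o -> [set u | S o u /\ size u = h] = [set` s]) ->
    (forall u, u \in e -> size u = h) ->
    (forall o u, A o -> u \in e -> vertices (T o) u /\ ~ S o u) ->
    (forall u, u \in s -> (0 < #|` J u|)%N /\
                          forall i, i \in J u -> (i < k u)%N) ->
    (P (A `&` [set o | forall u, u \in s ->
                nb_children (T o) u = count_nat (k u) /\
                forall i, S o (rcons u i) <-> i \in J u]
          `&` [set o | forall u, u \in e ->
                nb_children (T o) u = count_nat (k u)])
     = P A * (rho p c w (fine (mean p) ^+ h * theta) [seq #|` J u| | u <- s]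
              * \prod_(u <- s) (pbracket p c #|` J u| (k u)
                                / 'C(k u, #|` J u|)%:R)
              * \prod_(u <- e) pfrak p c (k u))%:E)%E.

Definition lambda_c (W : {RV P >-> R}) : \bar R :=
  ereal_sup [set l%:E | l in
    [set l : R | ('E_P[fun o => expR (l * W o)%R] < +oo)%E]].

(* As W >= 0 almost surely, lambda_c W is never -oo. *)
Definition zeta (p : nat -> R) (W : {RV P >-> R}) (h : nat) : \bar R :=
  if lambda_c W is l%:E
  then 'E_P[fun o => expR (l * (fine (mean p) ^+ h)^-1 * W o)%R]%E
  else +oo%E.

Definition tau_infty_law (p : nat -> R) (W : {RV P >-> R}) (h : nat)
    (x : child_count) : R :=
  if zeta p W h == +oo%E then (count_val R x == supp_sup p)%:R
  else if x is Some (Some k)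
       then fine (zeta p W h.+1) ^+ k * p k / fine (zeta p W h)
       else 0.

End random_trees.

(* Weak convergence of all finite-dimensional marginals of
   (nb_children (T_ i) u, u : word), in the product topology. *)
Definition local_cvg_in_law (R : realType) (I : Type) (F : set_system I)
    (d_ : I -> measure_display) (Omega_ : forall i, measurableType (d_ i))
    (P_ : forall i, probability (Omega_ i) R)
    (T_ : forall i, Omega_ i -> tree)
    (d : measure_display) (Omega : measurableType d) (P : probability Omega R)
    (T : Omega -> tree) : Prop :=
  forall (n : nat) (u : 'I_n -> word)
         (g : prod_topology (fun _ : 'I_n => child_count) -> R),
    continuous g -> (exists M, forall x, `|g x| <= M) ->
    (fun i => 'E_(P_ i)[fun o => g (fun j => nb_children (T_ i o) (u j))]%E) @ F
      --> 'E_P[fun o => g (fun j => nb_children (T o) (u j))]%E.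

(* Main.v *)
Require Import Defs.
From HB Require Import structures.
From mathcomp Require Import all_boot all_order all_algebra finmap.
From mathcomp Require Import all_classical all_reals all_analysis.
From mathcomp Require Import measurable_realfun.
From mathcomp Require Import ring lra.
Import Order.TTheory GRing.Theory Num.Theory numFieldNormedType.Exports.

Set Implicit Arguments.
Unset Strict Implicit.
Unset Printing Implicit Defensive.

Local Open Scope classical_set_scope.
Local Open Scope ring_scope.

(** Why the theorem holds. Let W be the limit of the normalized process, of law
    [c delta_0 + w(x) dx], and let phi(l) be its exponential moment of order l. The
    trees tau^theta are the Galton-Watson tree conditioned on [W = theta]. Averaging
    them with weights proportional to [exp(l theta) w(theta)] therefore gives, up to
    extinction, the Galton-Watson tree tilted by [exp(l W)]. By the branching property
    this is a time-inhomogeneous Galton-Watson tree: a vertex of generation h has k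
    children with probability [x_(h+1)^k p_k / x_h], where [x_h = phi(l mu^-h)]. As l
    increases to lambda_c, phi(l) tends to infinity. So the weights escape to infinity
    and the averages converge to the local limit of tau^theta, if there is one. On the
    other hand the tilted offspring laws converge to those of tau^infty.

    The conditioning is replaced by two inequalities. From the reproduction law of
    tau^theta, the probability of a finite two-type tree is a product of factors of
    its vertices, times a ratio of convolution powers of [w] that depends on the last
    generation only. Summing over all trees with less than K children per vertex
    gives a lower bound, times w(theta), of the probability of an event
    ([root_explore_le]) and of its complement ([root_explore_compl_le]). Integrating
    against [exp(l theta)] turns convolution powers into powers, for which the sums
    factorize ([exploreX], [integral_explore_lap]). As K tends to infinity they
    become products of tails of the tilted offspring laws ([fullv_cvg]), and this
    yields the averaging argument ([tail_prod_cvg]).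

    The facts needed about W come from the same inequalities. The first generation
    gives the functional equation [f(phi(l / mu)) = phi(l)]: an inequality between
    densities, whose sides have the same mass ([wint_functional_le]). As
    [f(R_c) = +oo], the set where f is finite is open to the right. This implies that
    W has a mean ([wint_id_fin]), then that lambda_c is positive ([lap_some_moment]),
    both by iterating the equation from a small scale, and that phi(lambda_c) is
    infinite when lambda_c is finite ([lap_critical]). When phi(lambda_c mu^-h) is
    infinite, the offspring law of generation h is pushed to the supremum of its
    support ([tail_ratio_cvg]).

    The events used are lower bounds on the numbers of children of finitely many
    vertices. Such bounds are continuous in the local topology, infinite numbers of
    children included ([Pr_At_cvg]), and product formulas for their probabilities characterize
    Galton-Watson trees by a monotone class argument ([is_inhom_GW_fits]). *)

(** * Convolution of densities on the positive half-line *)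

Section affine.
Context {R : realType}.
Notation leb := (@lebesgue_measure R).

Definition affine (a b x : R) : measurableTypeR R := a * x + b.

Lemma measurable_affine (a b : R) : measurable_fun [set: R] (affine a b).
Proof. by apply: measurable_funD => //; exact: measurable_funM. Qed.

HB.instance Definition _ a b :=
  isMeasurableFun.Build _ _ _ _ (affine a b) (measurable_affine a b).

Lemma lebesgue_measure_affine (a b : R) (A : set R) : a != 0 -> measurable A ->
  (`|a|%:E * pushforward leb (affine a b) A = leb A)%E.
Proof.
move=> a0 mA.
have a0' : 0 <= `|a| by [].
have -> : (`|a|%:E * pushforward leb (affine a b) A =
    mscale (NngNum a0') (pushforward leb (affine a b)) A)%E by [].
  exact: measurable_affine.
move=> ?.
apply/esym/lebesgue_measure_unique => //= _ [[x y]] _ <-.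
rewrite /mscale/= /pushforward/=.
case: (ltgtP a 0) => [a_lt0|a_gt0|E]; last by rewrite E eqxx in a0.
- have -> : affine a b @^-1` `]x, y] = `[(y - b) / a, (x - b) / a[%classic.
    apply/seteqP; split => z /=; rewrite !in_itv/= /affine;
      by rewrite ltr_ndivlMr// ler_ndivrMr// ltrBlDr lerBrDr [z * a]mulrC andbC.
  rewrite !lebesgue_measure_itv/= !lte_fin ltr_nM2r ?invr_lt0// ltrD2r.
  case: ifPn => _; last by rewrite mule0.
  by rewrite -!EFinB -EFinM ltr0_norm//; congr EFin; field; rewrite lt_eqF.
- have -> : affine a b @^-1` `]x, y] = `](x - b) / a, (y - b) / a]%classic.
    apply/seteqP; split => z /=; rewrite !in_itv/= /affine;
      by rewrite ltr_pdivrMr// ler_pdivlMr// ltrBlDr lerBrDr [z * a]mulrC.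
  rewrite !lebesgue_measure_itv/= !lte_fin ltr_pM2r ?invr_gt0// ltrD2r.
  case: ifPn => _; last by rewrite mule0.
  by rewrite -!EFinB -EFinM gtr0_norm//; congr EFin; field; rewrite gt_eqF.
Qed.

(** Used with a = -1 to exchange the factors of a convolution, with a = 1 to
    translate and with b = 0 to change the scale. *)
Lemma ge0_integral_affine (a b : R) (f : R -> \bar R) : a != 0 ->
  measurable_fun setT f -> (forall x, 0 <= f x)%E ->
  (`|a|%:E * \int[leb]_x f (a * x + b)%R = \int[leb]_x f x)%E.
Proof.
move=> a0 mf f0.
have a0' : 0 <= `|a| by [].
have @m : {measure set (measurableTypeR R) -> \bar R}.
  unshelve refine (mscale (NngNum a0') (pushforward leb (affine a b))).
  exact: measurable_affine.
transitivity (\int[m]_x f x)%E; last first.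
  by apply: eq_measure_integral => A mA _; exact: lebesgue_measure_affine.
by rewrite /m ge0_integral_mscale// ge0_integral_pushforward//; exact: measurable_affine.
Qed.

End affine.

Section convolution.
Context {R : realType}.
Notation leb := (@lebesgue_measure R).
Implicit Types f g e : R -> R.

Notation pos := (`]0%R, +oo[%classic : set R).

(** The class of functions on the positive half-line that is stable under
    convolution. Local boundedness is what makes a convolution finite at every
    point, not only almost everywhere. *)
Record cv_density g : Prop := CvDensity {
  cvd_meas : measurable_fun pos g;
  cvd_gt0 : forall x, 0 < x -> 0 < g x;
  cvd_bnd : forall a b, 0 < a -> exists M, forall x, a <= x -> x <= b -> g x <= M;
  cvd_int : (\int[leb]_(x in pos) (g x)%:E < +oo)%E }.

Definition zext g (x : R) : R := if 0 < x then g x else 0.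

Lemma zext_patch g : zext g = g \_ pos.
Proof.
apply/funext => x; rewrite /zext patchE.
by case: ifPn => x0; [rewrite mem_set | rewrite memNset]; rewrite //= in_itv/= andbT//;
  exact/negP.
Qed.

Lemma zext_ge0 g x : (forall x, 0 < x -> 0 < g x) -> 0 <= zext g x.
Proof. by move=> g0; rewrite /zext; case: ifPn => // /g0/ltW. Qed.

Lemma measurable_zext g : measurable_fun pos g -> measurable_fun [set: R] (zext g).
Proof. by move=> mg; rewrite zext_patch; apply/(measurable_restrictT _ _).1. Qed.

Lemma integral_zext (g : R -> R) e :
  (\int[leb]_(x in pos) (e x * g x)%:E = \int[leb]_x (e x * zext g x)%:E)%E.
Proof.
rewrite integral_mkcond; apply: eq_integral => x _.
rewrite patchE /zext; case: ifPn => [|/negP] x0.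
  by rewrite inE/= in_itv/= andbT in x0; rewrite x0.
rewrite ifF ?mulr0//; apply/negP => x1; apply: x0.
by rewrite inE/= in_itv/= andbT.
Qed.

(** The convolution as an extended integral over the whole line: in this form
    Tonelli's theorem and affine changes of variables apply to it. *)
Definition cvE f g (x : R) : \bar R :=
  (\int[leb]_y (zext f y * zext g (x - y))%:E)%E.

Section two.
Variables (f g : R -> R) (df : cv_density f) (dg : cv_density g).

Let f0 x : 0 <= zext f x. Proof. exact/zext_ge0/cvd_gt0. Qed.
Let g0 x : 0 <= zext g x. Proof. exact/zext_ge0/cvd_gt0. Qed.
Let mf : measurable_fun setT (zext f). Proof. exact: measurable_zext (cvd_meas df). Qed.
Let mg : measurable_fun setT (zext g). Proof. exact: measurable_zext (cvd_meas dg). Qed.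

Lemma measurable_shift x : measurable_fun setT (fun y : R => zext g (x - y)).
Proof. by apply: (measurableT_comp mg); exact: measurable_funB. Qed.

Lemma measurable_cv_prod :
  measurable_fun setT (fun z : R * R => (zext f z.2 * zext g (z.1 - z.2))%:E).
Proof.
apply/measurable_EFinP; apply: measurable_funM; first exact: (measurableT_comp mf).
by apply: (measurableT_comp mg); exact: measurable_funB.
Qed.

Lemma measurable_cvE : measurable_fun setT (cvE f g).
Proof.
apply: (measurable_fun_fubini_tonelli_F (m2 := leb)
  (fun z : R * R => (zext f z.2 * zext g (z.1 - z.2))%:E)).
  exact: measurable_cv_prod.
by move=> z; rewrite lee_fin mulr_ge0.
Qed.

Lemma convolE x : convol f g x = fine (cvE f g x).
Proof.
rewrite /convol /Rintegral /cvE integral_mkcond; congr fine.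
apply: eq_integral => y _; rewrite patchE /zext subr_gt0.
case: ifPn => [|/negP]; rewrite inE/= in_itv/=.
  by move=> /andP[-> ->].
by case: (ltP 0 y) => y0; case: (ltP y x) => yx //=; rewrite ?mulr0 ?mul0r.
Qed.

Lemma cvE_le0 x : x <= 0 -> cvE f g x = 0%E.
Proof.
move=> x0; rewrite /cvE integral0_eq// => y _; rewrite /zext subr_gt0.
case: (ltP 0 y) => y0; rewrite ?mul0r//.
by rewrite ltNge (le_trans x0)/= ?mulr0// ltW.
Qed.

Lemma cvE_ge0 x : (0 <= cvE f g x)%E.
Proof. by apply: integral_ge0 => y _; rewrite lee_fin mulr_ge0. Qed.

Lemma integral_zext1 (h : R -> R) :
  (\int[leb]_(x in pos) (h x)%:E = \int[leb]_x (zext h x)%:E)%E.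
Proof.
transitivity (\int[leb]_(x in pos) ((cst 1 x : R) * h x)%:E)%E.
  by apply: eq_integral => x _; rewrite mul1r.
by rewrite integral_zext; apply: eq_integral => x _; rewrite mul1r.
Qed.

Lemma integral_zext_shift x :
  (\int[leb]_y (zext g (x - y))%:E = \int[leb]_(x in pos) (g x)%:E)%E.
Proof.
rewrite integral_zext1.
rewrite -(@ge0_integral_affine _ (-1) x (fun y => (zext g y)%:E)) ?oppr_eq0//.
- rewrite normrN1 mul1e; apply: eq_integral => y _.
  by rewrite mulN1r addrC.
- exact/measurable_EFinP.
Qed.

(** One of y and x - y is at least x / 2, hence at least a / 2: there its density is
    bounded, while the other density has a finite integral. *)
Lemma cvE_bnd a b : 0 < a ->
  exists M, forall x, a <= x -> x <= b -> (cvE f g x <= M%:E)%E.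
Proof.
move=> a0; have a2 : 0 < a / 2 by rewrite divr_gt0.
have [Mf' Hf'] := cvd_bnd df b a2; have [Mg' Hg'] := cvd_bnd dg b a2.
pose Mf := Num.max 0 Mf'; pose Mg := Num.max 0 Mg'.
have Hf x : a / 2 <= x -> x <= b -> f x <= Mf.
  by move=> ax xb; rewrite le_max Hf' ?orbT.
have Hg x : a / 2 <= x -> x <= b -> g x <= Mg.
  by move=> ax xb; rewrite le_max Hg' ?orbT.
have Mf0 : 0 <= Mf by rewrite le_max lexx.
have Mg0 : 0 <= Mg by rewrite le_max lexx.
pose If := fine (\int[leb]_(x in pos) (f x)%:E)%E.
pose Ig := fine (\int[leb]_(x in pos) (g x)%:E)%E.
have EIf : (\int[leb]_(x in pos) (f x)%:E)%E = If%:E.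
  rewrite /If fineK// ge0_fin_numE; first exact: cvd_int.
  by apply: integral_ge0 => x /=; rewrite in_itv/= andbT => /(cvd_gt0 df)/ltW.
have EIg : (\int[leb]_(x in pos) (g x)%:E)%E = Ig%:E.
  rewrite /Ig fineK// ge0_fin_numE; first exact: cvd_int.
  by apply: integral_ge0 => x /=; rewrite in_itv/= andbT => /(cvd_gt0 dg)/ltW.
exists (Mg * If + Mf * Ig) => x ax xb.
have x0 : 0 < x by exact: lt_le_trans ax.
apply: (@le_trans _ _
    (\int[leb]_y (Mg * zext f y + Mf * zext g (x - y))%:E)%E).
  apply: ge0_le_integral => //.
  - by move=> y _; rewrite lee_fin mulr_ge0.
  - apply/measurable_EFinP/measurable_funM => //; exact: measurable_shift.
  - apply/measurable_EFinP; apply: measurable_funD; apply: measurable_funM => //.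
    exact: measurable_shift.
  - move=> y _; rewrite lee_fin.
    have [y0|y0] := leP y 0.
      by rewrite {1}/zext ltNge y0 mul0r addr_ge0// mulr_ge0.
    have [xy|xy] := leP x y.
      by rewrite [X in _ * X]/zext subr_gt0 ltNge xy mulr0 addr_ge0// mulr_ge0.
    have [yx2|yx2] := leP y (x / 2).
      rewrite [leLHS]mulrC -[leLHS]addr0 lerD ?mulr_ge0//.
      apply: ler_pM => //; rewrite /zext subr_gt0 xy Hg//; lra.
    rewrite -[leLHS]add0r lerD ?mulr_ge0//.
    apply: ler_pM => //; rewrite /zext y0 Hf//; lra.
rewrite le_eqVlt; apply/orP; left; apply/eqP.
under eq_integral do rewrite EFinD.
rewrite ge0_integralD//; last 4 first.
- by move=> y _; rewrite lee_fin mulr_ge0.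
- by apply/measurable_EFinP/measurable_funM.
- by move=> y _; rewrite lee_fin mulr_ge0.
- by apply/measurable_EFinP/measurable_funM => //; exact: measurable_shift.
under eq_integral do rewrite EFinM.
rewrite [X in (_ + X)%E](_ : _ = \int[leb]_y (Mf%:E * (zext g (x - y))%:E))%E; last first.
  by apply: eq_integral => y _; rewrite EFinM.
rewrite ge0_integralZl//; last 2 first.
- exact/measurable_EFinP.
- by move=> y _; rewrite lee_fin.
rewrite ge0_integralZl//; last 2 first.
- by apply/measurable_EFinP; exact: measurable_shift.
- by move=> y _; rewrite lee_fin.
by rewrite integral_zext_shift -integral_zext1 EIf EIg EFinD !EFinM.
Qed.

Lemma cvE_fin x : cvE f g x \is a fin_num.
Proof.
have [x0|x0] := leP x 0; first by rewrite cvE_le0.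
have [M HM] := cvE_bnd x x0.
by rewrite ge0_fin_numE ?cvE_ge0// (le_lt_trans (HM _ _ _)) ?ltry.
Qed.

(** Otherwise the integrand would vanish almost everywhere on ]0, x[, where it is
    positive. *)
Lemma cvE_gt0 x : 0 < x -> (0 < cvE f g x)%E.
Proof.
move=> x0; rewrite lt_neqAle cvE_ge0 andbT eq_sym; apply/eqP => H0.
have mh : measurable_fun setT (fun y => (zext f y * zext g (x - y))%:E).
  by apply/measurable_EFinP/measurable_funM => //; exact: measurable_shift.
have := (ae_eq_integral_abs leb measurableT mh).1; case.
  under eq_integral do rewrite gee0_abs ?lee_fin ?mulr_ge0//.
  exact: H0.
move=> N [mN N0 sub].
have : (leb `]0%R, x[ <= leb N)%E.
  apply: le_measure; rewrite ?inE//.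
  apply: subset_trans sub => y /=; rewrite in_itv/= => /andP[y0 yx].
  apply/not_implyP; split => //=.
  rewrite /zext y0 subr_gt0 yx => -[] /eqP.
  by rewrite gt_eqF// mulr_gt0// ?(cvd_gt0 df)// (cvd_gt0 dg)// subr_gt0.
by rewrite N0 lebesgue_measure_itv/= lte_fin x0 -EFinB lee_fin subr0 leNgt x0.
Qed.

Lemma zext_convol x : (zext (convol f g) x)%:E = cvE f g x.
Proof.
rewrite /zext convolE; case: ifPn; first by rewrite fineK// cvE_fin.
by rewrite -leNgt => /cvE_le0 ->.
Qed.

Lemma integral_convol e : measurable_fun setT e -> (forall x, 0 <= e x) ->
  (\int[leb]_(x in pos) (e x * convol f g x)%:E =
   \int[leb]_y ((zext f y)%:E * \int[leb]_x (e (x + y) * zext g x)%:E))%E.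
Proof.
move=> me e0; rewrite integral_zext.
under eq_integral do rewrite EFinM zext_convol /cvE.
transitivity (\int[leb]_x \int[leb]_y (e x * (zext f y * zext g (x - y)))%:E)%E.
  apply: eq_integral => x _; rewrite -ge0_integralZl//.
  - by apply/measurable_EFinP/measurable_funM => //; exact: measurable_shift.
  - by move=> y _; rewrite lee_fin mulr_ge0.
  - by rewrite lee_fin.
rewrite (@fubini_tonelli _ _ _ _ _ leb leb
  (fun z : R * R => (e z.1 * (zext f z.2 * zext g (z.1 - z.2)))%:E))/=; last 2 first.
- under eq_fun do rewrite EFinM.
  apply: emeasurable_funM; last exact: measurable_cv_prod.
  by apply/measurable_EFinP; exact: (measurableT_comp me).
- by move=> z; rewrite lee_fin !mulr_ge0.
apply: eq_integral => y _.
rewrite -ge0_integralZl//; last 3 first.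
- apply/measurable_EFinP/measurable_funM => //.
  by apply: (measurableT_comp me); exact: measurable_funD.
- by move=> x _; rewrite lee_fin mulr_ge0.
- by rewrite lee_fin.
rewrite -(@ge0_integral_affine _ 1 y
  (fun x => (e x * (zext f y * zext g (x - y)))%:E)) ?oner_eq0//.
- rewrite normr1 mul1e; apply: eq_integral => x _.
  by rewrite mul1r addrK -EFinM mulrCA.
- apply/measurable_EFinP; apply: measurable_funM => //; apply: measurable_funM => //.
  by apply: (measurableT_comp mg); exact: measurable_funB.
- by move=> x; rewrite lee_fin !mulr_ge0.
Qed.

(** Exponentials turn convolutions into products; an exponential truncated so as to
    be bounded is only submultiplicative, which gives an inequality. *)
Lemma integral_shift_le e : measurable_fun setT e -> (forall x, 0 <= e x) ->
  (forall x y, 0 < x -> 0 < y -> e (x + y) <= e x * e y) ->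
  (\int[leb]_(x in pos) (e x * convol f g x)%:E <=
   (\int[leb]_(x in pos) (e x * f x)%:E) * (\int[leb]_(x in pos) (e x * g x)%:E))%E.
Proof.
move=> me e0 eM; rewrite integral_convol// !integral_zext.
set I := (\int[leb]_x (e x * zext g x)%:E)%E.
have I0 : (0 <= I)%E by apply: integral_ge0 => x _; rewrite lee_fin mulr_ge0.
rewrite muleC -ge0_integralZl//; last 2 first.
- by apply/measurable_EFinP/measurable_funM.
- by move=> x _; rewrite lee_fin mulr_ge0.
apply: ge0_le_integral => //.
- move=> y _; rewrite mule_ge0 ?lee_fin//.
  by apply: integral_ge0 => x _; rewrite lee_fin mulr_ge0.
- apply: emeasurable_funM; first exact/measurable_EFinP.
  apply: (measurable_fun_fubini_tonelli_F (m2 := leb)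
    (fun z : R * R => (e (z.2 + z.1) * zext g z.2)%:E)).
    apply/measurable_EFinP/measurable_funM; last exact: (measurableT_comp mg).
    by apply: (measurableT_comp me); exact: measurable_funD.
  by move=> z; rewrite lee_fin mulr_ge0.
- apply: emeasurable_funM => //.
  by apply/measurable_EFinP/measurable_funM.
move=> y _; rewrite [in leRHS]EFinM muleA [leLHS]muleC.
have [y0|y0] := leP y 0; first by rewrite /zext ltNge y0 !mule0.
apply: lee_wpmul2r; first by rewrite lee_fin.
rewrite [leRHS]muleC -ge0_integralZl//; last 3 first.
- by apply/measurable_EFinP/measurable_funM.
- by move=> x _; rewrite lee_fin mulr_ge0.
- by rewrite lee_fin.
apply: ge0_le_integral => //.
- by move=> x _; rewrite lee_fin mulr_ge0.
- apply/measurable_EFinP/measurable_funM => //.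
  by apply: (measurableT_comp me); exact: measurable_funD.
- by apply: emeasurable_funM => //; apply/measurable_EFinP/measurable_funM.
move=> x _; rewrite -EFinM lee_fin mulrA [e y * _]mulrC.
have [x0|x0] := leP x 0; first by rewrite /zext ltNge x0 !mulr0.
by rewrite ler_wpM2r ?eM.
Qed.

Lemma integral_shift_eq e : measurable_fun setT e -> (forall x, 0 <= e x) ->
  (forall x y, 0 < x -> 0 < y -> e (x + y) = e x * e y) ->
  (\int[leb]_(x in pos) (e x * convol f g x)%:E =
   (\int[leb]_(x in pos) (e x * f x)%:E) * (\int[leb]_(x in pos) (e x * g x)%:E))%E.
Proof.
move=> me e0 eM; rewrite integral_convol// !integral_zext.
set I := (\int[leb]_x (e x * zext g x)%:E)%E.
have I0 : (0 <= I)%E by apply: integral_ge0 => x _; rewrite lee_fin mulr_ge0.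
rewrite [RHS]muleC -ge0_integralZl//; last 2 first.
- by apply/measurable_EFinP/measurable_funM.
- by move=> x _; rewrite lee_fin mulr_ge0.
apply: eq_integral => y _; rewrite [in RHS]EFinM muleA [LHS]muleC.
have [y0|y0] := leP y 0; first by rewrite /zext ltNge y0 !mule0.
congr (_ * _)%E; rewrite [RHS]muleC -ge0_integralZl//; last 3 first.
- by apply/measurable_EFinP/measurable_funM.
- by move=> x _; rewrite lee_fin mulr_ge0.
- by rewrite lee_fin.
apply: eq_integral => x _; rewrite -EFinM mulrA [e y * _]mulrC.
have [x0|x0] := leP x 0; first by rewrite /zext ltNge x0 !mulr0.
by rewrite eM.
Qed.

Lemma cv_density_convol : cv_density (convol f g).
Proof.
split.
- rewrite (_ : convol f g = fine \o cvE f g); last by apply/funext => x; rewrite convolE.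
  apply: measurable_funS (measurableT) _ _ => //.
  by apply: measurableT_comp => //; exact: measurable_cvE.
- by move=> x x0; rewrite convolE fine_gt0// cvE_gt0//= -ge0_fin_numE ?cvE_ge0// cvE_fin.
- move=> a b a0; have [M HM] := cvE_bnd b a0; exists M => x ax xb.
  by rewrite convolE -lee_fin fineK ?cvE_fin// HM.
- have H := @integral_shift_le (cst 1) _ _ _.
  under eq_integral do rewrite -[convol _ _ _]mul1r.
  apply: le_lt_trans (H _ _ _) _ => //; first by move=> x y; rewrite mulr1.
  apply: lte_mul_pinfty.
  + by apply: integral_ge0 => x /=; rewrite in_itv/= andbT mul1r => /(cvd_gt0 df)/ltW.
  + rewrite ge0_fin_numE; last first.
      by apply: integral_ge0 => x /=; rewrite in_itv/= andbT mul1r => /(cvd_gt0 df)/ltW.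
    by under eq_integral do rewrite mul1r; exact: cvd_int.
  + by under eq_integral do rewrite mul1r; exact: cvd_int.
Qed.

End two.

Lemma cv_density_pow w n : cv_density w -> cv_density (convol_pow w n).
Proof.
by move=> dw; rewrite /convol_pow; elim: n.-1 => //= m; exact: cv_density_convol.
Qed.

Lemma integral_convol_pow_le w e n : cv_density w ->
  measurable_fun setT e -> (forall x, 0 <= e x) ->
  (forall x y, 0 < x -> 0 < y -> e (x + y) <= e x * e y) ->
  (\int[leb]_(x in pos) (e x * convol_pow w n.+1 x)%:E <=
   (\int[leb]_(x in pos) (e x * w x)%:E) ^+ n.+1)%E.
Proof.
move=> dw me e0 eM; elim: n => [|n IH]; first by rewrite expeS expe0 mule1.
have dn := cv_density_pow n.+1 dw.
apply: le_trans (integral_shift_le dw dn me e0 eM) _.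
rewrite [leRHS]expeS lee_wpmul2l//; apply: integral_ge0 => x /=.
by rewrite in_itv/= andbT => x0; rewrite lee_fin mulr_ge0// ltW// (cvd_gt0 dw).
Qed.

Lemma integral_convol_pow_eq w e n : cv_density w ->
  measurable_fun setT e -> (forall x, 0 <= e x) ->
  (forall x y, 0 < x -> 0 < y -> e (x + y) = e x * e y) ->
  (\int[leb]_(x in pos) (e x * convol_pow w n.+1 x)%:E =
   (\int[leb]_(x in pos) (e x * w x)%:E) ^+ n.+1)%E.
Proof.
move=> dw me e0 eM; elim: n => [|n IH]; first by rewrite expeS expe0 mule1.
have dn := cv_density_pow n.+1 dw.
by rewrite [LHS](integral_shift_eq dw dn me e0 eM) [RHS]expeS -IH.
Qed.

(** Change of variables [y = m x] in the form in which it is used: [m g(m x)] is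
    the density of [1/m] times a variable of density [g]. *)
Lemma integral_scale (m : R) g e : 0 < m -> measurable_fun pos g ->
  (forall x, 0 < x -> 0 < g x) ->
  measurable_fun setT e -> (forall x, 0 <= e x) ->
  (\int[leb]_(x in pos) (e x * (m * g (m * x)))%:E =
   \int[leb]_(x in pos) (e (x / m) * g x)%:E)%E.
Proof.
move=> m0 mg g0 me e0; rewrite !integral_zext.
have mz := measurable_zext mg.
have z0 x := zext_ge0 x g0.
have me' : measurable_fun setT (fun x : R => e (x / m)).
  by apply: (measurableT_comp me); exact: measurable_funM.
rewrite -(@ge0_integral_affine _ m 0 (fun x : R => (e (x / m) * zext g x)%:E)) ?gt_eqF//; last 2 first.
- exact/measurable_EFinP/measurable_funM.
- by move=> x; rewrite lee_fin mulr_ge0.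
rewrite gtr0_norm// -ge0_integralZl//; last 3 first.
- apply/measurable_EFinP/measurable_funM.
    by apply: (measurableT_comp me'); apply: measurable_funD => //; exact: measurable_funM.
  by apply: (measurableT_comp mz); apply: measurable_funD => //; exact: measurable_funM.
- by move=> x _; rewrite lee_fin mulr_ge0.
- by rewrite lee_fin ltW.
apply: eq_integral => x _; rewrite -EFinM addr0 [m * x]mulrC mulfK ?gt_eqF//.
congr EFin; rewrite mulrCA; congr (_ * _).
rewrite /zext pmulr_lgt0//; case: ifP => _ //; by rewrite ?mulr0// [m * x]mulrC.
Qed.

End convolution.

(** * Generating functions *)

Section generating_function.
Context {R : realType}.
Implicit Types (u p : nat -> R) (x y c : R).

Lemma nneseries_cvg u (l : R) : (forall k, 0 <= u k) ->
  (\sum_(0 <= k <oo) (u k)%:E = l%:E)%E -> series u @ \oo --> l.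
Proof.
move=> u0 ul.
have H : (fun n => \sum_(0 <= k < n) (u k)%:E)%E @ \oo --> l%:E.
  by rewrite -ul; apply: is_cvg_nneseries => n _ _; rewrite lee_fin.
have -> : series u = fine \o (fun n => \sum_(0 <= k < n) (u k)%:E)%E.
  by apply/funext => n; rewrite /= /series/= sumEFin.
exact: fine_cvg.
Qed.

Lemma cvg_series_bnd u (B : R) : (forall k, 0 <= u k) ->
  (forall n, series u n <= B) -> cvgn (series u).
Proof.
move=> u0 uB; apply: nondecreasing_is_cvgn.
  by apply: nondecreasing_series => n _ _; exact: u0.
by exists B => _ [n _ <-]; exact: uB.
Qed.

Lemma series_le_lim u n : (forall k, 0 <= u k) -> cvgn (series u) ->
  series u n <= limn (series u).
Proof.
move=> u0 cu; apply: nondecreasing_cvgn_le => //.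
by apply: nondecreasing_series => m _ _; exact: u0.
Qed.

Definition inner_cvg u := forall x, 0 <= x -> x < 1 -> cvgn (pseries u x).

(** Compares the terms of the derived series at x with those of the series at y. *)
Lemma bernoulli_diff n x y : 0 <= x -> x <= y ->
  n.+1%:R * x ^+ n * (y - x) <= y ^+ n.+1.
Proof.
move=> x0 xy; have y0 : 0 <= y by exact: le_trans xy.
elim: n => [|n IH]; first by rewrite mul1r expr0 mul1r expr1; lra.
rewrite -natr1 2!mulrDl mul1r.
have -> : n.+1%:R * x ^+ n.+1 * (y - x) = x * (n.+1%:R * x ^+ n * (y - x)).
  by rewrite exprS; ring.
have H1 : x * (n.+1%:R * x ^+ n * (y - x)) <= x * y ^+ n.+1 by rewrite ler_wpM2l.
have H2 : x ^+ n.+1 * (y - x) <= y ^+ n.+1 * (y - x).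
  by rewrite ler_wpM2r ?subr_ge0// lerXn2r.
apply: le_trans (lerD H1 H2) _; rewrite [leRHS]exprS le_eqVlt; apply/orP; left.
by apply/eqP; ring.
Qed.

Lemma inner_cvg_diffs u : (forall k, 0 <= u k) ->
  inner_cvg u -> inner_cvg (pseries_diffs u).
Proof.
move=> u0 cu x x0 x1.
pose y := (1 + x) / 2.
have xy : x < y by rewrite /y; lra.
have y1 : y < 1 by rewrite /y; lra.
have y0 : 0 <= y by exact: le_trans (ltW xy).
have cy := cu _ y0 y1.
apply: (@cvg_series_bnd _ (limn (pseries u y) / (y - x))).
  by move=> k; rewrite !mulr_ge0// exprn_ge0.
move=> n; rewrite ler_pdivlMr ?subr_gt0//.
apply: (@le_trans _ _ (pseries u y n.+1)); last first.
  by apply: series_le_lim => // k; rewrite mulr_ge0// exprn_ge0.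
rewrite /pseries /series/= big_nat_recl//= mulr_suml.
apply: (@le_trans _ _ (\sum_(0 <= i < n) u i.+1 * y ^+ i.+1)); last first.
  by rewrite lerDr mulr_ge0.
apply: ler_sum => i _; rewrite /pseries_diffs.
rewrite [X in X * _ <= _]mulrAC -[_ * _ * (y - x)]mulrAC [leRHS]mulrC.
by rewrite ler_wpM2r// bernoulli_diff// ltW.
Qed.

Lemma derive_gf u x : (forall k, 0 <= u k) -> inner_cvg u -> `|x| < 1 ->
  is_derive x 1 (gf u) (gf (pseries_diffs u) x).
Proof.
move=> u0 cu x1.
have cd := inner_cvg_diffs u0 cu.
have d0 k : 0 <= pseries_diffs u k by rewrite mulr_ge0.
have cdd := inner_cvg_diffs d0 cd.
pose K := (1 + `|x|) / 2.
have xK : `|x| < K by rewrite /K; lra.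
have K0 : 0 <= K by exact: le_trans (ltW xK).
have K1 : K < 1 by rewrite /K; lra.
by apply: (@pseries_snd_diffs _ _ K); rewrite ?(ger0_norm K0)//;
  [exact: cu|exact: cd|exact: cdd].
Qed.

Lemma iter_diffs_ge0 j u : (forall k, 0 <= u k) ->
  forall k, 0 <= iter j (@pseries_diffs R) u k.
Proof. by move=> u0; elim: j => //= j IH k; rewrite mulr_ge0. Qed.

Lemma iter_diffs_cvg j u : (forall k, 0 <= u k) -> inner_cvg u ->
  inner_cvg (iter j (@pseries_diffs R) u).
Proof.
move=> u0 cu; elim: j => //= j IH; apply: inner_cvg_diffs => //.
exact: iter_diffs_ge0.
Qed.

(** The derivatives of the generating function in the laws of the types are those of
    a power series, whose coefficients are multiples of the original ones. *)
Lemma derive1n_gf j u x : (forall k, 0 <= u k) -> inner_cvg u -> `|x| < 1 ->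
  derive1n j (gf u) x = gf (iter j (@pseries_diffs R) u) x.
Proof.
move=> u0 cu; elim: j x => //= j IH x x1.
have dj := derive_gf (iter_diffs_ge0 j u0) (iter_diffs_cvg (j:=j) u0 cu) x1.
rewrite derive1E; apply: (etrans _ (@derive_val _ _ _ _ _ _ _ dj)).
apply: near_eq_derive.
near=> y; apply: IH; near: y.
exists (1 - `|x|) => /=; first by rewrite subr_gt0.
move=> y /=; rewrite /ball/= distrC => yx.
by have := ler_distD x y 0; rewrite !subr0; lra.
Unshelve. all: by end_near. Qed.

Lemma iter_diffs_coef j u n :
  exists2 q, 0 < q & iter j (@pseries_diffs R) u n = q * u (n + j)%N.
Proof.
elim: j n => [|j IH] n; first by exists 1 => //=; rewrite mul1r addn0.
have [q q0 E] := IH n.+1; exists (n.+1%:R * q).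
  by rewrite mulr_gt0.
by rewrite /= /pseries_diffs E mulrA addSnnS.
Qed.

(** The derivative of the generating function occurs in [rho], and its inverse in the
    law of the number of children: they cancel, leaving the factor of a type s vertex
    with k children, j of them of type s at given positions. *)
Lemma pbracket_factor p c j k : (forall k, 0 <= p k) -> inner_cvg p ->
  0 <= c -> c < 1 -> (j <= k)%N ->
  derive1n j (gf p) c / j`!%:R * (pbracket p c j k / 'C(k, j)%:R) =
  c ^+ (k - j) * p k.
Proof.
move=> p0 cp c0 c1 jk.
have C0 : 'C(k, j)%:R != 0 :> R by rewrite pnatr_eq0 -lt0n bin_gt0.
have f0 : j`!%:R != 0 :> R by rewrite pnatr_eq0 -lt0n fact_gt0.
have [E|/negPf ne0] := eqVneq (c ^+ (k - j) * p k) 0.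
  by rewrite /pbracket -[_ * _ * p k]mulrA E mulr0 mul0r mulr0.
suff d0 : derive1n j (gf p) c != 0.
  by rewrite /pbracket; field; rewrite d0 C0 f0.
rewrite derive1n_gf ?ger0_norm// gt_eqF//.
have [q q0 E] := iter_diffs_coef j p (k - j).
rewrite subnK// in E.
set v := iter _ _ _ in E *.
have v0 i : 0 <= v i by exact: iter_diffs_ge0.
have cv : cvgn (pseries v c) by exact: iter_diffs_cvg.
apply: (@lt_le_trans _ _ (pseries v c (k - j).+1)); last first.
  by apply: series_le_lim => // i; rewrite mulr_ge0// exprn_ge0.
rewrite /pseries /series/= big_nat_recr//= ltr_wpDl//.
  by apply: sumr_ge0 => i _; rewrite mulr_ge0// exprn_ge0.
rewrite E -mulrA mulr_gt0// lt_neqAle mulrC eq_sym ne0/=.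
by rewrite mulr_ge0// exprn_ge0.
Qed.

(** The generating function truncated at K, to be bounded or passed to the limit at
    points where the series is not known to converge. *)
Definition tgf p (K : nat) (x : R) : R := \sum_(k < K) p k * x ^+ k.

Lemma tgfE p K x : tgf p K x = pseries p x K.
Proof. by rewrite /tgf /pseries /series/= big_mkord. Qed.

(** The series diverges at its radius of convergence, so a point where it converges
    is not the radius itself. *)
Lemma tgf_bnd_extend p x B : (forall k, 0 <= p k) ->
  gf_ereal p (cvg_radius p) = +oo%E -> 0 <= x ->
  (forall K, tgf p K x <= B) ->
  exists y B', [/\ x < y & forall K, tgf p K y <= B'].
Proof.
move=> p0 hR x0 hB.
have px k : 0 <= p k * x ^+ k by rewrite mulr_ge0// exprn_ge0.
have cx : cvgn (pseries p x).
  by apply: (@cvg_series_bnd _ B) => // n; rewrite -[_ n]tgfE.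
have xR : (x%:E <= cvg_radius p)%E by apply: ereal_sup_ubound; exists x.
have : (x%:E < cvg_radius p)%E.
  rewrite lt_neqAle xR andbT; apply/eqP => E; move: hR; rewrite -E/= => hy.
  have : (\sum_(0 <= k <oo) (p k * x ^+ k)%:E <= B%:E)%E.
    apply: lime_le; first by apply: is_cvg_nneseries => k _ _; rewrite lee_fin.
    by apply: nearW => n; rewrite sumEFin lee_fin -[leLHS]/(pseries p x n) -tgfE.
  by rewrite hy leye_eq.
move=> /ereal_sup_gt[_ [y [y0 cy] <-]]; rewrite lte_fin => xy.
exists y, (limn (pseries p y)); split => // K; rewrite tgfE.
by apply: series_le_lim => // k; rewrite mulr_ge0// exprn_ge0.
Qed.

End generating_function.

(** * Exploration of two-type trees *)

(** The boolean is true for type s. *)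
Definition tvertex := (word * bool)%type.

(** The offspring of a vertex: the number of its children and the set of those of
    type s; a vertex is of type s exactly when this set is nonempty. *)
Definition offspring K := ('I_K * {set 'I_K})%type.

Definition in_set_ord K (J : {set 'I_K}) (i : nat) := [exists j in J, val j == i].

Definition children K (v : tvertex) (o : offspring K) : seq tvertex :=
  [seq (rcons v.1 i, in_set_ord o.2 i) | i <- iota 0 o.1].

Definition valid_offspring K (b : bool) (o : offspring K) :=
  (b == (o.2 != finset.set0)) && [forall i in o.2, (i < o.1)%N].

Definition vtx (st : seq tvertex) (i : 'I_(size st)) := tnth (in_tuple st) i.

Definition next_gen K (st : seq tvertex) (f : {ffun 'I_(size st) -> offspring K}) :
    seq tvertex :=
  flatten [seq children (vtx i) (f i) | i <- enum 'I_(size st)].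

Section offspring_sums.
Context {R : realType}.
Variables (p : nat -> R) (c : R) (N : word -> nat) (K : nat).
Hypotheses (p0 : forall k, 0 <= p k) (c0 : 0 <= c).

(** The factor that a vertex of type b contributes to the probability of a two-type
    tree: what remains of its reproduction law once the convolution powers, which
    depend on whole generations only, are set apart. *)
Definition weight (b : bool) (o : offspring K) : R :=
  if valid_offspring b o then
    (if b then c ^+ (o.1 - #|o.2|) else c ^+ o.1 / c) * p o.1
  else 0.

Lemma weight_ge0 b o : 0 <= weight b o.
Proof.
rewrite /weight; case: ifP => // _; rewrite mulr_ge0//.
by case: b; rewrite ?divr_ge0// exprn_ge0.
Qed.

Definition gen_weight (st : seq tvertex) (f : {ffun 'I_(size st) -> offspring K}) : R :=
  \prod_i (weight (vtx i).2 (f i) * (N (vtx i).1 <= (f i).1)%:R).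

Lemma gen_weight_ge0 st (f : {ffun 'I_(size st) -> offspring K}) : 0 <= gen_weight f.
Proof. by apply: prodr_ge0 => i _; rewrite mulr_ge0// weight_ge0. Qed.

(** The sum over the two-type trees of height n issued from [st], with at least [N u]
    and less than K children at each u. It is used for two functions g of the final
    number of type s vertices: powers, for which it factorizes over the vertices, and
    convolution powers, for which it is a probability. *)
Fixpoint explore (n : nat) (st : seq tvertex) (g : nat -> R) : R :=
  if n is m.+1 then
    \sum_(f : {ffun 'I_(size st) -> offspring K}) gen_weight f * explore m (next_gen f) g
  else g (count snd st).

Lemma weight_true_child u (o : offspring K) : weight true o != 0 ->
  has snd (children (u, true) o).
Proof.
rewrite /weight; case: ifPn; last by rewrite eqxx.
rewrite /valid_offspring eq_sym eqb_id => /andP[/set0Pn[j jJ] /forall_inP sub] _.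
apply/hasP; exists (rcons u j, true) => //=.
apply/mapP; exists (val j); first by rewrite mem_iota/= sub.
by congr pair; apply/esym/exists_inP; exists j.
Qed.

Lemma next_gen_has st (f : {ffun 'I_(size st) -> offspring K}) :
  gen_weight f != 0 -> has snd st -> has snd (next_gen f).
Proof.
move=> /prodf_neq0 w0 /hasP[v /(nthP v)[i ist vE] v2].
have := w0 (Ordinal ist) isT; rewrite mulf_eq0 negb_or => /andP[wi _].
have E : vtx (Ordinal ist) = v by rewrite /vtx (tnth_nth v).
rewrite E v2 in wi.
have := weight_true_child v.1 wi => /hasP[x xin x2].
apply/hasP; exists x => //; apply/flattenP.
exists (children (vtx (Ordinal ist)) (f (Ordinal ist))).
  by apply/mapP; exists (Ordinal ist); rewrite ?mem_enum.
by rewrite E -v2 -surjective_pairing in xin *.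
Qed.

(** The final number of type s vertices is positive, as a type s vertex always has a
    type s child: this is the range where convolution powers of [w] make sense. *)
Lemma explore_linear n st : has snd st ->
  exists s : seq (R * nat), (forall x, x \in s -> 0 <= x.1 /\ (0 < x.2)%N) /\
    forall g, explore n st g = \sum_(x <- s) x.1 * g x.2.
Proof.
elim: n st => [|n IH] st hst.
  exists [:: (1, count snd st)]; split.
    by move=> x; rewrite inE => /eqP -> /=; rewrite -has_count.
  by move=> g; rewrite big_seq1/= mul1r.
have H (f : {ffun 'I_(size st) -> offspring K}) : exists s : seq (R * nat),
    (forall x, x \in s -> 0 <= x.1 /\ (0 < x.2)%N) /\
    forall g, gen_weight f * explore n (next_gen f) g = \sum_(x <- s) x.1 * g x.2.
  have [w0|w0] := eqVneq (gen_weight f) 0.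
    by exists [::]; split=> // g; rewrite w0 mul0r big_nil.
  have [s [s0 sE]] := IH _ (next_gen_has w0 hst).
  exists [seq (gen_weight f * x.1, x.2) | x <- s]; split.
    move=> _ /mapP[x xs ->] /=; have [? ?] := s0 _ xs.
    by rewrite mulr_ge0 ?gen_weight_ge0.
  by move=> g; rewrite sE big_map mulr_sumr; apply: eq_bigr => x _; rewrite mulrA.
have [s sP] := boolp.choice H.
exists (flatten [seq s f | f <- index_enum _]); split.
  by move=> x /flattenP[_ /mapP[f _ ->]] /(sP f).1.
move=> g; rewrite big_flatten/= big_map; apply: eq_bigr => f _.
exact: (sP f).2.
Qed.

Lemma explore_ge0 n st g : (forall r, 0 <= g r) -> 0 <= explore n st g.
Proof.
move=> g0; elim: n st => //= n IH st; apply: sumr_ge0 => f _.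
by rewrite mulr_ge0 ?gen_weight_ge0.
Qed.

Section values.
Hypothesis cp0 : c = 0 -> p 0%N = 0.
Variable x : R.

(** With x in the role of the integral of [w] against an exponential, [fullv] is
    an exponential moment on the event that each descendant v of u has at least
    [N v] children, and [c * extv] its part on extinction. *)
Fixpoint fullv n (u : word) : R :=
  if n is m.+1 then
    \sum_(k < K) (N u <= k)%:R * (p k * \prod_(i < k) fullv m (rcons u i))
  else c + x.

Fixpoint extv n (u : word) : R :=
  if n is m.+1 then
    \sum_(k < K) (N u <= k)%:R * (c ^+ k / c * p k * \prod_(i < k) extv m (rcons u i))
  else 1.

Definition typedv n (v : tvertex) : R :=
  if v.2 then fullv n v.1 - c * extv n v.1 else extv n v.1.

Lemma extvE n u : c * extv n.+1 u =
  \sum_(k < K) (N u <= k)%:R * (p k * \prod_(i < k) (c * extv n (rcons u i))).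
Proof.
rewrite /= mulr_sumr; apply: eq_bigr => k _.
rewrite mulrCA; congr (_ * _).
rewrite big_split/= prodr_const card_ord.
have [c00|cn0] := eqVneq c 0; last by field.
rewrite c00 mul0r; case: (posnP k) => [->|k0]; first by rewrite cp0// mul0r.
by rewrite expr0n gtn_eqF// mul0r mulr0.
Qed.

Lemma prod_children b u n (k : 'I_K) (J : {set 'I_K}) :
  \prod_(v <- children (u, b) (k, J)) typedv n v =
  \prod_(i < k) typedv n (rcons u i, in_set_ord J i).
Proof. by rewrite big_map/= -[k in iota _ k]subn0 big_mkord. Qed.

Lemma in_set_ordE (J : {set 'I_K}) (i : 'I_K) : in_set_ord J i = (i \in J).
Proof.
apply/exists_inP/idP => [[j jJ /eqP/val_inj <-//]|iJ]; by exists i.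
Qed.

Lemma prod_ord_if (k : 'I_K) (F : nat -> R) :
  \prod_(i < K) (if (i < k)%N then F i else 1) = \prod_(i < k) F i.
Proof.
by rewrite (big_ord_widen _ F (ltnW (ltn_ord k))) [RHS]big_mkcond.
Qed.

(** The product of the [(a i - c * g i) + c * g i] expands over the sets J; the empty
    set gives the subtracted product. *)
Lemma sum_nonempty_subsets (k : 'I_K) (a g : nat -> R) :
  \sum_(J : {set 'I_K} | (J != finset.set0) && [forall i in J, (i < k)%N])
     c ^+ (k - #|J|) * \prod_(i < k) (if in_set_ord J i then a i - c * g i else g i)
  = \prod_(i < k) a i - \prod_(i < k) (c * g i).
Proof.
pose F (i : 'I_K) := if (i < k)%N then a i - c * g i else 0.
pose G (i : 'I_K) := if (i < k)%N then c * g i else 1.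
rewrite -(prod_ord_if k a) -(prod_ord_if k (fun i => c * g i)).
have -> : \prod_(i < K) (if (i < k)%N then a i else 1) = \prod_(i < K) (F i + G i).
  by apply: eq_bigr => i _; rewrite /F /G; case: ifP => _; rewrite ?subrK ?add0r.
rewrite (bigA_distr _ _ F G) [X in _ = X - _](bigD1 finset.set0)//=.
rewrite [X in _ = X + _ - _](_ : _ = \prod_(i < K) G i); last first.
  by apply: eq_bigr => i _; rewrite inE.
rewrite addrC addKr big_mkcondr; apply: eq_bigr => J J0.
case: ifPn => [/forall_inP sub|/forall_inPn[i iJ ik]]; last first.
  by rewrite (bigD1 i)//= iJ /F (negPf ik) mul0r.
have -> : c ^+ (k - #|J|) = \prod_(i < K) (if (i < k)%N && (i \notin J) then c else 1).
  rewrite -big_mkcond prodr_const; congr (c ^+ _).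
  pose A := [set i : 'I_K | (i < k)%N]%SET.
  have kA : k = #|A| :> nat.
    rewrite -sum1_card -[LHS]card_ord -sum1_card.
    rewrite (big_ord_widen _ (fun=> 1%N) (ltnW (ltn_ord k))).
    by apply: eq_bigl => i; rewrite inE.
  have sJ : J \subset A by apply/fintype.subsetP => i iJ; rewrite inE sub.
  rewrite {1}kA -(cardsDS sJ).
  by apply: eq_card => i; rewrite !inE andbC.
rewrite -(prod_ord_if k (fun i => if in_set_ord J i then a i - c * g i else g i)).
rewrite -big_split/=; apply: eq_bigr => i _; rewrite in_set_ordE /F /G.
by case: (boolP (i \in J)) => iJ; case: ltnP => ik /=; rewrite ?mul1r//;
  have := sub _ iJ; rewrite ltnNge ik.
Qed.

Lemma sum_offspring n v :
  \sum_(o : offspring K) weight v.2 o * (N v.1 <= o.1)%:R *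
     \prod_(v' <- children v o) typedv n v' = typedv n.+1 v.
Proof.
case: v => u b /=.
rewrite -(pair_bigA _ (fun (k : 'I_K) (J : {set 'I_K}) =>
  weight b (k, J) * (N u <= k)%:R *
  \prod_(v' <- children (u, b) (k, J)) typedv n v'))/=.
case: b; rewrite /typedv/=; last first.
  apply: eq_bigr => k _; rewrite (bigD1 finset.set0)//= [X in _ + X]big1 ?addr0; last first.
    by move=> J J0; rewrite /weight /valid_offspring/= J0 !mul0r.
  rewrite /weight /valid_offspring/= eqxx/=.
  rewrite ifT; last by apply/forall_inP => i; rewrite inE.
  rewrite prod_children mulrAC mulrC; congr (_ * (_ * _)).
  apply: eq_bigr => i _; rewrite /typedv/=.
  by case: ifPn => // /exists_inP[j]; rewrite inE.
rewrite -/(extv n.+1 u) extvE -sumrB; apply: eq_bigr => k _.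
rewrite -!mulrBr -(sum_nonempty_subsets k (fun i => fullv n (rcons u i))
  (fun i => extv n (rcons u i))) [in RHS]big_mkcond !mulr_sumr.
apply: eq_bigr => J _; rewrite prod_children /weight /valid_offspring/=.
rewrite [true == _]eq_sym eqb_id.
case: ifPn => _; last by rewrite !mul0r mulr0 mulr0.
by rewrite /typedv/=; ring.
Qed.

(** For powers of x the exploration has the branching property: the children of a
    type e vertex contribute independent extinct trees, those of a type s vertex
    independent trees, not all of them extinct. *)
Lemma exploreX n st :
  explore n st (fun r => x ^+ r) = \prod_(v <- st) typedv n v.
Proof.
elim: n st => [|n IH] st.
  elim: st => [|v st IHst]; first by rewrite big_nil /= expr0.
  rewrite big_cons -IHst /= exprD /typedv/=; case: ifP => _ //=.
  by rewrite mulr1 [c + x]addrC addrK expr1.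
rewrite [RHS]big_tnth.
under [RHS]eq_bigr do rewrite -sum_offspring.
rewrite bigA_distr_bigA/=; apply: eq_bigr => f _.
rewrite IH /next_gen big_flatten/= big_map big_enum/= /gen_weight -big_split/=.
by [].
Qed.

Hypothesis x0 : 0 <= x.

Lemma fullv_ge0 n u : 0 <= fullv n u.
Proof.
elim: n u => [|n IH] u /=; first by rewrite addr_ge0.
by apply: sumr_ge0 => k _; rewrite !mulr_ge0// prodr_ge0.
Qed.

Lemma extv_ge0 n u : 0 <= extv n u.
Proof.
elim: n u => [|n IH] u //=.
by apply: sumr_ge0 => k _; rewrite !mulr_ge0// ?invr_ge0// ?exprn_ge0// prodr_ge0.
Qed.

Lemma extv_le n u : \sum_(k < K) p k * c ^+ k <= c -> c * extv n u <= c.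
Proof.
move=> hc; elim: n u => [|n IH] u; first by rewrite mulr1.
rewrite extvE; apply: le_trans hc; apply: ler_sum => k _.
rewrite -[leRHS]mul1r; apply: ler_pM => //.
- by rewrite mulr_ge0// prodr_ge0// => i _; rewrite mulr_ge0// extv_ge0.
- by rewrite lern1 leq_b1.
rewrite ler_wpM2l// -[k in c ^+ k]card_ord -prodr_const.
by apply: ler_prod => i _; rewrite IH mulr_ge0// extv_ge0.
Qed.

End values.
End offspring_sums.

(** * Probabilities of the explored trees *)

Section sigma_algebras.
Variables (T : Type) (M : set (set T)).
Hypothesis sM : sigma_algebra setT M.

Lemma sigma_setC A : M A -> M (~` A).
Proof. by case: sM => _ H _ MA; rewrite -setTD; exact: H. Qed.

Lemma sigma_forall (I : countType) (F : I -> set T) :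
  (forall i, M (F i)) -> M [set o | forall i, F i o].
Proof.
move=> MF.
have -> : [set o | forall i, F i o] =
    ~` \bigcup_n (if choice.unpickle n is Some i then ~` F i else set0).
  apply/seteqP; split => o /=.
    by move=> Fo [n _]; case: choice.unpickle => // i; apply; exact: Fo.
  move=> nF i; apply: contrapT => nFi; apply: nF.
  by exists (choice.pickle i) => //; rewrite choice.pickleK.
apply: sigma_setC; case: sM => M0 _ MU; apply: MU => n.
by case: choice.unpickle => // i; exact: sigma_setC.
Qed.

Lemma sigma_setT : M setT.
Proof. by rewrite -setC0; apply: sigma_setC; case: sM. Qed.

Lemma sigma_imply (Q : Prop) A : (Q -> M A) -> M [set o | Q -> A o].
Proof.
move=> MA; have [q|nq] := pselect Q.
  by rewrite (_ : [set _ | _] = A)//; [exact: MA|apply/seteqP; split => o /=; auto].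
rewrite (_ : [set _ | _] = setT); first exact: sigma_setT.
by apply/seteqP; split => // o _ /nq.
Qed.

Lemma sigma_setI A B : M A -> M B -> M (A `&` B).
Proof.
move=> MA MB; rewrite (_ : _ `&` _ = [set o | forall b : bool, (if b then A else B) o]).
  by apply: sigma_forall => -[].
by apply/seteqP; split => o /=; [case=> ? ? []|move=> H; split; [exact: (H true)|exact: (H false)]].
Qed.

Lemma sigma_iff A (Q : Prop) : M A -> M [set o | A o <-> Q].
Proof.
move=> MA; have [q|nq] := pselect Q.
  by rewrite (_ : [set _ | _] = A)//; apply/seteqP; split => o /=; tauto.
rewrite (_ : [set _ | _] = ~` A); first exact: sigma_setC.
by apply/seteqP; split => o /=; tauto.
Qed.

Lemma sigma_imply2 A B : M A -> M B -> M [set o | A o -> B o].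
Proof.
move=> MA MB; rewrite (_ : [set _ | _] = ~` (A `&` ~` B)).
  by apply/sigma_setC/sigma_setI => //; exact: sigma_setC.
apply/seteqP; split => o /=; first by move=> AB [/AB].
by move=> nAB Ao; apply: contrapT => nB; exact: nAB.
Qed.

End sigma_algebras.

Section probability_values.
Context {R : realType} {d : measure_display} {Omega : measurableType d}.
Variable P : probability Omega R.

Definition Pr (A : set Omega) : R := fine (P A).

Lemma PrE A : measurable A -> P A = (Pr A)%:E.
Proof. by move=> mA; rewrite /Pr fineK// fin_num_measure. Qed.

Lemma Pr_ge0 A : 0 <= Pr A. Proof. exact: fine_ge0. Qed.

Lemma Pr_setT : Pr setT = 1.
Proof. by rewrite /Pr probability_setT. Qed.

Lemma Pr_set0 : Pr set0 = 0. Proof. by rewrite /Pr measure0. Qed.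

Lemma Pr_le A B : measurable A -> measurable B -> A `<=` B -> Pr A <= Pr B.
Proof.
by move=> mA mB AB; rewrite fine_le// ?fin_num_measure// le_measure ?inE.
Qed.

Lemma Pr_split A B : measurable A -> measurable B ->
  Pr A = Pr (A `&` B) + Pr (A `\` B).
Proof.
move=> mA mB; apply: EFin_inj.
by rewrite EFinD -!PrE//; [rewrite (measureDI P mA mB) addeC|exact: measurableD|exact: measurableI].
Qed.

Lemma sum_Pr_le (I : eqType) (r : seq I) (E : I -> set Omega) B : uniq r ->
  measurable B -> (forall i, i \in r -> measurable (E i)) ->
  (forall i, i \in r -> E i `<=` B) ->
  (forall i j o, i \in r -> j \in r -> E i o -> E j o -> i = j) ->
  \sum_(i <- r) Pr (E i) <= Pr B.
Proof.
elim: r B => [|i r IH] B /=; first by rewrite big_nil Pr_ge0.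
move=> /andP[ir ur] mB mE EB dE; rewrite big_cons.
have mEi : measurable (E i) by apply: mE; rewrite mem_head.
rewrite (Pr_split mB mEi) [B `&` _]setIC setIidl; last by apply: EB; rewrite mem_head.
rewrite lerD2l; apply: IH => //.
- exact: measurableD.
- by move=> j jr; apply: mE; rewrite inE jr orbT.
- move=> j jr o Ejo; split; first by apply: (EB j) => //; rewrite inE jr orbT.
  move=> Eio; have E1 := dE i j o _ _ Eio Ejo.
  by move: ir; rewrite E1 ?jr// ?inE ?eqxx// jr orbT.
- by move=> j k o jr kr; apply: dE; rewrite inE ?jr ?kr orbT.
Qed.

End probability_values.

Section trees.

Variant nb_children_spec (t : tree) (u : word) : child_count -> Prop :=
| NbAbsent of ~ vertices t u : nb_children_spec t u count_absent
| NbNat k of vertices t u & (forall i, vertices t (rcons u i) <-> (i < k)%N) :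
    nb_children_spec t u (count_nat k)
| NbInfty of vertices t u & (forall i, vertices t (rcons u i)) :
    nb_children_spec t u count_infty.

Lemma nb_childrenP t u : nb_children_spec t u (nb_children t u).
Proof.
rewrite /nb_children; case: asboolP => /= tu; last exact: NbAbsent.
have [[n|] tk] := tree_children tu.
  have -> : [set i | vertices t (rcons u i)] = `I_n.
    by apply/seteqP; split => i /=; rewrite tk.
  rewrite ifT; last by apply/asboolP/finite_II.
  by rewrite (card_fset_set (card_eqxx _)); apply: NbNat.
have -> : [set i | vertices t (rcons u i)] = setT.
  by apply/seteqP; split => i //= _; exact/tk.
rewrite ifF; first by apply: NbInfty => // i; exact/tk.
by apply/negP => /asboolP; exact: infinite_nat.
Qed.

Lemma nb_childrenE t u k : nb_children t u = count_nat k <->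
  vertices t u /\ forall i, vertices t (rcons u i) <-> (i < k)%N.
Proof.
case: nb_childrenP => [ntu|n tu tn|tu tn]; split => //.
- by case.
- by case=> <-.
- move=> [_ tk]; congr count_nat; apply/eqP; rewrite eqn_leq.
  apply/andP; split; rewrite leqNgt; apply/negP.
    by move=> /tn /tk; rewrite ltnn.
  by move=> /tk /tn; rewrite ltnn.
- by move=> [_ tk]; have := tn k; rewrite tk ltnn.
Qed.

(** Lower bounds, rather than exact values, are continuous functions of the numbers of
    children, even at infinity, and yet they determine the law of a tree. *)
Definition at_least (N : word -> nat) (h n : nat) (t : tree) : Prop :=
  forall u, vertices t u -> (h <= size u < h + n)%N ->
  forall i, (i < N u)%N -> vertices t (rcons u i).

End trees.

Section measurable_trees.
Context {d : measure_display} {Omega : measurableType d}.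
Variables (T : Omega -> tree).
Hypothesis rT : random_tree T.

Lemma measurable_vertex u : measurable [set o | vertices (T o) u].
Proof.
rewrite (_ : [set _ | _] = ~` [set o | nb_children (T o) u = count_absent]).
  exact/measurableC/rT.
by apply/seteqP; split => o /=; case: nb_childrenP.
Qed.

Let sM := @sigma_algebra_measurable d Omega.

Lemma measurable_at_least N h n : measurable [set o | at_least N h n (T o)].
Proof.
rewrite /at_least.
apply: (sigma_forall sM) => u; apply: (sigma_imply2 sM); first exact: measurable_vertex.
apply: (sigma_imply sM) => _; apply: (sigma_forall sM) => i.
by apply: (sigma_imply sM) => _; exact: measurable_vertex.
Qed.

End measurable_trees.

Section exploration.
Context {R : realType} {d : measure_display} {Omega : measurableType d}.
Variables (P : probability Omega R) (p : nat -> R) (c : R) (w : R -> R) (theta : R).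
Variables (T : Omega -> tree) (S : Omega -> set word) (K : nat).
Notation mu := (fine (mean p)).
Hypotheses (p0 : forall k, 0 <= p k) (cp : inner_cvg p) (c0 : 0 <= c) (c1 : c < 1).
Hypotheses (mu0 : 0 < mu) (theta0 : 0 < theta) (dw : cv_density w).
Hypothesis hT : is_tau_theta P p c w theta T S.

Let rT : random_tree T. Proof. by case: hT => -[]. Qed.
Let mS u : measurable [set o | S o u]. Proof. by case: hT => -[]. Qed.

Lemma typed_past_sigma h : sigma_algebra setT (typed_past T S h).
Proof. exact: smallest_sigma_algebra. Qed.

Lemma typed_past_sub h A : typed_past T S h A -> measurable A.
Proof.
apply: smallest_sub; first exact: sigma_algebra_measurable.
by move=> _ [[u _ <-]|[u _ <-]]; [exact: measurable_vertex|exact: mS].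
Qed.

Lemma typed_pastS h A : typed_past T S h A -> typed_past T S h.+1 A.
Proof.
apply: sub_smallest2r; first exact: smallest_sigma_algebra.
by move=> _ [[u uh <-]|[u uh <-]]; [left|right]; exists u => //=; exact: leqW.
Qed.

Lemma typed_past_vertex h u : (size u <= h)%N ->
  typed_past T S h [set o | vertices (T o) u].
Proof. by move=> uh; apply: sub_gen_smallest; left; exists u. Qed.

Lemma typed_past_type h u : (size u <= h)%N -> typed_past T S h [set o | S o u].
Proof. by move=> uh; apply: sub_gen_smallest; right; exists u. Qed.

(** What the exploration knows at generation h, as the invariant of an induction. *)
Record state (h : nat) (st : seq tvertex) (A : set Omega) : Prop := State {
  state_past : typed_past T S h A;
  state_uniq : uniq [seq v.1 | v <- st];
  state_size : forall v, v \in st -> size v.1 = h;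
  state_in : forall o v, A o -> v \in st ->
    vertices (T o) v.1 /\ (S o v.1 <-> v.2);
  state_all : forall o u, A o -> size u = h -> vertices (T o) u ->
    u \in [seq v.1 | v <- st];
  state_has : has snd st }.

Definition event (st : seq tvertex) (f : {ffun 'I_(size st) -> offspring K}) :
    set Omega :=
  [set o | forall i, nb_children (T o) (vtx i).1 = count_nat (f i).1 /\
     forall j, S o (rcons (vtx i).1 j) <-> in_set_ord (f i).2 j].

Definition valid_gen (st : seq tvertex) (f : {ffun 'I_(size st) -> offspring K}) :=
  [forall i, valid_offspring (vtx i).2 (f i)].

Lemma vtx_in st (i : 'I_(size st)) : vtx i \in st.
Proof. exact: mem_tnth. Qed.

Lemma typed_past_event h st A (f : {ffun 'I_(size st) -> offspring K}) :
  state h st A -> typed_past T S h.+1 (event f).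
Proof.
move=> sA; have sM := typed_past_sigma h.+1.
have sz (i : 'I_(size st)) : size (vtx i).1 = h by exact: (state_size sA (vtx_in i)).
apply: (sigma_forall sM) => i; apply: (sigma_setI sM).
  rewrite (_ : (fun o => _) = [set o | vertices (T o) (vtx i).1] `&`
      [set o | forall j, vertices (T o) (rcons (vtx i).1 j) <-> (j < (f i).1)%N]).
    apply: (sigma_setI sM); first by apply: typed_past_vertex; rewrite sz.
    apply: (sigma_forall sM) => j; apply: (sigma_iff sM).
    by apply: typed_past_vertex; rewrite size_rcons sz.
  by apply/seteqP; split => o /= /nb_childrenE.
apply: (sigma_forall sM) => j; apply: (sigma_iff sM).
by apply: typed_past_type; rewrite size_rcons sz.
Qed.

Lemma mem_next_gen st (f : {ffun 'I_(size st) -> offspring K}) u b :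
  reflect (exists i j, [/\ u = rcons (vtx i).1 j, (j < (f i).1)%N & b = in_set_ord (f i).2 j])
    ((u, b) \in next_gen f).
Proof.
apply: (iffP flattenP) => [[_ /mapP[i _ ->] /mapP[j]]|[i [j [-> jf ->]]]].
  by rewrite mem_iota/= => jf [-> ->]; exists i, j.
exists (children (vtx i) (f i)); first by apply/mapP; exists i; rewrite ?mem_enum.
by apply/mapP; exists j; rewrite ?mem_iota.
Qed.

Lemma vtx_inj st : uniq [seq v.1 | v <- st] ->
  injective (fun i : 'I_(size st) => (vtx i).1).
Proof.
move=> ust i j; rewrite /vtx !(tnth_nth ([::], true)) /= => E; apply/val_inj/eqP => /=.
by rewrite -(nth_uniq [::] _ _ ust) ?size_map// !(nth_map ([::], true))//; exact/eqP.
Qed.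

Lemma mem_vtx st v : v \in st -> exists i : 'I_(size st), vtx i = v.
Proof.
move=> /(nthP v)[i ist <-]; exists (Ordinal ist).
by rewrite /vtx (tnth_nth v).
Qed.

Lemma next_gen_uniq st (f : {ffun 'I_(size st) -> offspring K}) :
  uniq [seq v.1 | v <- st] -> uniq [seq v.1 | v <- next_gen f].
Proof.
move=> ust.
have -> : [seq v.1 | v <- next_gen f] =
    [seq rcons (vtx i).1 j | i <- enum 'I_(size st), j <- iota 0 (f i).1].
  rewrite /next_gen map_flatten -!map_comp; congr flatten; apply: eq_map => i /=.
  by rewrite /children -map_comp.
apply: allpairs_uniq_dep => [|i _|x y _ _]; rewrite ?enum_uniq ?iota_uniq//.
case: x y => [i j] [i' j'] /= /rcons_inj[/(vtx_inj ust) ii' jj'].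
by rewrite ii' jj'.
Qed.

Lemma state_next h st A (f : {ffun 'I_(size st) -> offspring K}) :
  state h st A -> valid_gen f -> state h.+1 (next_gen f) (A `&` event f).
Proof.
move=> sA /forallP vf; have sM := typed_past_sigma h.+1.
have sz (i : 'I_(size st)) : size (vtx i).1 = h by exact: (state_size sA (vtx_in i)).
split.
- apply: (sigma_setI sM); first exact: typed_pastS (state_past sA).
  exact: typed_past_event sA.
- exact: next_gen_uniq (state_uniq sA).
- by move=> [u b] /mem_next_gen[i [j [-> _ _]]] /=; rewrite size_rcons sz.
- move=> o [u b] [Ao Eo] /mem_next_gen[i [j [-> jf ->]]] /=.
  have [/nb_childrenE[_ nb] Sj] := Eo i; split; first exact/nb.
  exact: Sj.
- move=> o u [Ao Eo]; case: (lastP u) => // {}u j; rewrite size_rcons => -[uh] uj.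
  have := state_all sA Ao uh (tree_prefix uj).
  move=> /mapP[v /mem_vtx[i <-] ui].
  have [/nb_childrenE[_ nb] _] := Eo i.
  apply/mapP; exists (rcons u j, in_set_ord (f i).2 j) => //.
  by apply/mem_next_gen; exists i, j; rewrite ui; split => //; apply/nb; rewrite -ui.
- have /hasP[v /mem_vtx[i <-] vi] := state_has sA.
  have := vf i; rewrite /valid_offspring vi => /andP[/eqP/esym/set0Pn[j jf] /forall_inP sub].
  apply/hasP; exists (rcons (vtx i).1 j, true) => //.
  apply/mem_next_gen; exists i, (val j); split => //; first exact: sub.
  by rewrite in_set_ordE.
Qed.

Lemma event_disjoint h st A (f f' : {ffun 'I_(size st) -> offspring K}) o :
  state h st A -> event f o -> event f' o -> f = f'.
Proof.
move=> sA Eo Eo'; apply/ffunP => i.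
have [nb Sj] := Eo i; have [nb' Sj'] := Eo' i.
rewrite [f i]surjective_pairing [f' i]surjective_pairing; congr pair.
  by move: nb'; rewrite nb => -[/val_inj].
apply/setP => j; rewrite -!in_set_ordE; apply/idP/idP.
  by move=> /Sj /Sj'.
by move=> /Sj' /Sj.
Qed.

(** The function [g] of the induction: up to a constant factor depending on the
    tree, [mass j r / w theta] is the probability of a tree whose generation j
    has r vertices of type s. *)
Definition mass (j r : nat) : R := mu ^+ j * convol_pow w r (mu ^+ j * theta).

Lemma mass_gt0 j r : 0 < mass j r.
Proof.
rewrite mulr_gt0 ?exprn_gt0// (cvd_gt0 (cv_density_pow r dw))//.
by rewrite mulr_gt0 ?exprn_gt0.
Qed.

Lemma mass_ge0 j r : 0 <= mass j r.
Proof. exact/ltW/mass_gt0. Qed.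

Lemma count_next_gen st (f : {ffun 'I_(size st) -> offspring K}) : valid_gen f ->
  count snd (next_gen f) = (\sum_i #|(f i).2|)%N.
Proof.
move=> /forallP vf; rewrite /next_gen count_flatten sumnE 2!big_map big_enum/=.
apply: eq_bigr => i _; rewrite /children count_map -sum1_card.
have /andP[_ /forall_inP sub] := vf i.
rewrite -sum1_count big_mkcond/= -[X in iota _ X]subn0 big_mkord.
rewrite (big_ord_widen K (fun j => if in_set_ord (f i).2 j then 1 else 0)%N); last exact/ltnW.
rewrite big_mkcond [RHS]big_mkcond; apply: eq_bigr => j _.
rewrite in_set_ordE; case: (boolP (j \in _)) => jf; last by case: ifP.
by rewrite sub.
Qed.

Definition Wt (st : seq tvertex) (f : {ffun 'I_(size st) -> offspring K}) : R :=
  \prod_i weight p c (vtx i).2 (f i).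

(** The convolution powers in [rho] are those of [mass] at two successive
    generations, so that they cancel along the generations; the other factors are a
    product over the vertices. *)
Lemma kernel h st A (f : {ffun 'I_(size st) -> offspring K}) :
  state h st A -> valid_gen f ->
  Pr P (A `&` event f) * mass h (count snd st) =
  Pr P A * Wt f * mass h.+1 (count snd (next_gen f)).
Proof.
move=> sA vf; have ust := state_uniq sA.
pose ix u := [pick i : 'I_(size st) | (vtx i).1 == u].
pose k u := if ix u is Some i then val (f i).1 else 0%N.
pose J u := if ix u is Some i then [fset val j | j in (f i).2]%fset else fset0.
have ixE i : ix (vtx i).1 = Some i.
  rewrite /ix; case: pickP => [j /eqP/(vtx_inj ust) -> //|/(_ i)].
  by rewrite eqxx.
have kE i : k (vtx i).1 = (f i).1 by rewrite /k ixE.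
have JE i j : (j \in J (vtx i).1) = in_set_ord (f i).2 j.
  rewrite /J ixE; apply/imfsetP/exists_inP => /=.
    by move=> [m mf ->]; exists m.
  by move=> [m mf /eqP <-]; exists m.
have cJ i : #|` J (vtx i).1| = #|(f i).2|.
  by rewrite /J ixE card_imfset/= -?cardE//; exact: val_inj.
pose s := [seq v.1 | v <- st & v.2].
pose e := [seq v.1 | v <- st & ~~ v.2].
have sum_s (F : word -> R) :
    \prod_(u <- s) F u = \prod_(i < size st | (vtx i).2) F (vtx i).1.
  by rewrite /s big_map big_filter (big_tnth _ _ st).
have sum_e (F : word -> R) :
    \prod_(u <- e) F u = \prod_(i < size st | ~~ (vtx i).2) F (vtx i).1.
  by rewrite /e big_map big_filter (big_tnth _ _ st).
have mem_s u : u \in s -> exists2 i : 'I_(size st), (vtx i).1 = u & (vtx i).2.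
  move=> /mapP[v]; rewrite mem_filter => /andP[v2 /mem_vtx[i iv]] ->.
  by exists i; rewrite iv.
have mem_e u : u \in e -> exists2 i : 'I_(size st), (vtx i).1 = u & ~~ (vtx i).2.
  move=> /mapP[v]; rewrite mem_filter => /andP[v2 /mem_vtx[i iv]] ->.
  by exists i; rewrite iv.
have in_s (i : 'I_(size st)) : (vtx i).2 -> (vtx i).1 \in s.
  by move=> i2; apply/mapP; exists (vtx i); rewrite // mem_filter i2 vtx_in.
have in_e (i : 'I_(size st)) : ~~ (vtx i).2 -> (vtx i).1 \in e.
  by move=> i2; apply/mapP; exists (vtx i); rewrite // mem_filter i2 vtx_in.
have sz (i : 'I_(size st)) : size (vtx i).1 = h by exact: (state_size sA (vtx_in i)).
have us : uniq s by apply: subseq_uniq ust; exact/map_subseq/filter_subseq.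
have ue : uniq e by apply: subseq_uniq ust; exact/map_subseq/filter_subseq.
have size_s : size s = count snd st by rewrite size_map size_filter.
have sn0 : s != [::] by rewrite -size_eq0 size_s -lt0n -has_count (state_has sA).
have As o : A o -> [set u | S o u /\ size u = h] = [set` s].
  move=> Ao; apply/seteqP; split => u /=.
    move=> [Su uh]; have [[_ _ _ SV _] _] := hT.
    have /mapP[v vst uv] := state_all sA Ao uh (SV _ _ Su).
    have [_ Sv] := state_in sA Ao vst.
    by apply/mapP; exists v => //; rewrite mem_filter vst andbT; apply/Sv; rewrite -uv.
  move=> /mem_s[i <- i2]; split; last exact: sz.
  by have [_ H] := state_in sA Ao (vtx_in i); apply/H.
have He1 u : u \in e -> size u = h by move=> /mem_e[i <- _]; exact: sz.
have He2 o u : A o -> u \in e -> vertices (T o) u /\ ~ S o u.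
  move=> Ao /mem_e[i <- i2]; have [H1 H2] := state_in sA Ao (vtx_in i).
  by split => // /H2; exact/negP.
have HJ u : u \in s -> (0 < #|` J u|)%N /\ forall i, i \in J u -> (i < k u)%N.
  move=> /mem_s[i <- i2]; move/forallP: (vf) => /(_ i); rewrite /valid_offspring i2.
  move=> /andP[/eqP/esym J0 /forall_inP sub]; split; first by rewrite cJ card_gt0.
  by move=> j; rewrite JE kE => /exists_inP[m mf /eqP <-]; exact: sub.
have HP := hT.2 h A s e k J (state_past sA) us ue sn0 As He1 He2 HJ.
have EE : A `&` event f = A `&` [set o | forall u, u \in s ->
      nb_children (T o) u = count_nat (k u) /\ forall i, S o (rcons u i) <-> i \in J u]
    `&` [set o | forall u, u \in e -> nb_children (T o) u = count_nat (k u)].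
  apply/seteqP; split => o /=.
    move=> [Ao Eo]; split; [split => //|] => u.
      move=> /mem_s[i <- i2]; have [H1 H2] := Eo i; rewrite kE; split => // j.
      by rewrite JE.
    by move=> /mem_e[i <- i2]; have [H1 H2] := Eo i; rewrite kE.
  move=> [[Ao Hs] He]; split => // i.
  have [i2|i2] := boolP (vtx i).2.
    have [H1 H2] := Hs _ (in_s _ i2); rewrite kE in H1; split => // j.
    by rewrite -JE.
  have H1 := He _ (in_e _ i2); rewrite kE in H1; split => // j.
  move/forallP: (vf) => /(_ i); rewrite /valid_offspring (negPf i2).
  move=> /andP[/eqP/esym/negPn/eqP J0 _]; split.
    have [_ nS] := He2 _ _ Ao (in_e _ i2).
    by have [[_ _ _ _ SP] _] := hT; move=> /SP.
  by rewrite J0 => /exists_inP[m]; rewrite inE.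
rewrite -EE in HP.
have mA := typed_past_sub (state_past sA).
have mE : measurable (event f) by exact: typed_past_sub (typed_past_event f sA).
rewrite !PrE// in HP; last exact: measurableI.
rewrite -EFinM in HP; case: HP => ->.
have sumJ : sumn [seq #|` J u| | u <- s] = count snd (next_gen f).
  rewrite count_next_gen// sumnE big_map /s big_map big_filter (big_tnth _ _ st).
  rewrite big_mkcond/=; apply: eq_bigr => i _; case: ifPn => i2; first exact: cJ.
  move/forallP: (vf) => /(_ i); rewrite /valid_offspring (negPf i2).
  by move=> /andP[/eqP/esym/negPn/eqP -> _]; rewrite cards0.
have WtE : (\prod_(u <- s) (derive1n #|` J u| (gf p) c / (#|` J u|)`!%:R)) *
    (\prod_(u <- s) (pbracket p c #|` J u| (k u) / 'C(k u, #|` J u|)%:R)) *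
    \prod_(u <- e) pfrak p c (k u) = Wt f.
  rewrite /Wt (bigID (fun i => (vtx i).2))/= sum_e -big_split/= sum_s; congr (_ * _).
    apply: eq_bigr => i i2; rewrite cJ kE /weight.
    move/forallP: (vf) => /(_ i) vi; rewrite vi i2.
    apply: pbracket_factor => //; move: vi => /andP[_ /forall_inP sub].
    rewrite -[leqRHS]card_ord; apply: leq_trans (_ : #|[set j : 'I_K | (j < (f i).1)%N]%SET| <= _)%N.
      by apply/subset_leq_card/fintype.subsetP => j jf; rewrite inE sub.
    rewrite card_ord -sum1_card.
    rewrite (eq_bigl (fun j : 'I_K => (j < (f i).1)%N)); last by move=> j; rewrite inE.
    by rewrite -(big_ord_widen K (fun=> 1%N)) ?sum1_card ?card_ord// ltnW.
  apply: eq_bigr => i i2; rewrite kE /weight.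
  by move/forallP: (vf) => /(_ i) ->; rewrite (negPf i2).
rewrite /rho size_map size_s sumJ [\prod_(i <- map _ _) _]big_map.
rewrite -WtE /mass.
set a := convol_pow w (count snd st) _.
have a0 : a != 0.
  by rewrite gt_eqF// (cvd_gt0 (cv_density_pow _ dw))// mulr_gt0// exprn_gt0.
rewrite [mu * (mu ^+ h * theta)]mulrA -exprS.
by set b := convol_pow w _ _; rewrite exprS; field.
Qed.

Definition alive (N : word -> nat) st (f : {ffun 'I_(size st) -> offspring K}) :=
  [forall i, (N (vtx i).1 <= (f i).1)%N].

Lemma gen_weightE (N : word -> nat) st (f : {ffun 'I_(size st) -> offspring K}) :
  gen_weight p c N f = Wt f * (alive N f)%:R.
Proof.
rewrite /gen_weight big_split/=; congr (_ * _).
have [/forallP H|/forallPn[i /negPf ni]] := boolP (alive N f).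
  by rewrite big1// => i _; rewrite H.
by rewrite (bigD1 i)//= ni mul0r.
Qed.

Lemma Wt_valid st (f : {ffun 'I_(size st) -> offspring K}) : Wt f != 0 -> valid_gen f.
Proof.
move=> /prodf_neq0 W0; apply/forallP => i; have := W0 i isT.
by rewrite /weight; case: ifP => //; rewrite eqxx.
Qed.

Definition At (N : word -> nat) h n : set Omega := [set o | at_least N h n (T o)].

Lemma At_step N' h n st A (f : {ffun 'I_(size st) -> offspring K}) :
  state h st A -> alive N' f ->
  (A `&` event f) `&` At N' h n.+1 = (A `&` event f) `&` At N' h.+1 n.
Proof.
move=> sA /forallP Nf; apply/seteqP; split => o [[Ao Eo] Ho]; split => // u Vu /andP[h1 h2].
  by apply: Ho => //; rewrite (ltnW h1) -addSnnS h2.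
move=> i iN; move: h1; rewrite leq_eqVlt => /orP[/eqP uh|h1]; last first.
  by apply: Ho => //; rewrite h1 addSnnS.
have /mapP[v /mem_vtx[j <-] uj] := state_all sA Ao (esym uh) Vu.
have [/nb_childrenE[_ nb] _] := Eo j.
by rewrite uj; apply/nb; apply: leq_trans (Nf j); rewrite -uj.
Qed.

Lemma At_dead N' h n st A (f : {ffun 'I_(size st) -> offspring K}) :
  state h st A -> ~~ alive N' f ->
  (A `&` event f) `\` At N' h n.+1 = A `&` event f.
Proof.
move=> sA /forallPn[i]; rewrite -ltnNge => fi.
apply/seteqP; split => o; first by case.
move=> [Ao Eo]; split => // Ho.
have [/nb_childrenE[V nb] _] := Eo i.
have := Ho _ V; rewrite (state_size sA (vtx_in i)) leqnn addnS ltnS leq_addr.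
by move=> /(_ isT _ fi) /nb; rewrite ltnn.
Qed.

Lemma measurable_At N' h n : measurable (At N' h n).
Proof. exact: measurable_at_least. Qed.

(** The explored trees are disjoint events contained in [At]. They need not exhaust
    it, as their numbers of children are less than K: hence an inequality only. *)
Lemma explore_le N' n h st A : state h st A ->
  Pr P A * explore p c N' K n st (mass (h + n)) <=
  Pr P (A `&` At N' h n) * mass h (count snd st).
Proof.
elim: n h st A => [|n IH] h st A sA.
  rewrite addn0 /= (_ : A `&` At N' h 0 = A)// setIidl// => o _ u _ /andP[h1 h2].
  by rewrite addn0 ltnNge h1 in h2.
have mA := typed_past_sub (state_past sA).
have mE (f : {ffun 'I_(size st) -> offspring K}) : measurable (event f) by exact: typed_past_sub (typed_past_event f sA).
pose B := A `&` At N' h n.+1.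
have mB : measurable B by apply: measurableI => //; exact: measurable_At.
rewrite /= mulr_sumr.
apply: (@le_trans _ _ (\sum_f Pr P (B `&` event f) * mass h (count snd st))); last first.
  rewrite -mulr_suml ler_wpM2r ?mass_ge0//.
  apply: sum_Pr_le => //; first exact: index_enum_uniq.
  - by move=> f _; exact: measurableI.
  - by move=> f f' o _ _ [_ Eo] [_ Eo']; exact: event_disjoint sA Eo Eo'.
apply: ler_sum => f _; rewrite gen_weightE.
have [af|/negPf af] := boolP (alive N' f); last first.
  by rewrite mulr0 mul0r mulr0 mulr_ge0 ?Pr_ge0// ltW// mass_gt0.
have [W0|W0] := eqVneq (Wt f) 0.
  by rewrite W0 !mul0r mulr0 mulr_ge0 ?Pr_ge0// ltW// mass_gt0.
have vf := Wt_valid W0.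
have := IH _ _ _ (state_next sA vf).
rewrite -At_step// addSnnS setIAC -/B mulr1 => IHf.
rewrite -(ler_pM2r (mass_gt0 h.+1 (count snd (next_gen f)))).
rewrite [leLHS](_ : _ = (Pr P A * Wt f * mass h.+1 (count snd (next_gen f)))
   * explore p c N' K n (next_gen f) (mass (h + n.+1))); last by ring.
rewrite -kernel// mulrAC [leRHS]mulrAC.
by rewrite ler_wpM2r// ltW// mass_gt0.
Qed.

(** The trees that are explored without the constraint N but not under it are
    disjoint events of the complement of [At]. *)
Lemma explore_compl_le N' n h st A : state h st A ->
  Pr P A * explore p c (fun=> 0%N) K n st (mass (h + n)) <=
  Pr P A * explore p c N' K n st (mass (h + n)) +
  Pr P (A `\` At N' h n) * mass h (count snd st).
Proof.
elim: n h st A => [|n IH] h st A sA.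
  by rewrite /= lerDl mulr_ge0 ?Pr_ge0// ltW// mass_gt0.
have mA := typed_past_sub (state_past sA).
have mE (f : {ffun 'I_(size st) -> offspring K}) : measurable (event f) by exact: typed_past_sub (typed_past_event f sA).
pose B := A `\` At N' h n.+1.
have mB : measurable B by apply: measurableD => //; exact: measurable_At.
rewrite /= !mulr_sumr.
apply: (@le_trans _ _ (\sum_f (Pr P A * (gen_weight p c N' f *
    explore p c N' K n (next_gen f) (mass (h + n.+1)))
    + Pr P (B `&` event f) * mass h (count snd st)))); last first.
  rewrite [leLHS]big_split/=; apply: lerD; first exact: lexx.
  rewrite -mulr_suml ler_wpM2r ?mass_ge0//.
  apply: sum_Pr_le => //; first exact: index_enum_uniq.
  - by move=> f _; exact: measurableI.
  - by move=> f f' o _ _ [_ Eo] [_ Eo']; exact: event_disjoint sA Eo Eo'.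
apply: ler_sum => f _; rewrite !gen_weightE.
have -> : alive (fun=> 0%N) f by apply/forallP.
rewrite mulr1.
have [W0|W0] := eqVneq (Wt f) 0.
  by rewrite W0 !mul0r mulr0 add0r mulr_ge0 ?Pr_ge0// ltW// mass_gt0.
have vf := Wt_valid W0.
have sAf := state_next sA vf.
have mAf : measurable (A `&` event f) by exact: measurableI.
rewrite -(ler_pM2r (mass_gt0 h.+1 (count snd (next_gen f)))).
rewrite [leLHS](_ : _ = (Pr P A * Wt f * mass h.+1 (count snd (next_gen f)))
   * explore p c (fun=> 0%N) K n (next_gen f) (mass (h + n.+1))); last by ring.
rewrite -kernel// mulrAC.
have [af|af] := boolP (alive N' f).
  rewrite mulr1 mulrDl.
  rewrite [X in _ <= X + _](_ : _ = (Pr P A * Wt f * mass h.+1 (count snd (next_gen f)))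
   * explore p c N' K n (next_gen f) (mass (h + n.+1))); last by ring.
  rewrite -kernel// [X in _ <= X + _]mulrAC [X in _ <= _ + X]mulrAC -mulrDl.
  rewrite ler_wpM2r ?mass_ge0//.
  have := IH _ _ _ sAf; rewrite addSnnS => /le_trans; apply.
  rewrite lerD2l ler_wpM2r ?mass_ge0//.
  apply: Pr_le; [by apply: measurableD => //; exact: measurable_At|exact: measurableI|].
  move=> o [Ao nA]; split; last by case: Ao.
  split; first by case: Ao.
  move=> HA; apply: nA.
  have : ((A `&` event f) `&` At N' h n.+1) o by [].
  by rewrite At_step// => -[].
rewrite mulr0 mul0r mulr0 add0r [leRHS]mulrAC ler_wpM2r ?mass_ge0//.
have := explore_le (fun=> 0%N) n sAf; rewrite addSnnS => /le_trans; apply.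
rewrite ler_wpM2r ?mass_ge0// Pr_le//.
- by apply: measurableI => //; exact: measurable_At.
- exact: measurableI.
by rewrite -(At_dead n sA af) => o [[[Ao Eo] nAt] _].
Qed.

Definition root_st : seq tvertex := [:: ([::], true)].

Lemma state_root : state 0 root_st setT.
Proof.
have [[_ _ S0 SV _] _] := hT; split => //.
- exact: (sigma_setT (typed_past_sigma 0)).
- by move=> v; rewrite inE => /eqP ->.
- move=> o v _; rewrite inE => /eqP -> /=.
  by split; [exact: tree_root|split=> // _; exact: S0].
- by move=> o u _ /size0nil -> _; rewrite inE.
Qed.

Lemma mass01 : mass 0 1 = w theta.
Proof. by rewrite /mass expr0 !mul1r. Qed.

(** As [mass 0 1] is the density of W, this bound and the next one estimate the
    probability of [At] given [W = theta] from both sides. *)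
Lemma root_explore_le N' n :
  explore p c N' K n root_st (mass n) <= Pr P (At N' 0 n) * w theta.
Proof.
by have := explore_le N' n state_root; rewrite add0n Pr_setT mul1r setTI mass01.
Qed.

Lemma root_explore_compl_le N' n :
  explore p c (fun=> 0%N) K n root_st (mass n) <=
  explore p c N' K n root_st (mass n) + (1 - Pr P (At N' 0 n)) * w theta.
Proof.
have := explore_compl_le N' n state_root.
rewrite add0n Pr_setT !mul1r mass01.
have mAt := measurable_At N' 0 n.
by have := Pr_split P measurableT mAt; rewrite setTI Pr_setT => ->; rewrite [X in X - _]addrC addrK.
Qed.

End exploration.

(** * The functional equation *)

Section integrals_against_density.
Context {R : realType}.
Notation leb := (@lebesgue_measure R).
Notation pos := (`]0%R, +oo[%classic : set R).
Implicit Types e : R -> R.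
Variable w : R -> R.
Hypothesis dw : cv_density w.

Definition wint e : \bar R := (\int[leb]_(x in pos) (e x * w x)%:E)%E.

Lemma posP (x : R) : pos x = (0 < x) :> Prop.
Proof. by rewrite /= in_itv/= andbT. Qed.

Lemma w_ge0 x : pos x -> 0 <= w x.
Proof. by rewrite posP => /(cvd_gt0 dw)/ltW. Qed.

Lemma measurable_wint e : measurable_fun setT e ->
  measurable_fun pos (fun x => (e x * w x)%:E).
Proof.
move=> me; apply/measurable_EFinP/measurable_funM; last exact: cvd_meas.
exact: measurable_funS me.
Qed.

Lemma wint_ge0 e : (forall x, 0 < x -> 0 <= e x) -> (0 <= wint e)%E.
Proof.
move=> e0; apply: integral_ge0 => x x0; rewrite lee_fin mulr_ge0 ?w_ge0//.
by rewrite e0// -posP.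
Qed.

Lemma wint_le e e' : measurable_fun setT e -> measurable_fun setT e' ->
  (forall x, 0 < x -> 0 <= e x) -> (forall x, 0 < x -> e x <= e' x) ->
  (wint e <= wint e')%E.
Proof.
move=> me me' e0 ee'; apply: ge0_le_integral => //.
- by move=> x x0; rewrite lee_fin mulr_ge0 ?w_ge0// e0// -posP.
- exact: measurable_wint.
- exact: measurable_wint.
- by move=> x x0; rewrite lee_fin ler_wpM2r ?w_ge0// ee'// -posP.
Qed.

Lemma wintD e e' : measurable_fun setT e -> measurable_fun setT e' ->
  (forall x, 0 < x -> 0 <= e x) -> (forall x, 0 < x -> 0 <= e' x) ->
  wint (e \+ e') = (wint e + wint e')%E.
Proof.
move=> me me' e0 e0'; rewrite /wint -ge0_integralD//; last 4 first.
- by move=> x x0; rewrite lee_fin mulr_ge0 ?w_ge0// e0// -posP.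
- exact: measurable_wint.
- by move=> x x0; rewrite lee_fin mulr_ge0 ?w_ge0// e0'// -posP.
- exact: measurable_wint.
by apply: eq_integral => x _; rewrite -EFinD mulrDl.
Qed.

Lemma wintZ (a : R) e : 0 <= a -> measurable_fun setT e ->
  (forall x, 0 < x -> 0 <= e x) -> wint (fun x => a * e x) = (a%:E * wint e)%E.
Proof.
move=> a0 me e0; rewrite /wint -ge0_integralZl//; last 2 first.
- exact: measurable_wint.
- by move=> x x0; rewrite lee_fin mulr_ge0 ?w_ge0// e0// -posP.
by apply: eq_integral => x _; rewrite -EFinM mulrA.
Qed.

Lemma wint_cvg (e_ : nat -> R -> R) e : (forall n, measurable_fun setT (e_ n)) ->
  (forall n x, 0 < x -> 0 <= e_ n x) ->
  (forall x, 0 < x -> {homo e_ ^~ x : m n / (m <= n)%N >-> m <= n}) ->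
  (forall x, 0 < x -> e_ ^~ x @ \oo --> e x) ->
  wint (e_ n) @[n --> \oo] --> wint e.
Proof.
move=> me e0 ne ce.
have H := @cvg_monotone_convergence _ _ _ leb pos (measurable_itv _)
  (fun n x => (e_ n x * w x)%:E) (fun n => measurable_wint (me n)) _ _.
rewrite [X in _ --> X](_ : _ =
  \int[leb]_(x in pos) limn (fun n => (e_ n x * w x)%:E))%E.
  apply: H => [n x x0|x x0 m n mn].
    by rewrite lee_fin mulr_ge0 ?w_ge0// e0// -posP.
  by rewrite lee_fin ler_wpM2r ?w_ge0// ne// -posP.
apply: eq_integral => x; rewrite inE posP => x0; apply/esym/cvg_lim => //.
by apply: cvg_EFin; [exact: nearW|]; apply: cvgMl; exact: ce.
Qed.

Definition w1 : \bar R := wint (cst 1).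

Lemma w1_fin : w1 \is a fin_num.
Proof.
rewrite ge0_fin_numE; last exact: wint_ge0.
by rewrite /w1 /wint; under eq_integral do rewrite mul1r; exact: cvd_int.
Qed.

Lemma wint_bnd e B : measurable_fun setT e -> (forall x, 0 < x -> 0 <= e x) ->
  (forall x, 0 < x -> e x <= B) -> (wint e <= B%:E * w1)%E.
Proof.
move=> me e0 eB.
have B0 : 0 <= B by apply: le_trans (eB 1 _); rewrite ?e0.
rewrite -wintZ//; apply: wint_le => //; first exact: measurable_funM.
by move=> x x0; rewrite mulr1 eB.
Qed.

Lemma wint_bnd_fin e B : measurable_fun setT e -> (forall x, 0 < x -> 0 <= e x) ->
  (forall x, 0 < x -> e x <= B) -> wint e \is a fin_num.
Proof.
move=> me e0 eB; rewrite ge0_fin_numE ?wint_ge0//.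
apply: le_lt_trans (wint_bnd me e0 eB) _.
by rewrite -(fineK w1_fin) -EFinM ltry.
Qed.

End integrals_against_density.

Lemma lee_expe (R : realDomainType) (x y : \bar R) n : (0 <= x)%E -> (x <= y)%E ->
  (x ^+ n <= y ^+ n)%E.
Proof.
move=> x0 xy; elim: n => [|n IH]; first by rewrite !expe0.
rewrite !expeS lee_pmul//; elim: n {IH} => [|n IH]; first by rewrite expe0.
by rewrite expeS mule_ge0.
Qed.

Section functional_equation.
Context {R : realType}.
Notation leb := (@lebesgue_measure R).
Notation pos := (`]0%R, +oo[%classic : set R).
Implicit Types e : R -> R.
Variables (p : nat -> R) (c : R) (w : R -> R).
Notation mu := (fine (mean p)).
Notation wint := (wint w).
Hypotheses (p0 : forall k, 0 <= p k) (c0 : 0 <= c).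
Hypothesis cp0 : c = 0 -> p 0%N = 0.
Hypotheses (mu1 : 1 < mu) (dw : cv_density w).

Let mu0 : 0 < mu. Proof. exact: lt_trans mu1. Qed.

Lemma measurable_mass n r :
  measurable_fun pos (fun theta => mass p w theta n r).
Proof.
rewrite /mass; apply: measurable_funM => //.
apply: (measurable_comp (F := pos)) => //.
- move=> _ [x x0 <-]; rewrite posP mulr_gt0 ?exprn_gt0//.
  by rewrite -posP.
- exact: cvd_meas (cv_density_pow r dw).
Qed.

Lemma integral_mass n r e : measurable_fun setT e -> (forall x, 0 <= e x) ->
  (\int[leb]_(x in pos) (e x * mass p w x n r)%:E =
   \int[leb]_(x in pos) (e (x / mu ^+ n) * convol_pow w r x)%:E)%E.
Proof.
move=> me e0; have dr := cv_density_pow r dw.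
by rewrite /mass integral_scale ?exprn_gt0//; [exact: cvd_meas|exact: cvd_gt0].
Qed.

(** The exploration is a combination of convolution powers with nonnegative
    coefficients, to be integrated termwise. *)
Lemma integral_explore_sum N K n e (s : seq (R * nat)) :
  measurable_fun setT e -> (forall x, 0 <= e x) ->
  (forall x, x \in s -> 0 <= x.1 /\ (0 < x.2)%N) ->
  (forall g, explore p c N K n root_st g = \sum_(x <- s) x.1 * g x.2) ->
  (\int[leb]_(x in pos) (e x * explore p c N K n root_st (mass p w x n))%:E =
   \sum_(y <- s) y.1%:E * \int[leb]_(x in pos) (e (x / mu ^+ n) * convol_pow w y.2 x)%:E)%E.
Proof.
move=> me e0 s0 sE.
have mm (a : R) r : measurable_fun pos (fun x => (e x * (a * mass p w x n r))%:E).
  apply/measurable_EFinP/measurable_funM; first exact: measurable_funS me.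
  by apply: measurable_funM => //; exact: measurable_mass.
have ge (a : R) r x : pos x -> (0 <= (e x * (`|a| * mass p w x n r))%:E)%E.
  by rewrite posP => x0; rewrite lee_fin mulr_ge0// mulr_ge0//; exact: mass_ge0.
transitivity (\int[leb]_(x in pos)
    \sum_(y <- s) (e x * (`|y.1| * mass p w x n y.2))%:E)%E.
  apply: eq_integral => x _; rewrite sE mulr_sumr -sumEFin.
  by apply: eq_big_seq => y /s0[y0 _]; rewrite ger0_norm.
rewrite ge0_integral_sum//; last 2 first.
- by move=> y; exact: mm.
- by move=> y x; exact: ge.
apply: eq_big_seq => y /s0[y0 _]; rewrite -integral_mass// -ge0_integralZl//.
- by apply: eq_integral => x _; rewrite ger0_norm// -EFinM mulrCA.
- have := mm 1 y.2; apply: eq_measurable_fun => x _.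
  by rewrite mul1r.
- by move=> x; rewrite posP => x0; rewrite lee_fin mulr_ge0// mass_ge0.
Qed.

Lemma integral_explore_le N K n e (x : R) :
  measurable_fun setT e -> (forall x, 0 <= e x) ->
  (forall x y, 0 < x -> 0 < y -> e (x + y) <= e x * e y) ->
  (wint (fun y => e (y / mu ^+ n)%R) <= x%:E)%E ->
  (\int[leb]_(x in pos) (e x * explore p c N K n root_st (mass p w x n))%:E <=
   (explore p c N K n root_st (fun r => x ^+ r))%:E)%E.
Proof.
move=> me e0 eM ex.
have [s [s0 sE]] := explore_linear N K p0 c0 n (st := root_st) isT.
rewrite (integral_explore_sum me e0 s0 sE) sE -sumEFin.
rewrite big_seq [leRHS]big_seq; apply: lee_sum => y /s0[y0 y2].
rewrite EFinM lee_wpmul2l ?lee_fin//; case: y.2 y2 => // r _.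
have mu_n0 : 0 < mu ^+ n by rewrite exprn_gt0.
apply: le_trans (integral_convol_pow_le (e := fun y => e (y / mu ^+ n)) r dw _ _ _) _ => //.
- by apply: (measurableT_comp me); exact: measurable_funM.
- by move=> a b a0 b0; rewrite mulrDl eM// divr_gt0.
rewrite EFin_expe lee_expe//; apply: wint_ge0 => // y y0; exact: e0.
Qed.

Lemma integral_explore_eq N K n e (x : R) :
  measurable_fun setT e -> (forall x, 0 <= e x) ->
  (forall x y, 0 < x -> 0 < y -> e (x + y) = e x * e y) ->
  (wint (fun y => e (y / mu ^+ n)%R) = x%:E)%E ->
  (\int[leb]_(x in pos) (e x * explore p c N K n root_st (mass p w x n))%:E =
   (explore p c N K n root_st (fun r => x ^+ r))%:E)%E.
Proof.
move=> me e0 eM ex.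
have [s [s0 sE]] := explore_linear N K p0 c0 n (st := root_st) isT.
rewrite (integral_explore_sum me e0 s0 sE) sE -sumEFin.
apply: eq_big_seq => y /s0[y0 y2].
rewrite EFinM; congr (_ * _)%E; case: y.2 y2 => // r _.
have mu_n0 : 0 < mu ^+ n by rewrite exprn_gt0.
rewrite (integral_convol_pow_eq (e := fun y => e (y / mu ^+ n)) r dw)//.
- by rewrite -/(wint _) ex EFin_expe.
- by apply: (measurableT_comp me); exact: measurable_funM.
- by move=> a b a0 b0; rewrite mulrDl eM// divr_gt0.
Qed.

Lemma measurable_explore N K n :
  measurable_fun pos (fun x => explore p c N K n root_st (mass p w x n)).
Proof.
have [s [s0 sE]] := explore_linear N K p0 c0 n (st := root_st) isT.
rewrite (_ : (fun x => _) = (fun x => \sum_(y <- s) y.1 * mass p w x n y.2)); last first.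
  by apply/funext => x; rewrite sE.
apply: measurable_sum => y; apply: measurable_funM => //; exact: measurable_mass.
Qed.

Lemma explore_root N K n x : explore p c N K n root_st (fun r => x ^+ r) =
  fullv p c N K x n [::] - c * extv p c N K n [::].
Proof. by rewrite exploreX// big_seq1. Qed.

Lemma explore_root1 K x : explore p c (fun=> 0%N) K 1 root_st (fun r => x ^+ r) =
  tgf p K (c + x) - tgf p K c.
Proof.
rewrite explore_root extvE//; congr (_ - _); apply: eq_bigr => k _.
  by rewrite mul1r prodr_const card_ord.
by rewrite mul1r /= prodr_const card_ord mulr1.
Qed.

Hypothesis c1 : c < 1.
Hypothesis tgf1 : tgf p ^~ 1 @ \oo --> (1 : R).
Hypothesis tgfc : tgf p ^~ c @ \oo --> c.
Hypothesis w_mass : w1 w = (1 - c)%:E.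
(** An identity in law of [W], as an inequality between densities: it comes from
    the first generation of the trees. *)
Definition first_generation_le := forall K theta, 0 < theta ->
  explore p c (fun=> 0%N) K 1 root_st (mass p w theta 1) <= w theta.
Hypothesis explore1_le : first_generation_le.

Lemma tgf_homo K x y : 0 <= x -> x <= y -> tgf p K x <= tgf p K y.
Proof.
move=> x0 xy; apply: ler_sum => k _; rewrite ler_wpM2l// lerXn2r// nnegrE//.
exact: le_trans xy.
Qed.

Lemma tgf_homoK x : 0 <= x -> {homo tgf p ^~ x : m n / (m <= n)%N >-> m <= n}.
Proof.
move=> x0 m n mn; rewrite /tgf (big_ord_widen _ (fun k => p k * x ^+ k) mn) big_mkcond.
by apply: ler_sum => k _; case: ifP => // _; rewrite mulr_ge0// exprn_ge0.
Qed.

Lemma tgf_le_lim x l K : 0 <= x -> tgf p ^~ x @ \oo --> l -> tgf p K x <= l.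
Proof.
move=> x0 xl; rewrite -(cvg_lim (@Rhausdorff R) xl).
by apply: nondecreasing_cvgn_le; [exact: tgf_homoK|apply/cvg_ex; exists l].
Qed.

(** The integrals over theta of the two sides of [first_generation_le] become equal
    as K tends to infinity, both being the probability of survival. So the two
    densities differ by a small mass, which [e] multiplies by at most B. *)
Lemma wint_functional_le e B F : measurable_fun setT e -> (forall x, 0 <= e x) ->
  (forall x, 0 < x -> e x <= B) ->
  (forall x y, 0 < x -> 0 < y -> e (x + y) <= e x * e y) ->
  (forall K, tgf p K (c + fine (wint (fun y => e (y / mu)))) <= F) ->
  (wint e <= (F - c)%:E)%E.
Proof.
move=> me e0 eB eM hF.
have B0 : 0 <= B by apply: le_trans (eB 1 _).
have me' : measurable_fun setT (fun y : R => e (y / mu)).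
  by apply: (measurableT_comp me); exact: measurable_funM.
set x := fine _ in hF.
have xE : wint (fun y => e (y / mu)) = x%:E.
  rewrite fineK//; apply: (wint_bnd_fin (B := B) dw) => // y y0.
  by rewrite eB// divr_gt0.
have x0 : 0 <= x by rewrite fine_ge0// wint_ge0.
pose ex K theta := explore p c (fun=> 0%N) K 1 root_st (mass p w theta 1).
have mex K : measurable_fun pos (ex K) by exact: measurable_explore.
have ex0 K theta : pos theta -> 0 <= ex K theta.
  by rewrite posP => t0; apply: explore_ge0 => // r; exact: mass_ge0.
have exw K theta : pos theta -> ex K theta <= w theta.
  by rewrite posP; exact: explore1_le.
have mw := cvd_meas dw.
have me_pos : measurable_fun pos e by exact: measurable_funS me.
have step K : (wint e <= (B * ((1 - c) - (tgf p K 1 - tgf p K c)) + (F - tgf p K c))%:E)%E.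
  have mB := measurable_funB mw (mex K).
  have m1 : measurable_fun pos (fun y => (w y - ex K y)%:E) by apply/measurable_EFinP.
  have m2 : measurable_fun pos (fun y => (e y * (w y - ex K y))%:E).
    by apply/measurable_EFinP; exact: (measurable_funM me_pos mB).
  have m3 : measurable_fun pos (fun y => (B * (w y - ex K y))%:E).
    by apply/measurable_EFinP; apply: measurable_funM.
  have tot : (\int[leb]_(y in pos) (ex K y)%:E = (tgf p K 1 - tgf p K c)%:E)%E.
    transitivity (\int[leb]_(y in pos) ((cst 1 y : R) * ex K y)%:E)%E.
      by apply: eq_integral => y _; rewrite mul1r.
    rewrite (@integral_explore_eq _ _ _ _ (1 - c))//; last by move=> *; rewrite mulr1.
    by rewrite explore_root1 [c + _]addrC subrK.
  have exe : (\int[leb]_(y in pos) (e y * ex K y)%:E <= (F - tgf p K c)%:E)%E.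
    apply: le_trans (integral_explore_le (x := x) _ _ me e0 eM _) _.
      by rewrite xE lexx.
    by rewrite explore_root1 lee_fin lerB.
  have rest : (\int[leb]_(y in pos) (w y - ex K y)%:E =
      ((1 - c) - (tgf p K 1 - tgf p K c))%:E)%E.
    have : (\int[leb]_(y in pos) (w y - ex K y)%:E + (tgf p K 1 - tgf p K c)%:E = (1 - c)%:E)%E.
      rewrite -tot -ge0_integralD//.
      - rewrite -w_mass /w1 /wint; apply: eq_integral => y _.
        by rewrite -EFinD subrK mul1r.
      - by move=> y y0; rewrite lee_fin subr_ge0 exw.
      - by move=> y y0; rewrite lee_fin ex0.
      - by apply/measurable_EFinP; exact: mex.
    by move=> H; rewrite [RHS]EFinB -H addeK.
  have -> : wint e = (\int[leb]_(y in pos) ((e y * (w y - ex K y))%:E + (e y * ex K y)%:E))%E.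
    by apply: eq_integral => y _; rewrite -EFinD -mulrDr subrK.
  rewrite ge0_integralD//.
  - rewrite EFinD leeD//.
    rewrite EFinM -rest -ge0_integralZl//.
    + apply: ge0_le_integral => //.
      * by move=> y y0; rewrite lee_fin mulr_ge0// subr_ge0 exw.
      * move=> y y0; rewrite -EFinM lee_fin ler_wpM2r ?subr_ge0 ?exw// eB//.
        by rewrite -posP.
    + by move=> y y0; rewrite lee_fin subr_ge0 exw.
  - by move=> y y0; rewrite lee_fin mulr_ge0// subr_ge0 exw.
  - by move=> y y0; rewrite lee_fin mulr_ge0// ex0.
  - by apply/measurable_EFinP; exact: (measurable_funM me_pos (mex K)).
have cvl : (fun K => B * ((1 - c) - (tgf p K 1 - tgf p K c)) + (F - tgf p K c)) @ \oo --> F - c.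
  have -> : F - c = B * ((1 - c) - (1 - c)) + (F - c) by rewrite subrr mulr0 add0r.
  apply: cvgD; last by apply: cvgB => //; exact: cvg_cst.
  apply: cvgMr; apply: cvgB; first exact: cvg_cst.
  exact: cvgB.
have efin : wint e \is a fin_num by exact: (wint_bnd_fin (B := B) dw).
rewrite -(fineK efin) lee_fin.
apply: ler_cvg_to (cvg_cst _) cvl _; apply: nearW => K.
by rewrite -lee_fin fineK.
Qed.

(** The exponential moment of order l of W is [c + lap l], the atom at 0 contributing
    c. *)
Definition lap (l : R) : \bar R := wint (fun x => expR (l * x)).

Lemma measurable_exp l : measurable_fun setT (fun x : R => expR (l * x)).
Proof. by apply: measurableT_comp => //; exact: measurable_funM. Qed.

Lemma lap_ge0 l : (0 <= lap l)%E.
Proof. by apply: wint_ge0 => // x _; exact: expR_ge0. Qed.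

Lemma lap_le l l' : l <= l' -> (lap l <= lap l')%E.
Proof.
move=> ll; apply: (wint_le dw (measurable_exp _) (measurable_exp _)).
  by move=> x _; exact: expR_ge0.
by move=> x x0; rewrite ler_expR ler_wpM2r// ltW.
Qed.

Lemma lap0 : lap 0 = (1 - c)%:E.
Proof.
by rewrite -w_mass; apply: eq_integral => x _; rewrite mul0r expR0.
Qed.

Lemma lap_fin l l' : l <= l' -> (lap l' < +oo)%E -> lap l \is a fin_num.
Proof. move=> ll lfin; rewrite ge0_fin_numE; last exact: lap_ge0.
exact: le_lt_trans (lap_le ll) lfin. Qed.

(** An exponential turns convolution powers into powers, for which the exploration
    factorizes. *)
Lemma integral_explore_lap N K n l : lap (l / mu ^+ n) \is a fin_num ->
  (\int[leb]_(x in pos) (expR (l * x) * explore p c N K n root_st (mass p w x n))%:E =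
   (fullv p c N K (fine (lap (l / mu ^+ n))) n [::] - c * extv p c N K n [::])%:E)%E.
Proof.
move=> lfin; rewrite -explore_root; apply: integral_explore_eq.
- exact: measurable_exp.
- by move=> x; exact: expR_ge0.
- by move=> x y _ _; rewrite mulrDr expRD.
rewrite (fineK lfin); apply: eq_integral => x _.
by rewrite mulrAC mulrA.
Qed.

Lemma lap_ge l K : (lap l < +oo)%E -> lap (l / mu) \is a fin_num ->
  tgf p K (c + fine (lap (l / mu))) - tgf p K c <= fine (lap l).
Proof.
move=> lfin lmu; rewrite -explore_root1 -lee_fin fineK; last first.
  by rewrite ge0_fin_numE// lap_ge0.
rewrite -(@integral_explore_eq _ _ _ (fun x => expR (l * x))).
- apply: ge0_le_integral => //.
  + move=> x; rewrite posP => x0; rewrite lee_fin mulr_ge0 ?expR_ge0//.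
    by apply: explore_ge0 => // r; exact: mass_ge0.
  + apply/measurable_EFinP/measurable_funM; last exact: measurable_explore.
    exact: measurable_funS (measurable_exp l).
  + apply/measurable_EFinP/measurable_funM; last exact: cvd_meas.
    exact: measurable_funS (measurable_exp l).
  + move=> x; rewrite posP => x0; rewrite lee_fin ler_wpM2l ?expR_ge0//.
    exact: explore1_le.
- exact: measurable_exp.
- by move=> x; exact: expR_ge0.
- by move=> x y _ _; rewrite mulrDr expRD.
rewrite (fineK lmu); apply: eq_integral => x _.
by rewrite expr1 mulrAC mulrA.
Qed.

Definition exp_trunc (l M x : R) := expR (l * Num.min x M).

Lemma measurable_exp_trunc l M : measurable_fun setT (exp_trunc l M).
Proof.
apply: measurableT_comp => //; apply: measurable_funM => //.
exact: measurable_minr.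
Qed.

Lemma exp_truncD l M x y : 0 <= l -> 0 <= M -> 0 < x -> 0 < y ->
  exp_trunc l M (x + y) <= exp_trunc l M x * exp_trunc l M y.
Proof.
move=> l0 M0 x0 y0; rewrite /exp_trunc -expRD ler_expR -mulrDr ler_wpM2l//.
rewrite !minEle; case: ifP => h1; case: ifP => h2; case: ifP => h3; lra.
Qed.

Lemma exp_trunc_ge0 l M x : 0 <= exp_trunc l M x.
Proof. exact: expR_ge0. Qed.

Lemma exp_trunc_le l M x : 0 <= l -> exp_trunc l M x <= expR (l * M).
Proof. by move=> l0; rewrite ler_expR ler_wpM2l// ge_min lexx orbT. Qed.

Lemma exp_trunc_cvg l : 0 <= l ->
  wint (exp_trunc l n%:R) @[n --> \oo] --> lap l.
Proof.
move=> l0; apply: wint_cvg => //.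
- by move=> n; exact: measurable_exp_trunc.
- by move=> n x _; exact: exp_trunc_ge0.
- move=> x x0 m n mn; rewrite ler_expR ler_wpM2l// le_min ge_min lexx/=.
  by rewrite ge_min ler_nat mn orbT.
move=> x x0; apply: cvg_near_cst; exists (Num.truncn x).+1 => // n /= xn.
rewrite /exp_trunc min_l//; apply/ltW.
by apply: lt_le_trans (truncnS_gt x) _; rewrite ler_nat.
Qed.

Lemma wint_cvg_le (u : nat -> \bar R) l B : u @ \oo --> l -> (forall n, (u n <= B)%E) ->
  (l <= B)%E.
Proof.
move=> ul uB; rewrite -(cvg_lim (@ereal_hausdorff R) ul).
by apply: lime_le; [apply/cvg_ex; exists l|exact: nearW].
Qed.

(** Truncating the exponential is what allows using the functional equation before
    the exponential moment is known to be finite. *)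
Lemma lap_functional_le l F : 0 <= l -> lap (l / mu) \is a fin_num ->
  (forall K, tgf p K (c + fine (lap (l / mu))) <= F) -> (lap l <= (F - c)%:E)%E.
Proof.
move=> l0 lmu hF; apply: wint_cvg_le (exp_trunc_cvg l0) _ => n.
have me : measurable_fun setT (fun y : R => exp_trunc l n%:R (y / mu)).
  by apply: (measurableT_comp (measurable_exp_trunc l n%:R)); exact: measurable_funM.
apply: (@wint_functional_le _ (expR (l * n%:R))).
- exact: measurable_exp_trunc.
- by move=> x; exact: exp_trunc_ge0.
- by move=> x _; exact: exp_trunc_le.
- by move=> x y; exact: exp_truncD.
move=> K; apply: le_trans (hF K); apply: tgf_homo.
  by rewrite addr_ge0// fine_ge0// wint_ge0// => x _; exact: exp_trunc_ge0.
rewrite lerD2l; apply: fine_le.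
- apply: (wint_bnd_fin (B := expR (l * n%:R)) dw me).
    by move=> x _; exact: exp_trunc_ge0.
  by move=> x _; exact: exp_trunc_le.
- exact: lmu.
apply: (wint_le dw me (measurable_exp _)).
  by move=> x _; exact: exp_trunc_ge0.
move=> x x0; rewrite ler_expR mulrAC -mulrA; apply: ler_wpM2l => //.
by rewrite ge_min lexx.
Qed.

End functional_equation.

(** * Exponential moments *)

Section elementary.
Context {R : realType}.
Implicit Types x y : R.

(** The quotient of [(1 + x) ^+ k - 1 - k x] by [x ^+ 2] is largest at delta. *)
Lemma bernoulli2 (delta x : R) k : -1 <= x -> x <= delta -> 0 <= delta ->
  ((1 + x) ^+ k - 1 - k%:R * x) * delta ^+ 2 <=
  ((1 + delta) ^+ k - 1 - k%:R * delta) * x ^+ 2.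
Proof.
move=> x1 xd d0; elim: k => [|k IH]; first by rewrite !expr0 !mul0r; lra.
set A := (1 + x) ^+ k - 1 - k%:R * x in IH.
set D := (1 + delta) ^+ k - 1 - k%:R * delta in IH.
have D0 : 0 <= D.
  rewrite /D; elim: k {IH A D} => [|k IHk]; first by rewrite expr0; lra.
  have -> : (1 + delta) ^+ k.+1 - 1 - k.+1%:R * delta =
      (1 + delta) * ((1 + delta) ^+ k - 1 - k%:R * delta) + k%:R * delta ^+ 2.
    by rewrite exprS -natr1; ring.
  by rewrite addr_ge0// mulr_ge0// ?sqr_ge0// addr_ge0.
have -> : (1 + x) ^+ k.+1 - 1 - k.+1%:R * x = (1 + x) * A + k%:R * x ^+ 2.
  by rewrite /A exprS -natr1; ring.
have -> : (1 + delta) ^+ k.+1 - 1 - k.+1%:R * delta = (1 + delta) * D + k%:R * delta ^+ 2.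
  by rewrite /D exprS -natr1; ring.
have H1 : (1 + x) * (A * delta ^+ 2) <= (1 + x) * (D * x ^+ 2).
  by rewrite ler_wpM2l//; lra.
have H2 : (1 + x) * (D * x ^+ 2) <= (1 + delta) * (D * x ^+ 2).
  by apply: ler_wpM2r; [rewrite mulr_ge0 ?sqr_ge0|rewrite lerD2l].
have := le_trans H1 H2.
have -> : ((1 + x) * A + k%:R * x ^+ 2) * delta ^+ 2 =
  (1 + x) * (A * delta ^+ 2) + k%:R * x ^+ 2 * delta ^+ 2 by ring.
have -> : ((1 + delta) * D + k%:R * delta ^+ 2) * x ^+ 2 =
  (1 + delta) * (D * x ^+ 2) + k%:R * x ^+ 2 * delta ^+ 2 by ring.
by rewrite lerD2r.
Qed.

(** The recursion of a sequence decreasing like [mu^-n] up to a quadratic error, which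
    is absorbed by a bound of the form [1 / (kappa + mu^m)] with kappa proportional
    to C. *)
Lemma quadratic_decay (x : nat -> R) (mu C : R) : 1 < mu -> 0 <= C ->
  (forall n, 0 <= x n) -> (forall n, mu * x n.+1 - C * x n.+1 ^+ 2 <= x n) ->
  x @ \oo --> 0 -> exists n0, forall m, x (n0 + m)%N * mu ^+ m <= 1.
Proof.
move=> mu1 C0 x0 xS x_cvg.
have mu0 : 0 < mu by lra.
pose kappa := C / (mu - 1).
have k0 : 0 <= kappa by rewrite divr_ge0//; lra.
have kE : kappa * (mu - 1) = C by rewrite /kappa divfK//; lra.
pose eps := Num.min (kappa + 1)^-1 ((mu - 1) / (C + 1)).
have eps0 : 0 < eps.
  by rewrite lt_min; apply/andP; split; [rewrite invr_gt0|apply: divr_gt0]; lra.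
have [n0 _ Hn0] : \forall n \near \oo, x n <= eps.
  by apply: (cvgr_le _ x_cvg); lra.
exists n0.
have Hx n : (n0 <= n)%N -> C * x n <= mu - 1.
  move=> nn; have := Hn0 _ nn; rewrite le_min => /andP[_].
  rewrite ler_pdivlMr; last by lra.
  by have := x0 n; nra.
have main m : x (n0 + m)%N * (kappa + mu ^+ m) <= 1.
  elim: m => [|m IH].
    rewrite addn0 expr0; have := Hn0 _ (leqnn n0); rewrite le_min => /andP[+ _].
    by rewrite -ler_pdivlMr ?mul1r//; lra.
  set M := mu ^+ m in IH *; have M0 : 0 < M by exact: exprn_gt0.
  rewrite exprS -/M addnS.
  set y := x (n0 + m).+1; set z := x (n0 + m)%N in IH *.
  have y0 : 0 <= y by exact: x0.
  have z0 : 0 <= z by exact: x0.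
  have Cy : C * y <= mu - 1 by apply: Hx; rewrite -addnS leq_addr.
  have yz : mu * y - C * y ^+ 2 <= z by exact: xS.
  have yz' : y <= z.
    apply: le_trans yz; rewrite expr2.
    have : 0 <= y * (mu - 1 - C * y) by rewrite mulr_ge0// subr_ge0.
    by lra.
  have ky : (kappa + M) * y <= 1.
    by apply: le_trans IH; rewrite mulrC ler_wpM2r//; lra.
  rewrite leNgt; apply/negP => qy.
  have H1 : (kappa + M) * (mu * y - C * y ^+ 2) <= 1.
    by apply: le_trans IH; rewrite [leRHS]mulrC ler_wpM2l//; lra.
  have H2 : y * ((kappa + M) * (C * y)) <= y * C.
    rewrite ler_wpM2l// mulrCA; rewrite -[leRHS]mulr1 ler_wpM2l//.
  have H3 : (kappa + M) * (mu * y - C * y ^+ 2) =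
      y * (kappa + mu * M) + y * (kappa * (mu - 1)) - y * ((kappa + M) * (C * y)).
    by ring.
  by rewrite H3 kE in H1; lra.
move=> m; apply: le_trans (main m); rewrite ler_wpM2l//; lra.
Qed.

Lemma expR_le_quadratic x : 0 <= x -> expR x <= 1 + x + x ^+ 2 * expR x.
Proof.
move=> x0; have H : expR x <= 1 + x * expR x.
  have := expR_ge1Dx (- x); rewrite -(ler_pM2r (expR_gt0 x)) mulrDl.
  by rewrite [expR (- x) * _]mulrC expRxMexpNx_1; lra.
have := ler_wpM2l x0 H; rewrite mulrDr mulr1 => H2.
by rewrite expr2 -mulrA; lra.
Qed.

Lemma min_le_1BexpN x : 0 <= x -> Num.min x 1 <= 2 * (1 - expR (- x)).
Proof.
move=> x0; have e1 := expR_ge1Dx x; have e0 := expR_gt0 (- x).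
have : expR (- x) * (1 + x) <= 1.
  by rewrite -[leRHS](expRxMexpNx_1 x) [leRHS]mulrC ler_wpM2l// ltW.
set y := expR (- x) in e0 *.
move=> H; rewrite minEle; case: ifP => x1; nra.
Qed.

Lemma expR_convex (s x y : R) : 0 <= s -> s <= 1 ->
  expR ((1 - s) * x + s * y) <= (1 - s) * expR x + s * expR y.
Proof.
move=> s0 s1; set m := (1 - s) * x + s * y.
have tangent z : expR m * (1 + (z - m)) <= expR z.
  have -> : expR z = expR m * expR (z - m) by rewrite -expRD addrC subrK.
  by rewrite ler_wpM2l ?expR_ge0 ?expR_ge1Dx.
have Hx : (1 - s) * (expR m * (1 + (x - m))) <= (1 - s) * expR x.
  by rewrite ler_wpM2l ?subr_ge0.
have Hy : s * (expR m * (1 + (y - m))) <= s * expR y by rewrite ler_wpM2l.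
apply: le_trans (lerD Hx Hy); rewrite le_eqVlt; apply/orP; left; apply/eqP.
by rewrite /m; ring.
Qed.

End elementary.

Section moments.
Context {R : realType}.
Notation leb := (@lebesgue_measure R).
Notation pos := (`]0%R, +oo[%classic : set R).
Implicit Types e : R -> R.
Variables (p : nat -> R) (c : R) (w : R -> R).
Notation mu := (fine (mean p)).
Notation wint := (wint w).
Notation lap := (lap w).
Hypotheses (p0 : forall k, 0 <= p k) (c0 : 0 <= c).
Hypothesis cp0 : c = 0 -> p 0%N = 0.
Hypotheses (mu1 : 1 < mu) (dw : cv_density w).
Hypothesis c1 : c < 1.
Hypothesis tgf1 : tgf p ^~ 1 @ \oo --> (1 : R).
Hypothesis tgfc : tgf p ^~ c @ \oo --> c.
Hypothesis w_mass : w1 w = (1 - c)%:E.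
Hypothesis explore1_le : first_generation_le p c w.
Hypothesis mean_cvg : (fun K => \sum_(k < K) k%:R * p k) @ \oo --> mu.
Hypothesis radius : gf_ereal p (cvg_radius p) = +oo%E.

Let mu0 : 0 < mu. Proof. exact: lt_trans mu1. Qed.

(** The generating function is finite at some [1 + delta]; the remainder of its
    expansion of order 1 at 1 is compared with the one at that point, term by term. *)
Lemma tgf_quadratic : exists delta C, [/\ 0 < delta, 0 <= C &
  forall x K, -1 <= x -> x <= delta -> tgf p K (1 + x) <= 1 + mu * x + C * x ^+ 2].
Proof.
have [y [B [y1 yB]]] : exists y B', [/\ 1 < y & forall K, tgf p K y <= B'].
  apply: (tgf_bnd_extend (B := 1) p0 radius) => // K.
  exact: (tgf_le_lim p0 K _ tgf1).
pose delta := y - 1; have d0 : 0 < delta by rewrite subr_gt0.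
have B0 : 0 <= B by apply: le_trans (yB 0%N); rewrite /tgf big_ord0.
exists delta, (B / delta ^+ 2); split => //.
  by rewrite divr_ge0// sqr_ge0.
move=> x K x1 xd.
have cvb : (fun n => tgf p n 1 + (\sum_(k < n) k%:R * p k) * x + B / delta ^+ 2 * x ^+ 2) @ \oo
    --> 1 + mu * x + B / delta ^+ 2 * x ^+ 2.
  by apply: cvgD; [apply: cvgD => //; exact: cvgMl|exact: cvg_cst].
apply: (ler_cvg_to (cvg_cst _) cvb); exists K => // n /= Kn.
apply: le_trans (tgf_homoK p0 _ Kn) _; first by lra.
have dd : 0 < delta ^+ 2 by rewrite exprn_gt0.
apply: (@le_trans _ _ (\sum_(k < n) p k * (1 + k%:R * x + y ^+ k / delta ^+ 2 * x ^+ 2))).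
  apply: ler_sum => k _; rewrite ler_wpM2l//.
  have := bernoulli2 k x1 xd (ltW d0).
  rewrite -ler_pdivlMr//; pose D := (1 + delta) ^+ k - 1 - k%:R * delta; rewrite -/D => H.
  have : D * x ^+ 2 / delta ^+ 2 <= y ^+ k / delta ^+ 2 * x ^+ 2.
    rewrite mulrAC ler_wpM2r ?sqr_ge0// ler_wpM2r ?invr_ge0 ?(ltW dd)//.
    have yE : 1 + delta = y by rewrite /delta addrC subrK.
    rewrite /D yE; have : 0 <= k%:R * delta by rewrite mulr_ge0// ltW.
    by lra.
  by lra.
rewrite (eq_bigr (fun k : 'I_n => p k * 1 ^+ k + k%:R * p k * x
    + p k * y ^+ k * (x ^+ 2 / delta ^+ 2))); last first.
  by move=> k _; rewrite expr1n; field; rewrite gt_eqF.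
rewrite !big_split/= -!mulr_suml lerD2l.
rewrite [leRHS]mulrAC -[leRHS]mulrA ler_wpM2r ?divr_ge0 ?sqr_ge0//.
exact: yB.
Qed.

Lemma wint_gt0 e (a b : R) : 0 <= a -> a < b -> measurable_fun setT e ->
  (forall x, 0 < x -> 0 <= e x) -> (forall x, a < x -> x < b -> 0 < e x) ->
  (0 < wint e)%E.
Proof.
move=> a0 ab me e0 e_gt0.
rewrite lt_neqAle (wint_ge0 dw e0) andbT eq_sym; apply/eqP => H0.
have mh := measurable_wint dw me.
have := (ae_eq_integral_abs leb (measurable_itv _) mh).1; case.
  rewrite -[RHS]H0; apply: eq_integral => x; rewrite inE posP => x0.
  by rewrite gee0_abs// lee_fin mulr_ge0 ?e0// ltW// (cvd_gt0 dw).
move=> N [mN N0 sub].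
have : (leb `]a, b[ <= leb N)%E.
  apply: le_measure; rewrite ?inE//.
  apply: subset_trans sub => y /=; rewrite in_itv/= => /andP[ay yb].
  have y0 : 0 < y by exact: le_lt_trans ay.
  apply/not_implyP; split; first by rewrite in_itv/= andbT.
  by move=> -[] /eqP; rewrite gt_eqF// mulr_gt0// ?e_gt0// (cvd_gt0 dw).
by rewrite N0 lebesgue_measure_itv/= lte_fin ab -EFinB lee_fin subr_le0 leNgt ab.
Qed.

Let lapN_fin (a : R) : 0 <= a -> lap (- a) \is a fin_num.
Proof.
move=> a0; apply: (lap_fin dw (l' := 0)); first by rewrite oppr_le0.
by rewrite (lap0 w_mass) ltry.
Qed.

(** The mean of [1 - expR (- mu^-n W)], which decreases like [mu^-n] exactly when W is
    integrable. *)
Definition deficit n : R := 1 - c - fine (lap (- (mu ^+ n)^-1)).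

Let mun0 n : 0 < mu ^+ n. Proof. exact: exprn_gt0. Qed.
Let muV0 n : 0 <= (mu ^+ n)^-1. Proof. by rewrite invr_ge0 ltW. Qed.

Lemma deficit_ge0 n : 0 <= deficit n.
Proof.
rewrite subr_ge0 -lee_fin fineK ?lapN_fin// -(lap0 w_mass).
by apply: (lap_le dw); rewrite oppr_le0.
Qed.

Lemma muV_cvg : (fun n => (mu ^+ n)^-1) @ \oo --> 0.
Proof.
have -> : (fun n => (mu ^+ n)^-1) = (fun n => mu^-1 ^+ n).
  by apply/funext => n; rewrite exprVn.
by apply: cvg_expr; rewrite ger0_norm ?invr_ge0 ?ltW// invf_lt1.
Qed.

Lemma deficit_cvg : deficit @ \oo --> 0.
Proof.
have H : lap (- (mu ^+ n)^-1) @[n --> \oo] --> (1 - c)%:E.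
  rewrite -(lap0 w_mass); apply: (wint_cvg dw).
  - by move=> n; exact: measurable_exp.
  - by move=> n x _; exact: expR_ge0.
  - move=> x x0 m n mn; rewrite ler_expR ler_wpM2r ?(ltW x0)// lerN2 lef_pV2 ?posrE//.
    by rewrite ler_weXn2l// ltW.
  - move=> x x0; apply: continuous_cvg; first exact: continuous_expR.
    by apply: cvgMl; rewrite -oppr0; apply: cvgN; exact: muV_cvg.
rewrite /deficit -(subrr (1 - c)); apply: cvgB; first exact: cvg_cst.
exact: fine_cvg H.
Qed.

Lemma deficit_rec C delta :
  (forall x K, -1 <= x -> x <= delta -> tgf p K (1 + x) <= 1 + mu * x + C * x ^+ 2) ->
  0 < delta ->
  forall n, mu * deficit n.+1 - C * deficit n.+1 ^+ 2 <= deficit n.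
Proof.
move=> hq d0 n; set y := deficit n.+1.
have y0 : 0 <= y := deficit_ge0 n.+1.
have lS : lap (- (mu ^+ n.+1)^-1) = (1 - c - y)%:E.
  by rewrite /y /deficit subKr fineK ?lapN_fin.
have y1 : y <= 1.
  have : 0 <= 1 - c - y by rewrite -lee_fin -lS lap_ge0.
  by move: c0; lra.
have := @wint_functional_le _ p c w p0 c0 cp0 mu1 dw tgf1 tgfc w_mass explore1_le
  (fun x => expR (- (mu ^+ n)^-1 * x)) 1 (1 + mu * (- y) + C * (- y) ^+ 2).
move=> H.
have {}H : (lap (- (mu ^+ n)^-1) <= (1 + mu * - y + C * (- y) ^+ 2 - c)%:E)%E.
  apply: H.
  - exact: measurable_exp.
  - by move=> x; exact: expR_ge0.
  - by move=> x x0; rewrite expR_le1 mulNr oppr_le0 mulr_ge0// ltW.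
  - by move=> a b _ _; rewrite mulrDr expRD.
  move=> K.
  have -> : wint (fun y0 => expR (- (mu ^+ n)^-1 * (y0 / mu))) = lap (- (mu ^+ n.+1)^-1).
    apply: eq_integral => x _; congr (expR _ * _)%:E.
    by rewrite exprS invfM; field; rewrite !gt_eqF.
  rewrite lS /= [c + _](_ : _ = 1 + - y); last by lra.
  by apply: hq; lra.
rewrite -(fineK (lapN_fin (muV0 n))) lee_fin in H.
by rewrite /deficit; move: H; rewrite sqrrN; lra.
Qed.

(** W is integrable, because [min(x, mu^n) <= 2 mu^n (1 - exp(- x / mu^n))] and the
    functional equation makes [mu^n * deficit n] bounded. *)
Lemma wint_id_fin : wint id \is a fin_num.
Proof.
rewrite ge0_fin_numE; last by apply: (wint_ge0 dw) => x /ltW.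
have [delta [C [d0 C0 hq]]] := tgf_quadratic.
have [n0 hn0] := quadratic_decay mu1 C0 deficit_ge0 (deficit_rec hq d0) deficit_cvg.
pose e_ m (x : R) := Num.min x (mu ^+ (n0 + m)).
have me m : measurable_fun setT (e_ m) by exact: measurable_minr.
have ec : wint (e_ m) @[m --> \oo] --> wint id.
  apply: (wint_cvg dw) => //.
  - by move=> m x x0; rewrite le_min (ltW x0) ltW.
  - move=> x x0 m n mn; rewrite le_min ge_min lexx/= ge_min.
    by rewrite ler_weXn2l ?orbT ?leq_add2l// ltW.
  - move=> x x0; apply: cvg_near_cst.
    have xV : 0 < x^-1 by rewrite invr_gt0.
    have [m0 _ Hm0] := cvgr_le _ muV_cvg _ xV.
    exists m0 => // m /= mm; rewrite /e_ min_l//.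
    have := Hm0 (n0 + m)%N; rewrite /= (leq_trans mm) ?leq_addl// => /(_ isT).
    by rewrite lef_pV2 ?posrE.
apply: (@le_lt_trans _ _ (2 * mu ^+ n0)%:E); last by rewrite ltry.
apply: wint_cvg_le ec _ => m.
set n := (n0 + m)%N; pose g x := expR (- (mu ^+ n)^-1 * x).
have mg : measurable_fun setT g by exact: measurable_exp.
have g1 x : 0 < x -> 0 <= 1 - g x.
  by move=> x0; rewrite subr_ge0 expR_le1 mulNr oppr_le0 mulr_ge0// ltW.
have m1g : measurable_fun setT (fun x => 1 - g x) by exact: measurable_funB.
have gE : wint (fun x => 1 - g x) = (deficit n)%:E.
  have lf := lapN_fin (muV0 n).
  rewrite /deficit EFinB (fineK lf).
  have : (wint (fun x => (1 - g x)%R) + wint g = (1 - c)%:E)%E.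
    rewrite -(wintD dw)//; last by move=> x _; exact: expR_ge0.
    by rewrite -w_mass; apply: eq_integral => x _; rewrite /= subrK.
  by move=> <-; rewrite addeK.
apply: (@le_trans _ _ (wint (fun x => (2 * mu ^+ n) * (1 - g x)))).
  apply: (wint_le dw) => //.
  - exact: measurable_funM.
  - by move=> x x0; rewrite le_min (ltW x0) ltW.
  move=> x x0; rewrite /e_ -/n.
  have -> : Num.min x (mu ^+ n) = mu ^+ n * Num.min (x / mu ^+ n) 1.
    by rewrite minr_pMr ?(ltW (mun0 n))// mulr1 mulrCA divff ?mulr1// gt_eqF.
  have := @min_le_1BexpN R (x / mu ^+ n); rewrite divr_ge0 ?(ltW x0) ?(ltW (mun0 n))//.
  move=> /(_ isT) H.
  have -> : g x = expR (- (x / mu ^+ n)) by rewrite /g mulNr mulrC.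
  by rewrite -mulrA mulrCA ler_wpM2l// ltW.
rewrite (wintZ dw)//; last by rewrite mulr_ge0// ltW.
rewrite gE -EFinM lee_fin /n exprD.
rewrite [leLHS](_ : _ = 2 * mu ^+ n0 * (deficit (n0 + m) * mu ^+ m)); last by ring.
by rewrite -[leRHS]mulr1 ler_wpM2l ?mulr_ge0 ?(ltW (mun0 n0)).
Qed.

(** The exponential moment of [min W M] is bounded uniformly in M: the functional
    equation is iterated from a scale [mu^-n] at which the first moment suffices,
    and [t + kappa t^2] is a supersolution of the iteration. *)
Lemma lap_some_moment : exists2 l, 0 < l & (lap l < +oo)%E.
Proof.
have [delta [C [d0 C0 hq]]] := tgf_quadratic.
(* kappa absorbs the term C (t + kappa t^2)^2 <= 4 C t^2 of one iteration *)
pose kappa := 4 * C / (mu * (mu - 1)).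
have muB : 0 < mu - 1 by rewrite subr_gt0.
have k0 : 0 <= kappa by rewrite divr_ge0 ?mulr_ge0// ltW.
have kE : kappa * mu * (mu - 1) = 4 * C by rewrite /kappa; field; rewrite !gt_eqF.
pose t0 := Num.min (delta / 2) (kappa + 1)^-1.
have t00 : 0 < t0.
  by rewrite lt_min; apply/andP; split; [apply: divr_gt0|rewrite invr_gt0]; lra.
have t0d : 2 * t0 <= delta.
  by have : t0 <= delta / 2 by [rewrite ge_min lexx]; lra.
have t0k : kappa * t0 <= 1.
  have : t0 <= (kappa + 1)^-1 by rewrite ge_min lexx orbT.
  have kk : 0 < kappa + 1 by lra.
  by rewrite -[_^-1]mul1r ler_pdivlMr//; lra.
pose m1 := fine (wint id).
have m1E : wint id = m1%:E by rewrite fineK// wint_id_fin.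
have m10 : 0 <= m1 by rewrite fine_ge0// (wint_ge0 dw)// => x /ltW.
pose l := t0 / (m1 + 1).
have m11 : 0 < m1 + 1 by lra.
have l0 : 0 < l by rewrite divr_gt0.
have lE : l * (m1 + 1) = t0 by rewrite /l divfK// gt_eqF.
exists l => //; apply: (@le_lt_trans _ _ (1 + 2 * t0 - c)%:E); last by rewrite ltry.
apply: wint_cvg_le (exp_trunc_cvg dw (ltW l0)) _ => M0.
pose M : R := M0%:R; have M_ge0 : 0 <= M by [].
rewrite -/M.
pose e n (x : R) := exp_trunc l M (x / mu ^+ n).
have me n : measurable_fun setT (e n).
  by apply: (measurableT_comp (measurable_exp_trunc l M)); exact: measurable_funM.
have e0 n x : 0 <= e n x by exact: exp_trunc_ge0.
have eB n x : e n x <= expR (l * M) by exact: exp_trunc_le (ltW l0).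
have efin n : wint (e n) \is a fin_num.
  by apply: (wint_bnd_fin (B := expR (l * M)) dw) => // x _.
pose phi n := c + fine (wint (e n)).
have phi_ge0 n : 0 <= phi n by rewrite addr_ge0// fine_ge0// (wint_ge0 dw).
pose t n := t0 * (mu ^+ n)^-1.
have t_ge0 n : 0 <= t n by rewrite mulr_ge0// ltW.
have t_le n : t n <= t0.
  rewrite /t -[leRHS]mulr1 ler_wpM2l ?(ltW t00)// invf_le1//.
  by rewrite exprn_ege1// ltW.
have tS n : t n = mu * t n.+1 by rewrite /t exprS; field; rewrite !gt_eqF.
(* at a small scale, exp(y) <= 1 + y + y^2 exp(y) bounds phi through the mean of W,
   the quadratic term being small by monotone convergence *)
have base : exists n, phi n <= 1 + t n.
  pose r_ n (x : R) := x * (M - Num.min (x / mu ^+ n) M).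
  have mr n : measurable_fun setT (r_ n).
    apply: measurable_funM => //; apply: measurable_funB => //.
    by apply: measurable_minr => //; exact: measurable_funM.
  have r0 n x : 0 < x -> 0 <= r_ n x.
    by move=> x0; rewrite mulr_ge0 ?(ltW x0)// subr_ge0 ge_min lexx orbT.
  have rc : wint (r_ n) @[n --> \oo] --> wint (fun x => x * M).
    apply: (wint_cvg dw) => //.
    - move=> x x0 m n mn; rewrite ler_wpM2l ?(ltW x0)// lerB// le_min !ge_min lexx !orbT andbT.
      by rewrite ler_wpM2l ?(ltW x0)// lef_pV2 ?posrE// ler_weXn2l// ltW.
    - move=> x x0; apply: cvgMr; rewrite -[X in _ --> X]subr0; apply: cvgB; first exact: cvg_cst.
      apply: (@squeeze_cvgr _ _ _ _ (cst 0) (fun n => x * (mu ^+ n)^-1)).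
      + apply: nearW => n /=; rewrite le_min M_ge0 mulr_ge0 ?(ltW x0)//=.
        by rewrite ge_min lexx.
      + exact: cvg_cst.
      + by rewrite -[X in _ --> X](mulr0 x); apply: cvgMr; exact: muV_cvg.
  have MmE : wint (fun x => x * M) = (M * m1)%:E.
    rewrite EFinM -m1E -(wintZ dw)//; last by move=> x /ltW.
    by apply: eq_integral => x _; rewrite [x * M]mulrC.
  pose q n (x : R) := x * Num.min (x / mu ^+ n) M.
  have mq n : measurable_fun setT (q n).
    apply: measurable_funM => //.
    by apply: measurable_minr => //; exact: measurable_funM.
  have q0 n x : 0 < x -> 0 <= q n x.
    by move=> x0; rewrite mulr_ge0 ?(ltW x0)// le_min M_ge0 andbT divr_ge0 ?ltW.
  have qr n : (wint (q n) + wint (r_ n) = (M * m1)%:E)%E.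
    rewrite -(wintD dw)//; [|exact: q0|exact: r0].
    rewrite -MmE; apply: eq_integral => x _; congr (_ * _)%:E.
    by rewrite /= /q /r_ -mulrDr addrC subrK.
  have rfin n : wint (r_ n) \is a fin_num.
    rewrite ge0_fin_numE; last by apply: (wint_ge0 dw); exact: r0.
    apply: (@le_lt_trans _ _ (M * m1)%:E); last by rewrite ltry.
    by rewrite -(qr n) leeDr// (wint_ge0 dw)//; exact: q0.
  pose eta := (l * expR (l * M))^-1.
  have eta0 : 0 < eta by rewrite invr_gt0 mulr_gt0// expR_gt0.
  rewrite MmE in rc.
  have rc' : fine (wint (r_ n)) @[n --> \oo] --> M * m1 by exact: fine_cvg rc.
  have [n _ /(_ _ (leqnn n)) Hn] : \forall n \near \oo, M * m1 - eta <= fine (wint (r_ n)).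
    have H := cvgr_ge _ rc' (M * m1 - eta).
    by apply: H => /=; lra.
  exists n.
  have qE : (wint (q n) <= eta%:E)%E.
    have -> : wint (q n) = (M * m1 - fine (wint (r_ n)))%:E.
      by rewrite EFinB -(qr n) (fineK (rfin n)) addeK.
    by rewrite lee_fin; move: Hn => /=; lra.
  have a0 : 0 <= l / mu ^+ n by rewrite divr_ge0 ?ltW.
  have b0 : 0 <= l / mu ^+ n * (l * expR (l * M)).
    by rewrite mulr_ge0// mulr_ge0 ?expR_ge0 ?(ltW l0).
  have key : (wint (e n) <= w1 w + ((l / mu ^+ n)%:E * wint id
      + (l / mu ^+ n * (l * expR (l * M)))%:E * wint (q n)))%E.
    rewrite -(wintZ dw b0 (mq n)); last by move=> x; exact: q0.
    rewrite -(wintZ dw a0)//; last by move=> x /ltW.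
    have mi : measurable_fun setT (fun x : R => l / mu ^+ n * id x) by exact: measurable_funM.
    have mq' : measurable_fun setT (fun x => l / mu ^+ n * (l * expR (l * M)) * q n x).
      exact: measurable_funM.
    have i0 x : 0 < x -> 0 <= l / mu ^+ n * id x by move=> x0; rewrite mulr_ge0// ltW.
    have q0' x : 0 < x -> 0 <= l / mu ^+ n * (l * expR (l * M)) * q n x.
      by move=> x0; rewrite mulr_ge0// q0.
    rewrite -(wintD dw)// /w1 -(wintD dw)//; last 2 first.
    - exact: measurable_funD.
    - by move=> x x0; rewrite addr_ge0 ?i0 ?q0'.
    apply: (wint_le dw) => //.
    - by apply: measurable_funD => //; exact: measurable_funD.
    move=> x x0 /=; rewrite /e /exp_trunc.
    set y := Num.min (x / mu ^+ n) M.
    have y0 : 0 <= y by rewrite le_min M_ge0 andbT divr_ge0 ?ltW.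
    have yM : y <= M by rewrite ge_min lexx orbT.
    have yx : y <= x / mu ^+ n by rewrite ge_min lexx.
    have ly0 : 0 <= l * y by rewrite mulr_ge0// ltW.
    apply: le_trans (expR_le_quadratic ly0) _; rewrite -addrA lerD2l lerD//.
      rewrite [leRHS](_ : _ = l * (x / mu ^+ n)); last by rewrite /=; ring.
      by rewrite ler_wpM2l// ltW.
    rewrite /q -/y exprMn.
    have -> : l / mu ^+ n * (l * expR (l * M)) * (x * y) =
        l ^+ 2 * (x / mu ^+ n * y) * expR (l * M) by ring.
    apply: ler_pM.
    - by rewrite mulr_ge0 ?sqr_ge0.
    - exact: expR_ge0.
    - by rewrite ler_wpM2l ?sqr_ge0// expr2 ler_wpM2r.
    - by rewrite ler_expR ler_wpM2l// ltW.
  have : (wint (e n) <= (1 - c + (l / mu ^+ n * m1 + l / mu ^+ n))%:E)%E.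
    apply: le_trans key _; rewrite w_mass m1E !EFinD leeD2l// -EFinM leeD2l//.
    apply: (@le_trans _ _ ((l / mu ^+ n * (l * expR (l * M)))%:E * eta%:E)%E).
      by rewrite lee_wpmul2l// lee_fin.
    by rewrite -EFinM lee_fin /eta mulfK// mulf_neq0 ?gt_eqF// expR_gt0.
  rewrite -(fineK (efin n)) lee_fin /phi /t -lE => H.
  have -> : l * (m1 + 1) * (mu ^+ n)^-1 = l / mu ^+ n * m1 + l / mu ^+ n by ring.
  by lra.
have step n : phi n.+1 <= 1 + (t n.+1 + kappa * t n.+1 ^+ 2) ->
    phi n <= 1 + (t n + kappa * t n ^+ 2).
  move=> IH; set T := t n.+1 in IH.
  have T0 : 0 <= T := t_ge0 n.+1.
  have Tt : T <= t0 := t_le n.+1.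
  have kT : kappa * T <= 1 by apply: le_trans t0k; rewrite ler_wpM2l.
  have kT2 : kappa * T ^+ 2 <= T by rewrite expr2 mulrA -[leRHS]mul1r ler_wpM2r.
  have kT20 : 0 <= kappa * T ^+ 2 by rewrite mulr_ge0 ?sqr_ge0.
  have H := @wint_functional_le _ p c w p0 c0 cp0 mu1 dw tgf1 tgfc w_mass explore1_le
    (e n) (expR (l * M)) (1 + (mu * T + kappa * (mu * T) ^+ 2)).
  have {}H : (wint (e n) <= (1 + (mu * T + kappa * (mu * T) ^+ 2) - c)%:E)%E.
    apply: H => //.
    - move=> x y x0 y0; rewrite /e mulrDl exp_truncD ?(ltW l0)//;
        by rewrite divr_gt0.
    move=> K.
    have -> : wint (fun y => e n (y / mu)) = wint (e n.+1).
      apply: eq_integral => x _; congr (exp_trunc _ _ _ * _)%:E.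
      by rewrite exprS; field; rewrite !gt_eqF.
    rewrite -/(phi n.+1); apply: le_trans (tgf_homo p0 K (phi_ge0 _) IH) _.
    apply: le_trans (hq _ K _ _) _; [by lra|by lra|].
    set z := kappa * T ^+ 2 in kT2 kT20 *.
    have zz : (T + z) ^+ 2 <= 4 * T ^+ 2 by rewrite !expr2; nra.
    have CC : C * (T + z) ^+ 2 <= C * (4 * T ^+ 2) by rewrite ler_wpM2l.
    have -> : kappa * (mu * T) ^+ 2 = mu * z + (kappa * mu * (mu - 1)) * T ^+ 2.
      by rewrite /z; ring.
    by rewrite kE; lra.
  rewrite -(fineK (efin n)) lee_fin in H.
  by rewrite /phi (tS n) -/T; lra.
have [n Hn] := base.
have : phi n <= 1 + (t n + kappa * t n ^+ 2).
  by apply: le_trans Hn _; rewrite lerD2l lerDl mulr_ge0 ?sqr_ge0.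
elim: n {Hn} => [|n IH]; last by move=> /step/IH.
rewrite /phi /t expr0 invr1 mulr1 => H.
have e0E : wint (e 0%N) = wint (exp_trunc l M).
  by apply: eq_integral => x _; rewrite /e expr0 divr1.
rewrite -e0E -(fineK (efin 0%N)) lee_fin.
have : kappa * t0 ^+ 2 <= t0 by rewrite expr2 mulrA -[leRHS]mul1r ler_wpM2r// ltW.
by lra.
Qed.

(** The exponential moment is infinite at the critical value: otherwise the
    functional equation, [f] being finite beyond [phi (lc / mu)], would give a
    larger finite exponential moment. *)
Lemma lap_critical lc : 0 < lc -> (forall l, l < lc -> (lap l < +oo)%E) ->
  (forall l, (lap l < +oo)%E -> l <= lc) -> lap lc = +oo%E.
Proof.
move=> lc0 Hlt Hle; apply/eqP; rewrite -leye_eq leNgt; apply/negP => lcfin.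
have [a aE] : exists a, a = lc / mu by exists (lc / mu).
have alc : a < lc by rewrite aE ltr_pdivrMr// ltr_pMr.
have value l : l <= lc -> exists2 v : R, 0 <= v & lap l = v%:E.
  move=> llc; have lfin := lap_fin dw llc lcfin.
  exists (fine (lap l)); last by rewrite fineK.
  by rewrite fine_ge0// (lap_ge0 dw).
have [La La0 LaE] := value a (ltW alc).
have [Lb Lb0 LbE] := value lc (lexx lc).
have bnd K : tgf p K (c + La) <= Lb + c.
  have h1 : tgf p K (c + fine (lap a)) - tgf p K c <= fine (lap lc).
    rewrite aE; apply: (lap_ge p0 c0 cp0 mu1 dw explore1_le); first exact: lcfin.
    by rewrite -aE LaE.
  rewrite LaE LbE /= in h1.
  rewrite -[leLHS](subrK (tgf p K c)); apply: lerD h1 _.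
  exact: (tgf_le_lim p0 K c0 tgfc).
have [y [B [xy yB]]] := tgf_bnd_extend p0 radius (addr_ge0 c0 La0) bnd.
pose gap := y - c - La.
have gap0 : 0 < gap by rewrite /gap; move: xy; lra.
have LaLb : La <= Lb by rewrite -lee_fin -LaE -LbE; apply: (lap_le dw); exact: ltW.
(* a convex combination of lc / mu and lc that stays below y by convexity of lap *)
pose s := Num.min 1 (gap / (Lb - La + 1)).
have s0 : 0 < s.
  by rewrite lt_min ltr01/= divr_gt0//; lra.
have s1 : s <= 1 by rewrite ge_min lexx.
have sgap : s * (Lb - La) <= gap.
  have : s <= gap / (Lb - La + 1) by rewrite ge_min lexx orbT.
  by rewrite ler_pdivlMr; [move: s0; nra|lra].
have [l lE] : exists l, l = (1 - s) * a + s * lc by exists ((1 - s) * a + s * lc).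
have al : a < l by rewrite lE; move: alc s0; nra.
have l0 : 0 < l by apply: lt_trans al; rewrite aE divr_gt0.
have llc : l <= lc by rewrite lE; move: alc s0 s1; nra.
have [Ll Ll0 LlE] := value l llc.
have lapl : Ll <= y - c.
  have : (lap l <= ((1 - s)%:E * lap a + s%:E * lap lc))%E.
    rewrite -!(wintZ dw) ?(ltW s0) ?subr_ge0//; try exact: measurable_exp;
      try by move=> x _; exact: expR_ge0.
    rewrite -(wintD dw); last 4 first.
    - by apply: measurable_funM => //; exact: measurable_exp.
    - by apply: measurable_funM => //; exact: measurable_exp.
    - by move=> x _; rewrite mulr_ge0 ?expR_ge0 ?subr_ge0.
    - by move=> x _; rewrite mulr_ge0 ?expR_ge0 ?(ltW s0).
    apply: (wint_le dw); first exact: measurable_exp.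
    - by apply: measurable_funD; apply: measurable_funM => //; exact: measurable_exp.
    - by move=> x _; exact: expR_ge0.
    move=> x _ /=.
    have -> : l * x = (1 - s) * (a * x) + s * (lc * x) by rewrite lE; ring.
    exact: expR_convex (ltW s0) s1.
  rewrite LlE LaE LbE -!EFinM -EFinD lee_fin => H.
  by apply: le_trans H _; move: sgap; rewrite /gap; lra.
have : (lap (mu * l) < +oo)%E.
  have muE : mu * l / mu = l by rewrite mulrAC mulfV ?mul1r// gt_eqF.
  apply: (@le_lt_trans _ _ (B - c)%:E); last by rewrite ltry.
  apply: (lap_functional_le p0 c0 cp0 mu1 dw tgf1 tgfc w_mass explore1_le).
  - by rewrite mulr_ge0 ?(ltW l0)// ltW.
  - by rewrite muE LlE.
  move=> K; rewrite muE LlE /=; apply: le_trans (yB K); apply: (tgf_homo p0).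
    by rewrite addr_ge0.
  by move: lapl; lra.
move=> /Hle; rewrite leNgt; apply/negP/negPn.
by move: al; rewrite aE ltr_pdivrMr// mulrC.
Qed.

Lemma lap_mul_ge l : (l%:E * wint id <= lap l)%E.
Proof.
have [l0|/ltW l0] := leP 0 l; last first.
  apply: le_trans (lap_ge0 dw l); apply: mule_le0_ge0; first by rewrite lee_fin.
  by apply: (wint_ge0 dw) => x /ltW.
rewrite -(wintZ dw l0)//; last by move=> x /ltW.
apply: (wint_le dw).
- exact: measurable_funM.
- exact: measurable_exp.
- by move=> x x0; rewrite mulr_ge0// ltW.
- by move=> x _; apply: le_trans (expR_ge1Dx _); rewrite lerDr.
Qed.

(** The part of an exponential weight that does not escape to infinity. *)
Definition low (M l : R) (x : R) : R := expR (l * x) * ((x <= M)%R)%:R.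

Lemma measurable_low M l : measurable_fun setT (low M l).
Proof.
apply: measurable_funM; first exact: measurable_exp.
have -> : (fun x => ((x <= M)%R)%:R) = \1_(`]-oo, M]%classic : set R) :> (R -> R).
  by apply/funext => x; rewrite indicE mem_setE in_itv.
exact: measurable_indic.
Qed.

Lemma low_ge0 M l x : 0 <= low M l x.
Proof. by rewrite mulr_ge0 ?expR_ge0. Qed.

Lemma low_le M l x : 0 <= l -> low M l x <= expR (l * M).
Proof.
move=> l0; rewrite /low; have [xM|xM] := boolP (x <= M); last by rewrite mulr0 expR_ge0.
by rewrite mulr1 ler_expR ler_wpM2l.
Qed.

Lemma wint_low_le M l : 0 <= l -> (wint (low M l) <= (expR (l * M))%:E)%E.
Proof.
move=> l0; apply: le_trans (wint_bnd dw (measurable_low M l) _ _) _.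
- by move=> x _; exact: low_ge0.
- by move=> x _; exact: low_le.
rewrite w_mass -EFinM lee_fin -[leRHS]mulr1 ler_wpM2l ?expR_ge0//.
by move: c0; lra.
Qed.

(** [lambda_c], and below [zeta], in terms of the density. *)
Definition lc : \bar R := ereal_sup [set l%:E | l in [set l : R | (lap l < +oo)%E]].

Lemma lc_ge l : (lap l < +oo)%E -> (l%:E <= lc)%E.
Proof. by move=> lfin; apply: ereal_sup_ubound; exists l. Qed.

Lemma lc_lt l : (l%:E < lc)%E -> (lap l < +oo)%E.
Proof.
move=> /ereal_sup_gt[_ [l' l'fin <-]]; rewrite lte_fin => ll.
by apply: le_lt_trans l'fin; apply: (lap_le dw); exact: ltW.
Qed.

Lemma lc_gt0 : (0 < lc)%E.
Proof.
have [l l0 lfin] := lap_some_moment.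
by apply: lt_le_trans (lc_ge lfin); rewrite lte_fin.
Qed.

Definition zt (h : nat) : \bar R :=
  if lc is l%:E then (c%:E + lap (l * (mu ^+ h)^-1))%E else +oo%E.

(** The exponential tilts: as the parameter increases to the critical value, the
    tilted moments tend to the zeta's, the one of generation 0 tends to infinity,
    and the tilted law of [W] escapes to infinity. *)
Lemma tilts : exists lam : nat -> R, [/\
  forall n, 0 < lam n, forall n, (lap (lam n) < +oo)%E,
  forall h, (c%:E + lap (lam n * (mu ^+ h)^-1))%E @[n --> \oo] --> zt h,
  lap (lam n) @[n --> \oo] --> +oo%E &
  forall M eps, 0 < eps ->
    \forall n \near \oo, (wint (low M (lam n)) <= eps%:E * lap (lam n))%E].
Proof.
have scale_cvg (u : nat -> \bar R) l : (forall n, (0 <= u n)%E) ->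
    u @ \oo --> l -> (c%:E + u n)%E @[n --> \oo] --> (c%:E + l)%E.
  by move=> u0 ul; apply: cvgeD; [case: (l)|exact: cvg_cst|exact: ul].
have := lc_gt0; rewrite /zt; case E : lc => [l| |] // l0.
- rewrite lte_fin in l0.
  pose lam n := l * (1 - n.+2%:R^-1).
  have lam_lt n : lam n < l.
    by rewrite /lam -[ltRHS]mulr1 ltr_pM2l// ltrBlDr ltrDl invr_gt0.
  have lam0 n : 0 < lam n by rewrite mulr_gt0// subr_gt0 invf_lt1// ltr1n.
  have lamS : {homo lam : m n / (m <= n)%N >-> m <= n}.
    by move=> m n mn; rewrite ler_wpM2l ?(ltW l0)// lerB// lef_pV2 ?posrE// ler_nat.
  have lamc : lam @ \oo --> l.
    rewrite -[X in _ --> X]mulr1; apply: cvgMr; rewrite -[X in _ --> X]subr0.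
    apply: cvgB; first exact: cvg_cst.
    by move: (@cvg_harmonic R); rewrite -cvg_shiftS.
  have lapc h : lap (lam n * (mu ^+ h)^-1) @[n --> \oo] --> lap (l * (mu ^+ h)^-1).
    apply: (wint_cvg dw).
    - by move=> n; exact: measurable_exp.
    - by move=> n x _; exact: expR_ge0.
    - move=> x x0 m n mn; rewrite ler_expR ler_wpM2r ?(ltW x0)// ler_wpM2r//.
      exact: lamS.
    - move=> x x0; apply: continuous_cvg; first exact: continuous_expR.
      by apply: cvgMl; apply: cvgMl.
  have lcrit : lap l = +oo%E.
    apply: (lap_critical l0) => l' H; first by apply: lc_lt; rewrite E lte_fin.
    by have := lc_ge H; rewrite E lee_fin.
  have lapy : lap (lam n) @[n --> \oo] --> +oo%E.
    have := lapc 0%N; rewrite expr0 invr1 mulr1 lcrit.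
    by under eq_fun do rewrite mulr1.
  exists lam; split => //.
  - by move=> n; apply: lc_lt; rewrite E lte_fin.
  - by move=> h; apply: scale_cvg (lapc h) => n; exact: (lap_ge0 dw).
  - move=> M eps eps0.
    have H : \forall n \near \oo, ((expR (l * Num.max M 0) / eps)%:E <= lap (lam n))%E.
      by move/cvgeyPge : lapy; apply.
    near=> n.
    apply: (@le_trans _ _ (expR (l * Num.max M 0))%:E).
      apply: le_trans (wint_low_le M (ltW (lam0 n))) _.
      rewrite lee_fin ler_expR.
      apply: (@le_trans _ _ (lam n * Num.max M 0)).
        by rewrite ler_wpM2l ?(ltW (lam0 n))// le_max lexx.
      by rewrite ler_wpM2r ?(ltW (lam_lt n))// le_max lexx orbT.
    have -> : expR (l * Num.max M 0) = eps * (expR (l * Num.max M 0) / eps).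
      by rewrite mulrCA mulfV ?mulr1// gt_eqF.
    rewrite EFinM lee_wpmul2l ?lee_fin ?(ltW eps0)//.
    by near: n.
- pose lam (n : nat) : R := n.+1%:R.
  have m0 : (0 < wint id)%E by apply: (wint_gt0 (a := 0) (b := 1)) => // x /ltW.
  have mE := wint_id_fin.
  pose m1 := fine (wint id); have m10 : 0 < m1.
    by rewrite /m1 fine_gt0// m0/= -ge0_fin_numE ?mE// ltW.
  have lapy a : 0 < a -> lap (lam n * a) @[n --> \oo] --> +oo%E.
    move=> a0; apply/cvgeyPge => B.
    exists (Num.truncn (`|B| / (a * m1))).+1 => // n /= nB.
    apply: le_trans (lap_mul_ge _); rewrite -(fineK mE) -/m1 -EFinM lee_fin.
    apply: le_trans (ler_norm B) _; rewrite -mulrA -ler_pdivrMr ?mulr_gt0//.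
    apply/ltW/(lt_le_trans (truncnS_gt _)); rewrite ler_nat.
    by apply: leq_trans nB _; exact: leqnSn.
  exists lam; split.
  - by move=> n; rewrite ltr0n.
  - by move=> n; apply: lc_lt; rewrite E ltry.
  - move=> h; have a0 : 0 < (mu ^+ h)^-1 by rewrite invr_gt0.
    have := scale_cvg _ _ (fun n => lap_ge0 dw (lam n * (mu ^+ h)^-1)) (lapy _ a0).
    by rewrite addey.
  - by have := lapy 1 ltr01; under eq_fun do rewrite mulr1.
  - move=> M' eps eps0.
    pose M := Num.max M' 1; have M0 : 0 < M by rewrite lt_max ltr01 orbT.
    pose tail (x : R) : R := ((2 * M < x)%R)%:R.
    have mt : measurable_fun setT tail.
      have -> : tail = \1_(`]2 * M, +oo[%classic : set R).
        by apply/funext => x; rewrite indicE mem_setE in_itv/= andbT.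
      exact: measurable_indic.
    have t0 : (0 < wint tail)%E.
      apply: (wint_gt0 (a := 2 * M) (b := 2 * M + 1)) => //.
      - by rewrite mulr_ge0// ltW.
      - by rewrite ltrDl.
      - by move=> x xM _; rewrite /tail xM.
    have tfin : wint tail \is a fin_num.
      by apply: (wint_bnd_fin (B := 1) dw) => // x _; rewrite /tail; case: (_ < _).
    pose k := fine (wint tail); have k0 : 0 < k.
      by rewrite /k fine_gt0// t0/= -ge0_fin_numE ?tfin// ltW.
    exists (Num.truncn (eps * k)^-1).+1 => // n /= nB.
    have ln0 : 0 < lam n by rewrite ltr0n.
    have H1 : ((expR (lam n * (2 * M)) * k)%:E <= lap (lam n))%E.
      rewrite EFinM /k (fineK tfin) -(wintZ dw)// ?expR_ge0//.
      apply: (wint_le dw).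
      - exact: measurable_funM.
      - exact: measurable_exp.
      - by move=> x _; rewrite mulr_ge0 ?expR_ge0.
      - move=> x _; rewrite /tail; case: ltP => xM; last by rewrite mulr0 expR_ge0.
        by rewrite mulr1 ler_expR ler_wpM2l ?(ltW ln0)// ltW.
    apply: le_trans (wint_low_le M' (ltW ln0)) _.
    apply: (@le_trans _ _ (eps%:E * (expR (lam n * (2 * M)) * k)%:E)%E); last first.
      by rewrite lee_wpmul2l// lee_fin ltW.
    rewrite -EFinM lee_fin.
    have -> : lam n * (2 * M) = lam n * M + lam n * M by ring.
    apply: (@le_trans _ _ (expR (lam n * M))).
      by rewrite ler_expR ler_wpM2l ?(ltW ln0)// le_max lexx.
    rewrite expRD -[leLHS]mulr1 -!mulrA [leRHS]mulrCA ler_wpM2l ?expR_ge0//.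
    rewrite mulrCA -ler_pdivrMr ?mulr_gt0// mul1r.
    apply: le_trans (expR_ge1Dx _).
    have : (eps * k)^-1 <= lam n.
      apply/ltW/(lt_le_trans (truncnS_gt _)); rewrite ler_nat.
      by apply: leq_trans nB _; exact: leqnSn.
    have : lam n <= lam n * M by rewrite ler_peMr ?(ltW ln0)// le_max lexx orbT.
    by lra.
Unshelve. all: by end_near. Qed.

End moments.

(** * Prescribed finite trees *)

Section tannery.
Context {R : realType}.

(** Dominated convergence for a truncated series whose terms depend on the
    truncation: a bounded number of terms is close to the limit. *)
Lemma tannery (a : nat -> nat -> R) (b : nat -> R) (s : R) :
  (forall n k, 0 <= a n k) -> (forall n k, a n k <= b k) ->
  (forall k, a ^~ k @ \oo --> b k) ->
  (fun n => \sum_(k < n) b k) @ \oo --> s ->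
  (fun n => \sum_(k < n) a n k) @ \oo --> s.
Proof.
move=> a0 ab ac bs.
have b0 k : 0 <= b k by exact: le_trans (a0 0%N k) (ab 0%N k).
have nb : nondecreasing_seq (fun n => \sum_(k < n) b k).
  apply/nondecreasing_seqP => n.
  by rewrite big_ord_recr/= lerDl.
have bles n : \sum_(k < n) b k <= s.
  rewrite -(cvg_lim (@Rhausdorff R) bs); apply: nondecreasing_cvgn_le => //.
  by apply/cvg_ex; exists s.
apply/cvgrPdist_le => e e0.
have e2 : 0 < e / 2 by lra.
have [K0 _ HK0] := (cvgrPdist_le _ _).1 bs _ e2.
have fin : (fun n => \sum_(k < K0) a n k) @ \oo --> \sum_(k < K0) b k.
  by apply: cvg_big => [|k _]; [exact: add_continuous|exact: ac].
have [n0 _ Hn0] := (cvgrPdist_le _ _).1 fin _ e2.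
exists (maxn K0 n0) => // n /=; rewrite geq_max => /andP[Kn n0n].
have h1 := HK0 _ (leqnn K0); have h2 := Hn0 _ n0n; rewrite /= in h1 h2.
have h3 : \sum_(k < n) a n k <= s by apply: le_trans (bles n); apply: ler_sum.
have h4 : \sum_(k < K0) a n k <= \sum_(k < n) a n k.
  rewrite (big_ord_widen _ (fun k => a n k) Kn) big_mkcond; apply: ler_sum => k _.
  by case: ifP.
have h5 := ler_norm (s - \sum_(k < K0) b k).
have h6 := ler_norm (\sum_(k < K0) b k - \sum_(k < K0) a n k).
by rewrite ger0_norm; lra.
Qed.

End tannery.

Section finite_trees.
Variables (N : word -> nat) (D : seq word).

(** D is the set of the vertices of a finite tree at which a number N of children
    is prescribed; the prescribed children need not belong to D. *)
Record prescription : Prop := Prescription {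
  presc_uniq : uniq D;
  presc_out : forall u, u \notin D -> N u = 0%N;
  presc_in : forall u i, rcons u i \in D -> u \in D /\ (i < N u)%N }.

Hypothesis ND : prescription.

Lemma presc_prefix u v : v \in D -> prefix u v -> u \in D.
Proof.
elim/last_ind: v => [|v i IH] vD.
  by rewrite prefixs0 => /eqP ->.
move=> /prefixP[r]; case/lastP: r => [|r j] E; first by rewrite cats0 in E; rewrite -E.
have [vD' _] := presc_in ND vD.
apply: IH => //; move: E; rewrite -rcons_cat => /rcons_inj[-> _].
exact: prefix_prefix.
Qed.

Context {R : realType}.
Variable Q : nat -> nat -> R.
Hypothesis Q0 : forall h, Q h 0 = 1.

Definition subtree_prod (u : word) : R :=
  \prod_(v <- D | prefix u v) Q (size v) (N v).

Lemma subtree_prod_out u : u \notin D -> subtree_prod u = 1.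
Proof.
move=> uD; rewrite /subtree_prod big_seq_cond big_pred0// => v.
by apply/negP => /andP[vD uv]; rewrite (presc_prefix vD uv) in uD.
Qed.

Lemma subtree_prod_big u i : (N u <= i)%N -> subtree_prod (rcons u i) = 1.
Proof.
move=> Ni; apply: subtree_prod_out; apply/negP => /(presc_in ND)[_].
by rewrite ltnNge Ni.
Qed.

Lemma subtree_prod_root : subtree_prod [::] = \prod_(v <- D) Q (size v) (N v).
Proof. by apply: eq_bigl => v; rewrite prefix0s. Qed.

Lemma subtree_prod_rec u :
  subtree_prod u = Q (size u) (N u) * \prod_(i < N u) subtree_prod (rcons u i).
Proof.
have [uD|uD] := boolP (u \in D); last first.
  by rewrite subtree_prod_out// presc_out// Q0 big_ord0 mulr1.
rewrite /subtree_prod [LHS]big_mkcond/= (bigD1_seq u)//= ?(presc_uniq ND)//.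
rewrite prefix_refl; congr (_ * _).
under [RHS]eq_bigr do rewrite big_mkcond/=.
rewrite exchange_big/= [LHS]big_mkcond/= [LHS]big_seq [RHS]big_seq.
apply: eq_bigr => v vD; rewrite -big_mkcond/=.
case: (eqVneq v u) => [->|vu] /=.
  rewrite big_pred0// => i; apply/negP => /size_prefix.
  by rewrite size_rcons ltnn.
case: ifPn => uv; last first.
  rewrite big_pred0// => i; apply: contraNF uv.
  by apply: prefix_trans; rewrite -cats1 prefix_prefix.
have /prefixP[r vE] := uv.
case: r vE => [|a r] vE; first by rewrite vE cats0 eqxx in vu.
have pa : prefix (rcons u a) v by rewrite vE -cat_rcons prefix_prefix.
have [_ aN] := presc_in ND (presc_prefix vD pa).
rewrite (big_pred1 (Ordinal aN))// => i /=; rewrite vE -cats1.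
by rewrite prefix_catr// eqxx/= -val_eqE/= prefix0s andbT.
Qed.

End finite_trees.

Section value_limit.
Context {R : realType}.
Variables (p : nat -> R) (c : R) (N : word -> nat) (D : seq word) (x : nat -> R) (H : nat).
Hypotheses (p0 : forall k, 0 <= p k) (c0 : 0 <= c).
Hypotheses (ND : prescription N D) (x_gt0 : forall h, 0 < x h) (xc : c <= x H).
Hypothesis xS : forall h, tgf p ^~ (x h.+1) @ \oo --> x h.

(** The probability of at least k children under the offspring law
    [x h.+1 ^+ j * p j / x h] of generation h. *)
Definition tailQ (h k : nat) : R := 1 - tgf p k (x h.+1) / x h.

Lemma tailQ0 h : tailQ h 0 = 1.
Proof. by rewrite /tailQ /tgf big_ord0 mul0r subr0. Qed.

Lemma tailQ_ge0 h k : 0 <= tailQ h k.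
Proof.
rewrite subr_ge0 ler_pdivrMr// mul1r.
exact: (tgf_le_lim p0 k (ltW (x_gt0 h.+1)) (@xS h)).
Qed.

Hypothesis DH : forall u, u \in D -> (size u < H)%N.

Lemma tgf_tail_cvg h m :
  (fun K => \sum_(k < K) (m <= k)%N%:R * (p k * x h.+1 ^+ k)) @ \oo --> x h * tailQ h m.
Proof.
have -> : x h * tailQ h m = x h - tgf p m (x h.+1).
  by rewrite /tailQ mulrBr mulr1 mulrCA mulfV ?mulr1// gt_eqF.
have cv : (fun K => tgf p K (x h.+1) - tgf p m (x h.+1)) @ \oo --> x h - tgf p m (x h.+1).
  by apply: cvgB; [exact: xS|exact: cvg_cst].
apply: cvg_trans cv; apply: near_eq_cvg; exists m => // K /= mK.
rewrite /tgf (big_ord_widen _ (fun k => p k * x h.+1 ^+ k) mK).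
rewrite [X in _ - X]big_mkcond -sumrB; apply: eq_bigr => k _.
by case: (leqP m k) => _ /=; rewrite ?subrr ?mul0r ?subr0 ?mul1r.
Qed.

(** As K tends to infinity, the vertices outside D contribute the total mass of
    their offspring law, and those of D a tail of it. *)
Lemma fullv_cvg n u : (size u + n = H)%N ->
  (forall K, fullv p c N K (x H - c) n u <= x (size u) * subtree_prod N D tailQ u) /\
  (fun K => fullv p c N K (x H - c) n u) @ \oo --> x (size u) * subtree_prod N D tailQ u.
Proof.
elim: n u => [|n IH] u uH.
  have uD : u \notin D.
    by apply/negP => /DH; rewrite -uH addn0 ltnn.
  have -> : x (size u) * subtree_prod N D tailQ u = x H.
    by rewrite subtree_prod_out// mulr1 -uH addn0.
  split=> [K|] /=; first by rewrite addrC subrK.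
  by rewrite addrC subrK; exact: cvg_cst.
have uiH i : (size (rcons u i) + n = H)%N by rewrite size_rcons addSnnS.
pose S := \prod_(i < N u) subtree_prod N D tailQ (rcons u i).
pose a K k := (N u <= k)%N%:R * (p k * \prod_(i < k) fullv p c N K (x H - c) n (rcons u i)).
pose b k := ((N u <= k)%N%:R * (p k * x (size u).+1 ^+ k)) * S.
have bE k : b k = (N u <= k)%N%:R * (p k * \prod_(i < k) (x (size u).+1 *
    subtree_prod N D tailQ (rcons u i))).
  rewrite /b; case: leqP => Nk; rewrite ?mul0r// !mul1r -mulrA big_split/=.
  rewrite prodr_const card_ord; congr (_ * (_ * _)).
  rewrite /S (big_ord_widen _ (fun i => subtree_prod N D tailQ (rcons u i)) Nk).
  rewrite big_mkcond; apply: eq_bigr => i _; case: ltnP => // iN.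
  by rewrite (subtree_prod_big ND).
have f0 K v : 0 <= fullv p c N K (x H - c) n v by rewrite fullv_ge0// subr_ge0.
have a0 K k : 0 <= a K k by rewrite !mulr_ge0// prodr_ge0.
have ab K k : a K k <= b k.
  rewrite bE; do 2 apply: ler_wpM2l => //.
  apply: ler_prod => i _; rewrite f0/=.
  by have := (IH _ (uiH i)).1 K; rewrite size_rcons.
have b0 k : 0 <= b k by exact: le_trans (a0 0%N k) (ab 0%N k).
have ac k : a ^~ k @ \oo --> b k.
  rewrite bE; apply: cvgMr; apply: cvgMr.
  apply: cvg_big => [|i _]; first exact: mul_continuous.
  by have := (IH _ (uiH i)).2; rewrite size_rcons.
have bs : (fun K => \sum_(k < K) b k) @ \oo --> x (size u) * subtree_prod N D tailQ u.
  rewrite (subtree_prod_rec ND tailQ0) mulrA.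
  under eq_fun do rewrite -mulr_suml.
  by apply: cvgMl; exact: tgf_tail_cvg.
split; last exact: (tannery a0 ab ac bs).
move=> K; apply: (@le_trans _ _ (\sum_(k < K) b k)); first by apply: ler_sum => k _; exact: ab.
rewrite -(cvg_lim (@Rhausdorff R) bs).
apply: (@nondecreasing_cvgn_le _ (fun K => \sum_(k < K) b k)).
  by apply/nondecreasing_seqP => m; rewrite big_ord_recr/= lerDl.
by apply/cvg_ex; eexists; exact: bs.
Qed.

End value_limit.

(** * Averaging over the limit variable *)

Section averaging.
Context {R : realType}.
Notation leb := (@lebesgue_measure R).
Notation pos := (`]0%R, +oo[%classic : set R).
Variables (p : nat -> R) (c : R) (w : R -> R).
Notation mu := (fine (mean p)).
Notation wint := (wint w).
Notation lap := (lap w).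
Hypotheses (p0 : forall k, 0 <= p k) (c0 : 0 <= c).
Hypothesis cp0 : c = 0 -> p 0%N = 0.
Hypotheses (mu1 : 1 < mu) (dw : cv_density w).
Hypothesis c1 : c < 1.
Hypothesis tgf1 : tgf p ^~ 1 @ \oo --> (1 : R).
Hypothesis tgfc : tgf p ^~ c @ \oo --> c.
Hypothesis w_mass : w1 w = (1 - c)%:E.
Hypothesis explore1_le : first_generation_le p c w.
Variables (N : word -> nat) (D : seq word) (H : nat).
Hypotheses (ND : prescription N D) (DH : forall u, u \in D -> (size u < H)%N).
Variables (PF : R -> R) (ell : R).
Hypotheses (PF0 : forall t, 0 <= PF t) (PF1 : forall t, PF t <= 1).
Hypothesis PFell : PF @ +oo --> ell.
Hypothesis explore_le_PF : forall K theta, 0 < theta ->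
  explore p c N K H root_st (mass p w theta H) <= PF theta * w theta.
Hypothesis explore_compl_le_PF : forall K theta, 0 < theta ->
  explore p c (fun=> 0%N) K H root_st (mass p w theta H) <=
  explore p c N K H root_st (mass p w theta H) + (1 - PF theta) * w theta.

Let mu0 : 0 < mu. Proof. exact: lt_trans mu1. Qed.

Let ell01 : 0 <= ell <= 1.
Proof.
have cell : cvg (PF @ +oo) by apply/cvg_ex; exists ell.
rewrite -(cvg_lim (@Rhausdorff R) PFell); apply/andP; split.
  by apply: limr_ge => //; exact: nearW.
by apply: limr_le => //; exact: nearW.
Qed.

(** The exponential moment of order [l mu^-h] of W, as the value of generation h. *)
Definition moment (l : R) (h : nat) : R := c + fine (lap (l / mu ^+ h)).

Let lapfin l : (lap l < +oo)%E -> 0 < l -> forall h, lap (l / mu ^+ h) \is a fin_num.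
Proof.
move=> lfin l0 h; apply: (lap_fin dw _ lfin).
rewrite ler_pdivrMr ?exprn_gt0// ler_peMr ?(ltW l0)//.
by rewrite exprn_ege1// ltW.
Qed.

Lemma moment_gt0 l h : (lap l < +oo)%E -> 0 < l -> 0 < moment l h.
Proof.
move=> lfin l0; rewrite ltr_wpDl// fine_gt0//; apply/andP; split; last first.
  by rewrite -ge0_fin_numE ?lapfin// (lap_ge0 dw).
apply: (wint_gt0 dw (a := 0) (b := 1)) => //.
- exact: measurable_exp.
- by move=> x _ _; exact: expR_gt0.
Qed.

(** The functional equation: [f] maps the moment of order [l / mu] to that of order
    l. *)
Lemma moment_step l h : (lap l < +oo)%E -> 0 < l ->
  tgf p ^~ (moment l h.+1) @ \oo --> moment l h.
Proof.
move=> lfin l0; have lh0 : 0 < l / mu ^+ h by rewrite divr_gt0// exprn_gt0.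
have E : l / mu ^+ h.+1 = l / mu ^+ h / mu by rewrite exprSr invfM mulrA.
have fh := lapfin lfin l0 h; have fh1 := lapfin lfin l0 h.+1.
rewrite E in fh1.
have le K : tgf p K (moment l h.+1) <= moment l h.
  have h1 := @lap_ge _ _ _ _ p0 c0 cp0 mu1 dw explore1_le (l / mu ^+ h) K.
  rewrite /moment E -lerBlDl; apply: le_trans (h1 _ fh1).
    by rewrite lerB//; exact: (tgf_le_lim p0 K c0 tgfc).
  by rewrite -ge0_fin_numE; [exact: fh|exact: (lap_ge0 dw)].
have m0 : 0 <= moment l h.+1 by apply/ltW/moment_gt0.
have cv : cvgn (fun K => tgf p K (moment l h.+1)).
  apply: nondecreasing_is_cvgn; first exact: (tgf_homoK p0).
  by exists (moment l h) => _ [K _ <-]; exact: le.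
suff -> : moment l h = limn (fun K => tgf p K (moment l h.+1)) by exact: cv.
apply/eqP; rewrite eq_le; apply/andP; split; last first.
  by apply: limr_le => //; exact: nearW.
have [F FE] : exists F, F = limn (fun K => tgf p K (moment l h.+1)) by eexists.
rewrite -FE.
have FK K : tgf p K (c + fine (lap (l / mu ^+ h / mu))) <= F.
  rewrite -E FE; apply: (tgf_le_lim p0 K m0); exact: cv.
have := lap_functional_le p0 c0 cp0 mu1 dw tgf1 tgfc w_mass explore1_le (ltW lh0) fh1 FK.
rewrite /moment -(fineK fh); set La := fine _; rewrite lee_fin => La'.
by rewrite addrC -lerBrDr.
Qed.

Definition tail_prod l := \prod_(u <- D) tailQ p (moment l) (size u) (N u).

Let full_cvg l N' D' : prescription N' D' -> (forall u, u \in D' -> (size u < H)%N) ->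
  (lap l < +oo)%E -> 0 < l ->
  (fun K => fullv p c N' K (fine (lap (l / mu ^+ H))) H [::]) @ \oo -->
  moment l 0 * \prod_(u <- D') tailQ p (moment l) (size u) (N' u).
Proof.
move=> ND' DH' lfin l0.
have := (@fullv_cvg _ p c N' D' (moment l) H p0 c0 ND' (fun h => moment_gt0 h lfin l0)
  _ (fun h => @moment_step l h lfin l0) DH' H [::] erefl).2.
rewrite subtree_prod_root /moment [X in X - c]addrC addrK; apply.
by rewrite lerDl fine_ge0// (lap_ge0 dw).
Qed.

Let presc0 : prescription (fun=> 0%N) [::].
Proof. by split. Qed.

Let c_ext N' K n : 0 <= c * extv p c N' K n [::] <= c.
Proof.
by rewrite mulr_ge0 ?extv_ge0//= extv_le//; exact: (tgf_le_lim p0 K c0 tgfc).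
Qed.

Let integral_explore_bnd l M N1 N2 K (a b : R) : 0 < l -> (lap l < +oo)%E ->
  0 <= a -> 0 <= b ->
  (forall x, 0 < x -> expR (l * x) * explore p c N1 K H root_st (mass p w x H) <=
     b * (expR (l * x) * explore p c N2 K H root_st (mass p w x H)) +
     (a * expR (l * x) + low M l x) * w x) ->
  fullv p c N1 K (fine (lap (l / mu ^+ H))) H [::] - c * extv p c N1 K H [::] <=
  b * (fullv p c N2 K (fine (lap (l / mu ^+ H))) H [::] - c * extv p c N2 K H [::]) +
  (a * fine (lap l) + fine (wint (low M l))).
Proof.
move=> l0 lfin a0 b0 hx.
have lowfin : wint (low M l) \is a fin_num.
  rewrite ge0_fin_numE; last by apply: (wint_ge0 dw) => x _; exact: low_ge0.
  by apply: le_lt_trans (wint_low_le c0 dw w_mass M (ltW l0)) _; exact: ltry.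
have lfn : lap l \is a fin_num by rewrite ge0_fin_numE; [exact: lfin|exact: (lap_ge0 dw)].
have mex N' : measurable_fun pos (fun x =>
    (expR (l * x) * explore p c N' K H root_st (mass p w x H))).
  apply: measurable_funM; last exact: (measurable_explore p0 c0 mu1 dw).
  exact: measurable_funS (measurable_exp l).
have ex0 N' x : pos x ->
    (0 <= (expR (l * x) * explore p c N' K H root_st (mass p w x H))%:E)%E.
  rewrite posP => x0; rewrite lee_fin mulr_ge0 ?expR_ge0//.
  by apply: explore_ge0 => // r; exact: mass_ge0.
have mlow : measurable_fun setT (fun x => a * expR (l * x) + low M l x).
  apply: measurable_funD; last exact: measurable_low.
  by apply: measurable_funM => //; exact: measurable_exp.
have low0 x : 0 < x -> 0 <= a * expR (l * x) + low M l x.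
  by move=> _; rewrite addr_ge0 ?low_ge0// mulr_ge0 ?expR_ge0.
rewrite -lee_fin -(integral_explore_lap p0 c0 cp0 mu1 dw N1 K (lapfin lfin l0 H)).
rewrite EFinD EFinM -(integral_explore_lap p0 c0 cp0 mu1 dw N2 K (lapfin lfin l0 H)).
rewrite EFinD EFinM.
rewrite (fineK lfn) (fineK lowfin).
rewrite -(wintZ dw a0); [|exact: measurable_exp|by move=> x _; exact: expR_ge0].
rewrite -(wintD dw); last 4 first.
- by apply: measurable_funM => //; exact: measurable_exp.
- exact: measurable_low.
- by move=> x _; rewrite mulr_ge0 ?expR_ge0.
- by move=> x _; exact: low_ge0.
rewrite -ge0_integralZl//; last 2 first.
- by apply/measurable_EFinP; exact: mex.
- by move=> x; exact: ex0.
rewrite -ge0_integralD//; last 4 first.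
- by move=> x x0; rewrite mule_ge0 ?ex0.
- by apply: measurable_funeM; apply/measurable_EFinP; exact: mex.
- by move=> x; rewrite posP => x0; rewrite lee_fin mulr_ge0 ?low0// ltW// (cvd_gt0 dw).
- exact: (measurable_wint dw).
apply: ge0_le_integral => //.
- by move=> x; exact: ex0.
- by apply/measurable_EFinP; exact: mex.
- apply: emeasurable_funD; last exact: (measurable_wint dw).
  by apply: measurable_funeM; apply/measurable_EFinP; exact: mex.
- by move=> x; rewrite posP => x0; rewrite -EFinM -EFinD lee_fin; exact: hx.
Qed.

(** The bounds on the explorations are integrated against [expR (l * x)]. Beyond M the
    probability [PF] is within eps of its limit; below M it is only known to be in
    [0, 1], at the cost of the integral of [low]. *)
Lemma tail_prod_estimate l M eps : 0 < l -> (lap l < +oo)%E -> 0 < eps ->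
  (forall t, M < t -> `|ell - PF t| <= eps) ->
  moment l 0 * tail_prod l <= (ell + eps) * fine (lap l) + fine (wint (low M l)) + c /\
  (ell - eps) * fine (lap l) - fine (wint (low M l)) <= moment l 0 * tail_prod l.
Proof.
move=> l0 lfin eps0 Mell; have /andP[ell0 ell1] := ell01.
have near_ell t : M < t -> ell - eps <= PF t <= ell + eps.
  by move=> /Mell; rewrite ler_norml => /andP[h1 h2]; apply/andP; split; lra.
have FN := full_cvg ND DH lfin l0.
have F0 := @full_cvg l _ _ presc0 (fun u (uD : u \in [::]) => False_ind _ (notF uD)) lfin l0.
rewrite big_nil mulr1 in F0.
have [La LaE] : exists La, La = fine (lap l) by eexists.
have [lo loE] : exists lo, lo = fine (wint (low M l)) by eexists.
have bnd a b N1 N2 K := @integral_explore_bnd l M N1 N2 K a b l0 lfin.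
rewrite -LaE -loE; rewrite -LaE -loE in bnd.
have m0E : moment l 0 = c + La by rewrite /moment expr0 divr1 LaE.
split.
  rewrite -(cvg_lim (@Rhausdorff R) FN); apply: limr_le; first by apply/cvg_ex; eexists; exact: FN.
  apply: nearW => K.
  have /andP[_ cN] := c_ext N K H.
  have := bnd (ell + eps) 0 N N K _ (lexx 0) _; rewrite mul0r add0r => h.
  rewrite -lerBlDr; apply: le_trans (h _ _); first by rewrite lerB.
    by lra.
  move=> x x0; rewrite mul0r add0r mulrC.
  have e0 := expR_ge0 (l * x); have w0 := cvd_gt0 dw x0.
  apply: le_trans (ler_wpM2r e0 (explore_le_PF K x0)) _.
  rewrite mulrAC ler_wpM2r ?(ltW w0)// /low.
  have [xM|xM] := boolP (x <= M); rewrite ?mulr1 ?mulr0 ?addr0.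
    by rewrite -[X in _ <= _ + X]mul1r -mulrDl ler_wpM2r//; have := PF1 x; lra.
  by rewrite ler_wpM2r//; rewrite -ltNge in xM; have /andP[] := near_ell _ xM.
rewrite m0E in F0.
have FD : (fun K => fullv p c N K (fine (lap (l / mu ^+ H))) H [::] + c + ((1 - ell + eps) * La + lo)
   - fullv p c (fun=> 0%N) K (fine (lap (l / mu ^+ H))) H [::]) @ \oo -->
   moment l 0 * tail_prod l + c + ((1 - ell + eps) * La + lo) - (c + La).
  apply: cvgB; last exact: F0.
  by apply: cvgD; [apply: cvgD; [exact: FN|exact: cvg_cst]|exact: cvg_cst].
suff : 0 <= moment l 0 * tail_prod l + c + ((1 - ell + eps) * La + lo) - (c + La) by lra.
rewrite -(cvg_lim (@Rhausdorff R) FD); apply: limr_ge; first by apply/cvg_ex; eexists; exact: FD.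
apply: nearW => K.
have /andP[cN _] := c_ext N K H; have /andP[_ c0'] := c_ext (fun=> 0%N) K H.
have a0 : 0 <= 1 - ell + eps by lra.
have h := bnd (1 - ell + eps) 1 (fun=> 0%N) N K a0 ler01.
suff hle : fullv p c (fun=> 0%N) K (fine (lap (l / mu ^+ H))) H [::]
    - c * extv p c (fun=> 0%N) K H [::] <=
    1 * (fullv p c N K (fine (lap (l / mu ^+ H))) H [::] - c * extv p c N K H [::]) +
    ((1 - ell + eps) * La + lo).
  move: hle cN c0'; move: (fullv p c N _ _ _ _) (extv p c N _ _ _)
    (fullv p c _ K _ _ _) (extv p c _ K _ _) => A B A' B'.
  by rewrite mul1r; lra.
apply: h.
move=> x x0; have e0 := expR_ge0 (l * x); have w0 := cvd_gt0 dw x0.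
rewrite mul1r; apply: le_trans (ler_wpM2l e0 (explore_compl_le_PF K x0)) _.
rewrite mulrDr lerD2l mulrA ler_wpM2r ?(ltW w0)// /low mulrC.
have [xM|xM] := boolP (x <= M); rewrite ?mulr1 ?mulr0 ?addr0.
  by rewrite -[X in _ <= _ + X]mul1r -mulrDl ler_wpM2r//; have := PF0 x; lra.
by rewrite ler_wpM2r//; rewrite -ltNge in xM; have /andP[] := near_ell _ xM; lra.
Qed.

(** The average of [PF] under weights that escape to infinity tends to its limit at
    infinity; it is also the probability of the prescribed tree under a
    Galton-Watson law, up to the mass c of extinction. *)
Lemma tail_prod_cvg (lam : nat -> R) : (forall n, 0 < lam n) ->
  (forall n, (lap (lam n) < +oo)%E) -> lap (lam n) @[n --> \oo] --> +oo%E ->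
  (forall M eps, 0 < eps ->
    \forall n \near \oo, (wint (low M (lam n)) <= eps%:E * lap (lam n))%E) ->
  (fun n => tail_prod (lam n)) @ \oo --> ell.
Proof.
move=> lam0 lfin lapy conc; apply/cvgrPdist_le => e e0.
have e3 : 0 < e / 3 by lra.
have [M [_ HM]] := (cvgrPdist_le _ _).1 PFell _ e3.
have near1 := conc M _ e3.
have near2 : \forall n \near \oo, ((c / (e / 3) + 1)%:E <= lap (lam n))%E.
  by move/cvgeyPge : lapy; apply.
near=> n.
have [up dn] := tail_prod_estimate (lam0 n) (lfin n) e3 HM.
have h1 : fine (wint (low M (lam n))) <= e / 3 * fine (lap (lam n)).
  have lfn : lap (lam n) \is a fin_num.
    by rewrite ge0_fin_numE; [exact: lfin|exact: (lap_ge0 dw)].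
  have : (wint (low M (lam n)) <= (e / 3)%:E * lap (lam n))%E by near: n.
  rewrite -{1}(fineK lfn) -EFinM => h.
  rewrite -lee_fin fineK// ge0_fin_numE; first by apply: le_lt_trans h _; exact: ltry.
  by apply: (wint_ge0 dw) => x _; exact: low_ge0.
have h2 : c / (e / 3) + 1 <= fine (lap (lam n)).
  have : ((c / (e / 3) + 1)%:E <= lap (lam n))%E by near: n.
  have lfn : lap (lam n) \is a fin_num.
    by rewrite ge0_fin_numE; [exact: lfin|exact: (lap_ge0 dw)].
  by rewrite -{1}(fineK lfn) lee_fin.
have m0 h : 0 < moment (lam n) h by exact: moment_gt0 (lfin n) (lam0 n).
have mS h := @moment_step (lam n) h (lfin n) (lam0 n).
have h3 : 0 <= tail_prod (lam n) <= 1.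
  have Q0 h k : 0 <= tailQ p (moment (lam n)) h k by exact: tailQ_ge0 p0 m0 mS h k.
  apply/andP; split; first by apply: prodr_ge0 => u _; exact: Q0.
  apply: prodr_ile1 => u _; rewrite Q0/=.
  rewrite /tailQ lerBlDr lerDl; apply: divr_ge0; last exact/ltW/m0.
  by apply: sumr_ge0 => k _; apply: mulr_ge0; [exact: p0|apply/exprn_ge0/ltW/m0].
move: up dn h1 h2; rewrite /moment expr0 divr1.
move: (fine (wint (low M (lam n)))) (fine (lap (lam n))) (tail_prod (lam n)) h3 => lo L Q.
move=> /andP[Q0 Q1] up dn h1 h2; have /andP[l0 l1] := ell01.
have L0 : 0 < L by apply: lt_le_trans h2; rewrite ltr_wpDl// divr_ge0// ltW.
have cL : c <= e / 3 * L.
  rewrite mulrC -ler_pdivrMr//; apply: le_trans h2; lra.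
have cQ : 0 <= c * Q <= c by rewrite mulr_ge0//= ler_piMr.
have {cQ} /andP[cQ0 cQ1] := cQ.
rewrite ler_norml; apply/andP; split; rewrite -(ler_pM2r L0).
  by move: up; rewrite mulrDl (mulrDl ell) => up; rewrite mulrBl; lra.
by move: dn; rewrite mulrBl (mulrDl c) => dn; rewrite mulrBl; lra.
Unshelve. all: by end_near. Qed.

End averaging.

(** * Tails of the limiting offspring laws *)

Section tail_limit.
Context {R : realType}.
Variable p : nat -> R.
Hypotheses (p0 : forall k, 0 <= p k).
Hypothesis tgf1 : tgf p ^~ 1 @ \oo --> (1 : R).

Lemma supp_supP k :
  (k%:R%:E <= supp_sup p)%E -> k = 0%N \/ exists2 m, (k <= m)%N & 0 < p m.
Proof.
case: k => [|k] ksup; [by left|right].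
have : (k%:R%:E < supp_sup p)%E by apply: lt_le_trans ksup; rewrite lte_fin ltr_nat.
move=> /ereal_sup_gt[_ [m pm <-]]; rewrite lte_fin ltr_nat => km.
by exists m.
Qed.

Lemma supp_sup_out k m : ~~ (k%:R%:E <= supp_sup p)%E -> (k <= m)%N -> p m = 0.
Proof.
move=> ksup km; apply/eqP; rewrite eq_le p0 andbT leNgt; apply: contra ksup => pm.
apply: (@le_trans _ _ m%:R%:E); first by rewrite lee_fin ler_nat.
by apply: ereal_sup_ubound; exists m.
Qed.

Lemma tgf1_le K : tgf p K 1 <= 1.
Proof. exact: (tgf_le_lim p0 K ler01 tgf1). Qed.

(** When the value of a generation tends to infinity, every fixed number of
    children below the supremum of the support is eventually exceeded: either the
    value [y] of the next generation is bounded, or the terms of the generating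
    function beyond [k] dominate the previous ones. *)
Lemma tail_ratio_cvg (x y : nat -> R) k :
  (forall n, 0 < y n) -> (forall n, tgf p ^~ (y n) @ \oo --> x n) ->
  (x n)%:E @[n --> \oo] --> +oo%E -> (k%:R%:E <= supp_sup p)%E ->
  (fun n => tgf p k (y n) / x n) @ \oo --> (0 : R).
Proof.
move=> y0 yx xoo /supp_supP[->|[m km pm]].
  by under eq_fun do rewrite /tgf big_ord0 mul0r; exact: cvg_cst.
apply/cvgrPdist_le => e e0.
(* y <= B is settled by x tending to infinity, y > B by the term of index m >= k *)
pose B := Num.max 1 (p m * e)^-1.
have B1 : 1 <= B by rewrite le_max lexx.
have B0 : 0 < B by exact: lt_le_trans B1.
have near1 : \forall n \near \oo, ((B ^+ k / e)%:E <= (x n)%:E)%E.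
  by move/cvgeyPge : xoo; apply.
near=> n.
have hx : B ^+ k / e <= x n by rewrite -lee_fin; near: n.
have x0 : 0 < x n by apply: lt_le_trans hx; rewrite divr_gt0 ?exprn_gt0.
have t0 : 0 <= tgf p k (y n).
  by apply: sumr_ge0 => j _; rewrite mulr_ge0// exprn_ge0// ltW.
rewrite sub0r normrN ger0_norm ?divr_ge0 ?(ltW x0)// ler_pdivrMr//.
have [yB|By] := leP (y n) B.
  apply: (@le_trans _ _ (B ^+ k)); last by rewrite mulrC -ler_pdivrMr.
  apply: (@le_trans _ _ (tgf p k 1 * B ^+ k)).
    rewrite /tgf mulr_suml; apply: ler_sum => j _; rewrite expr1n mulr1 ler_wpM2l//.
    apply: (@le_trans _ _ (B ^+ j)); first by rewrite lerXn2r ?nnegrE// ltW.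
    by rewrite ler_weXn2l// ltnW.
  by rewrite ler_piMl ?exprn_ge0 ?(ltW B0)// tgf1_le.
have y1 : 1 <= y n by apply: le_trans B1 _; exact: ltW.
have hm : p m * y n ^+ m <= x n.
  apply: le_trans (tgf_le_lim p0 m.+1 (ltW (y0 n)) (@yx n)).
  rewrite /tgf big_ord_recr/= lerDr; apply: sumr_ge0 => j _.
  by rewrite mulr_ge0// exprn_ge0// ltW.
have [kE|[j kE]] : k = 0%N \/ exists j, k = j.+1.
- by case: (k); [left|right; eexists].
- by rewrite kE /tgf big_ord0 mulr_ge0 ?ltW.
rewrite kE; rewrite kE in km; apply: (@le_trans _ _ (y n ^+ j)).
  apply: (@le_trans _ _ (tgf p j.+1 1 * y n ^+ j)).
    rewrite /tgf mulr_suml; apply: ler_sum => i _; rewrite expr1n mulr1 ler_wpM2l//.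
    by rewrite ler_weXn2l// -ltnS.
  by rewrite ler_piMl ?exprn_ge0 ?(ltW (y0 n))// tgf1_le.
apply: (@le_trans _ _ (e * (p m * y n ^+ m))); last by rewrite ler_wpM2l// ltW.
apply: (@le_trans _ _ (e * (p m * y n ^+ j.+1))); last first.
  by rewrite !ler_wpM2l ?(ltW e0)// ler_weXn2l.
rewrite exprS !mulrA ler_peMl ?exprn_ge0 ?(ltW (y0 n))//.
have : (p m * e)^-1 <= y n by apply: le_trans (ltW By); rewrite le_max lexx orbT.
by rewrite -ler_pdivrMl ?invr_gt0 ?mulr_gt0// mulr1 mulrC.
Unshelve. all: by end_near. Qed.

Lemma tail_ratio_out (x y : R) k : tgf p ^~ y @ \oo --> x ->
  ~~ (k%:R%:E <= supp_sup p)%E -> tgf p k y = x.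
Proof.
move=> yx ksup; rewrite -(cvg_lim (@Rhausdorff R) yx); apply/esym/cvg_lim => //.
apply: cvg_near_cst; exists k => // K /= kK.
rewrite /tgf [RHS](big_ord_widen _ (fun j => p j * y ^+ j) kK) [RHS]big_mkcond.
apply: eq_bigr => j _; case: ltnP => // kj.
by rewrite (supp_sup_out ksup kj) mul0r.
Qed.

(** The law of the number of children at generation [h], through its tails, when
    [z] gives the values of the successive generations. *)
Definition limQ (z : nat -> \bar R) (h k : nat) : R :=
  if z h == +oo%E then (k%:R%:E <= supp_sup p)%E%:R
  else 1 - tgf p k (fine (z h.+1)) / fine (z h).

Lemma tailQ_cvg (x : nat -> nat -> R) (z : nat -> \bar R) h k :
  (forall n h, 0 < x n h) -> (forall n h, tgf p ^~ (x n h.+1) @ \oo --> x n h) ->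
  (forall h, (x n h)%:E @[n --> \oo] --> z h) -> (0 < z h)%E ->
  (z h < +oo -> z h.+1 < +oo)%E -> (0 <= z h.+1)%E ->
  (fun n => tailQ p (x n) h k) @ \oo --> limQ z h k.
Proof.
move=> x0 xS xz z0 zfin z10; rewrite /limQ /tailQ; case: eqP => [zoo|/eqP zoo].
  case: (boolP (k%:R%:E <= supp_sup p)%E) => ksup /=.
    rewrite -[X in _ --> X]subr0; apply: cvgB; first exact: cvg_cst.
    apply: (@tail_ratio_cvg (fun n => x n h) (fun n => x n h.+1)) ksup => [n|n|].
    - exact: x0.
    - exact: (@xS n h).
    - by rewrite -zoo; exact: (@xz h).
  apply: cvg_near_cst; apply: nearW => n.
  by rewrite (tail_ratio_out (@xS n h) ksup) divff ?subrr// gt_eqF.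
have zh : (z h < +oo)%E by rewrite ltey.
have fin1 : z h.+1 \is a fin_num by rewrite ge0_fin_numE// zfin.
have fin0 : z h \is a fin_num by rewrite ge0_fin_numE// ltW.
have cf h' : z h' \is a fin_num -> (fun n => x n h') @ \oo --> fine (z h').
  by move=> zf; have := @xz h'; rewrite -{1}(fineK zf) => /fine_cvg.
apply: cvgB; first exact: cvg_cst.
apply: cvgM; last by apply: cvgV; [rewrite gt_eqF// fine_gt0// z0|exact: cf].
apply: cvg_big => [|j _]; first exact: add_continuous.
apply: cvgM; first exact: cvg_cst.
have cj : {for fine (z h.+1), continuous (fun t : R => t ^+ j)} by exact: exprn_continuous.
exact: (cvg_comp _ _ (cf _ fin1) cj).
Qed.

End tail_limit.

(** * Local convergence of prescribed trees *)

Section events.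
Variables (N : word -> nat) (D : seq word).

Definition fits (t : tree) : Prop :=
  forall u i, u \in D -> (i < N u)%N -> vertices t (rcons u i).

Lemma vertices_presc t u : prescription N D -> fits t -> u \in D -> vertices t u.
Proof.
move=> ND ft; elim/last_ind: u => [|u i _] uD; first exact: tree_root.
by have [uD' iN] := presc_in ND uD; exact: ft.
Qed.

Lemma fits_at_least H t : prescription N D -> (forall u, u \in D -> (size u < H)%N) ->
  fits t <-> at_least N 0 H t.
Proof.
move=> ND DH; split.
  move=> ft u _ _ i iN; apply: ft => //; apply: contraLR iN => uD.
  by rewrite (presc_out ND uD).
move=> al; suff inT u : u \in D -> vertices t u.
  by move=> u i uD iN; apply: al iN; [exact: inT|rewrite /= add0n DH].
elim/last_ind: u => [|u i IH] uD; first exact: tree_root.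
have [uD' iN] := presc_in ND uD.
by apply: al iN; [exact: IH|rewrite /= add0n DH].
Qed.

End events.

Section continuity.
Context {R : realType}.

Definition count_ge (n : nat) (x : child_count) : bool :=
  match x with
  | None => true
  | Some None => n == 0%N
  | Some (Some k) => (n <= k)%N
  end.

Lemma count_geP t n u : vertices t u ->
  (count_ge n (nb_children t u) <-> forall i, (i < n)%N -> vertices t (rcons u i)).
Proof.
move=> tu; case: nb_childrenP => [//|k _ tk|_ ti] /=; last by [].
split=> [nk i iN|H]; first by apply/tk/(leq_trans iN).
by rewrite leqNgt; apply/negP => /H/tk; rewrite ltnn.
Qed.

Lemma count_ge_out t n u : ~ vertices t u -> count_ge n (nb_children t u) = (n == 0%N).
Proof. by case: nb_childrenP. Qed.

Lemma fits_count N D t : prescription N D ->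
  fits N D t <-> all (fun u => count_ge (N u) (nb_children t u)) D.
Proof.
move=> ND; split.
  move=> ft; apply/allP => u uD; have tu := vertices_presc ND ft uD.
  by apply/(count_geP _ tu) => i; exact: ft.
move=> /allP al u i uD iN; apply: (count_geP (N u) _).1 => //; last exact: al.
apply: contrapT => /(count_ge_out (N u)) h; have := al _ uD; rewrite h => /eqP N0.
by rewrite N0 in iN.
Qed.

(** A lower bound only depends on the class of a number of children among finitely
    many finite values and a neighbourhood of infinity. *)
Lemma count_ge_continuous n : continuous (fun x : child_count => (count_ge n x)%:R : R).
Proof.
have locally_cst (x : child_count) (A : set child_count) : nbhs x A ->
    (forall y, A y -> count_ge n y = count_ge n x) ->
    {for x, continuous (fun x : child_count => (count_ge n x)%:R : R)}.
  move=> xA H; apply: cvg_near_cst.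
    exact: (@nbhs_filter _ x).
  apply: (@filterS _ _ (@nbhs_filter _ x) A) xA => y Ay.
  by rewrite H.
case=> [y|].
  apply: (locally_cst _ (Some @` [set y])); last by move=> _ [_ -> <-].
  by apply: one_point_compactification_some_nbhs; exact: discrete_set1.
pose C : set (discrete_topology (option nat)) :=
  [set None] `|` [set Some k | k in `I_n].
apply: (locally_cst _ (Some @` (~` C) `|` [set None])).
  exists C => //; split; last exact: discrete_closed.
  apply: finite_compact; rewrite finite_setU; split; first exact: finite_set1.
  by apply: finite_image; exact: finite_II.
move=> _ [[[k|] nC <-]|->] //=.
  by rewrite leqNgt; apply/negP => kn; apply: nC; right; exists k.
by case: nC; left.
Qed.

Lemma fits_continuous (N : word -> nat) (D : seq word) :
  let u (j : 'I_(size D)) := tnth (in_tuple D) j in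
  continuous (fun x : prod_topology (fun _ : 'I_(size D) => child_count) =>
    \prod_j (count_ge (N (u j)) (x j))%:R : R).
Proof.
move=> u; apply: continuous_big => [|j _ x]; first exact: mul_continuous.
have pj := @proj_continuous _ (fun _ : 'I_(size D) => child_count) j x.
exact: (cvg_comp _ _ pj (@count_ge_continuous (N (u j)) (x j))).
Qed.

End continuity.

Section convergence.
Context {R : realType}.
Variables (d_ : R -> measure_display) (Omega_ : forall theta, measurableType (d_ theta)).
Variables (P_ : forall theta, probability (Omega_ theta) R).
Variables (T_ : forall theta, Omega_ theta -> tree).
Variables (d : measure_display) (Omega : measurableType d) (P : probability Omega R).
Variables (T : Omega -> tree).
Hypotheses (rT_ : forall theta, 0 < theta -> random_tree (@T_ theta)) (rT : random_tree T).
Hypothesis T_cvg : local_cvg_in_law (pinfty_nbhs R) P_ T_ P T.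
Variables (N : word -> nat) (D : seq word) (H : nat).
Hypotheses (ND : prescription N D) (DH : forall u, u \in D -> (size u < H)%N).

Lemma expectation_fits d' (Omega' : measurableType d') (P' : probability Omega' R)
    (T' : Omega' -> tree) : random_tree T' ->
  ('E_P'[fun o => (\prod_(j < size D)
    (count_ge (N (tnth (in_tuple D) j)) (nb_children (T' o) (tnth (in_tuple D) j)))%:R)%R])%E
  = (Pr P' (At T' N 0 H))%:E.
Proof.
move=> rT'; rewrite -PrE; last exact: measurable_at_least.
rewrite -expectation_indic; last exact: measurable_at_least.
congr expectation; apply/funext => o; rewrite indicE.
rewrite -(big_tnth _ _ D xpredT (fun u => (count_ge (N u) (nb_children (T' o) u))%:R)).
have -> : (o \in At T' N 0 H) = all (fun u => count_ge (N u) (nb_children (T' o) u)) D.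
  by apply/idP/idP => [/set_mem/(fits_at_least (T' o) ND DH).2/(fits_count _ ND)|
    /(fits_count _ ND)/(fits_at_least (T' o) ND DH).1/mem_set].
elim: D => [|v s IH]; first by rewrite big_nil.
by rewrite big_cons IH /=; case: count_ge; rewrite ?mul1r ?mul0r.
Qed.

Lemma Pr_At_cvg : (fun theta => Pr (P_ theta) (At (@T_ theta) N 0 H)) @ +oo -->
  Pr P (At T N 0 H).
Proof.
have := @T_cvg (size D) (fun j => tnth (in_tuple D) j) _ (@fits_continuous R N D).
have bnd : exists M : R, forall x : prod_topology (fun _ : 'I_(size D) => child_count),
    `|\prod_j (count_ge (N (tnth (in_tuple D) j)) (x j))%:R : R| <= M.
  exists 1 => x; rewrite ger0_norm; last by apply: prodr_ge0.
  by apply: prodr_ile1 => j _; rewrite ler0n/=; case: count_ge; rewrite ?lexx.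
move=> /(_ bnd); rewrite (expectation_fits P rT) => cv.
suff /fine_cvg : (Pr (P_ theta) (At (@T_ theta) N 0 H))%:E @[theta --> +oo] -->
  (Pr P (At T N 0 H))%:E by [].
apply: cvg_trans cv; apply: near_eq_cvg; exists 0; split => // theta theta0.
by rewrite /= (expectation_fits (P_ theta) (@rT_ theta theta0)).
Qed.

End convergence.

(** * The law of the limit variable *)

Section integral_atom_density.
Context {R : realType}.
Notation leb := (@lebesgue_measure R).
Notation pos := (`]0%R, +oo[%classic : set R).
Variables (nu : {measure set R -> \bar R}) (c : R) (w : R -> R).
Hypotheses (c0 : 0 <= c) (dw : cv_density w).
Hypothesis nuE : forall A : set R, measurable A ->
  nu A = (c%:E * dirac (0%R : R) A + \int[leb]_(t in A `&` pos) (w t)%:E)%E.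

Import HBNNSimple.

Let mpre (g : {nnsfun R >-> R}) (r : R) :
  measurable (g @^-1` [set r] : set R).
Proof. by apply: (measurable_funPTI g); exact: measurable_set1. Qed.

(** With the next lemma, reduces an identity between integrals of a simple function to
    one between the measures of its level sets. *)
Lemma integral_nnsfun_sum (m : {measure set R -> \bar R})
    (g : {nnsfun R >-> R}) :
  (\int[m]_x (g x)%:E = \sum_(r <- fset_set (range g)) r%:E * m (g @^-1` [set r]))%E.
Proof.
under eq_integral do rewrite fimfunE -fsumEFin//.
rewrite ge0_integral_fsum//; last 2 first.
- by move=> r; exact/measurable_EFinP/measurable_funM.
- by move=> r x _; rewrite nnfun_muleindic_ge0.
rewrite fsbig_finite//=; apply: eq_bigr => r _.
by rewrite integralZl_indic_nnsfun// integral_indic// setIT.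
Qed.

Lemma wint_nnsfun_sum (g : {nnsfun R >-> R}) :
  (wint w g = \sum_(r <- fset_set (range g)) r%:E *
     \int[leb]_(t in g @^-1` [set r] `&` pos) (w t)%:E)%E.
Proof.
transitivity (\int[leb]_(x in pos)
    \sum_(r <- fset_set (range g)) ((`|r| * \1_(g @^-1` [set r]) x) * w x)%:E)%E.
  apply: eq_integral => x _; rewrite fimfunE fsbig_finite//= mulr_suml -sumEFin.
  rewrite big_seq [RHS]big_seq; apply: eq_bigr => r.
  by rewrite in_fset_set// => /set_mem[y _ <-]; rewrite ger0_norm.
have mr (r : R) : measurable_fun pos (fun x => (\1_(g @^-1` [set r]) x * w x)%:E).
  by apply: (measurable_wint dw); apply: measurable_indic; exact: mpre.
have r0 (r : R) x : pos x -> (0 <= (\1_(g @^-1` [set r]) x * w x)%:E)%E.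
  by move=> x0; rewrite lee_fin mulr_ge0// (w_ge0 dw).
rewrite ge0_integral_sum//; last 2 first.
- move=> r; apply: (measurable_wint dw (e := fun x => `|r| * \1_(g @^-1` [set r]) x)).
  by apply: measurable_funM => //; apply: measurable_indic; exact: mpre.
- by move=> r x x0; rewrite lee_fin !mulr_ge0// (w_ge0 dw).
rewrite big_seq [RHS]big_seq; apply: eq_bigr => r.
rewrite in_fset_set// => /set_mem[y _ gy].
have -> : (fun x => (`|r| * \1_(g @^-1` [set r]) x * w x)%:E) =
    (fun x => r%:E * (\1_(g @^-1` [set r]) x * w x)%:E)%E.
  by apply/funext => x; rewrite -EFinM mulrA ger0_norm// -gy.
rewrite ge0_integralZl//; [|exact: mr|exact: r0|by rewrite lee_fin -gy].
congr (_ * _)%E; rewrite setIC integral_mkcondr; apply: eq_integral => x _.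
rewrite patchE indicE; case: ifP => _; rewrite ?mul1r ?mul0r//.
Qed.

(** Integration against a law with an atom at 0 and a density on the positive
    half-line; that law is only known on measurable sets. *)
Lemma integral_atom_density (e : R -> R) : measurable_fun setT e -> (forall x, 0 <= e x) ->
  (\int[nu]_x (e x)%:E = (c * e 0)%:E + wint w e)%E.
Proof.
move=> me e0.
have mE : measurable_fun setT (EFin \o e : R -> \bar R).
  by apply/measurable_EFinP.
pose f_ := nnsfun_approx measurableT mE.
have e0' x : setT x -> (0 <= (EFin \o e) x)%E by rewrite lee_fin.
have fcvg x : (fun n => (f_ n x : R)) @ \oo --> e x.
  by have /fine_cvg := @cvg_nnsfun_approx _ _ _ _ measurableT _ mE e0' x I.
have fnd x : {homo (fun n => (f_ n x : R)) : m n / (m <= n)%N >-> m <= n}.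
  by move=> m n mn; exact/lefP/nd_nnsfun_approx.
have step n : (\int[nu]_x (f_ n x)%:E = (c * f_ n 0)%:E + wint w (f_ n))%E.
  rewrite integral_nnsfun_sum wint_nnsfun_sum.
  have -> : ((c * f_ n 0)%:E = c%:E * \sum_(r <- fset_set (range (f_ n)))
      r%:E * dirac (0%R : R) (f_ n @^-1` [set r]))%E.
    rewrite -integral_nnsfun_sum integral_dirac//=.
      by rewrite diracT mul1e EFinM.
    exact/measurable_EFinP.
  have rge0 (r : R) : r \in fset_set (range (f_ n)) -> 0 <= r.
    by rewrite in_fset_set// => /set_mem[y _ <-].
  rewrite [X in (c%:E * X)%E]big_seq ge0_sume_distrr; last first.
    by move=> r /rge0 r0; rewrite mule_ge0.
  rewrite -big_seq -big_split/= big_seq [RHS]big_seq; apply: eq_bigr => r /rge0 r0.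
  rewrite nuE//.
  rewrite ge0_muleDr//.
  - by rewrite muleCA.
  - by rewrite mule_ge0.
  - by apply: integral_ge0 => x [_ x0]; rewrite lee_fin (w_ge0 dw).
have c1 : (\int[nu]_x (f_ n x)%:E)%E @[n --> \oo] --> (\int[nu]_x (e x)%:E)%E.
  have H := @cvg_monotone_convergence _ _ _ nu setT measurableT
    (fun n x => (f_ n x)%:E) _ _ _.
  rewrite [X in _ --> X](_ : _ = \int[nu]_(x in setT) limn (fun n => (f_ n x)%:E))%E.
    apply: H => [n|n x _|x _ m n mn].
    - exact/measurable_EFinP.
    - by rewrite lee_fin.
    - by rewrite lee_fin; exact: fnd.
  apply: eq_integral => x _; apply/esym/cvg_lim => //.
  by apply: cvg_EFin; [exact: nearW|exact: fcvg].
have c2 : ((c * f_ n 0)%:E + wint w (f_ n))%E @[n --> \oo] --> ((c * e 0)%:E + wint w e)%E.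
  apply: cvgeD.
  - by case: (wint w e).
  - by apply: cvg_EFin; [exact: nearW|apply: cvgMr; exact: fcvg].
  - by apply: (wint_cvg dw).
rewrite -(cvg_lim (@ereal_hausdorff R) c1) -(cvg_lim (@ereal_hausdorff R) c2).
by apply: congr_lim; apply/funext => n; exact: step.
Qed.

End integral_atom_density.

Section limit_density.
Context {R : realType}.
Notation leb := (@lebesgue_measure R).
Notation pos := (`]0%R, +oo[%classic : set R).
Variables (p : nat -> R) (c : R) (w : R -> R).
Variables (d : measure_display) (Omega : measurableType d) (P : probability Omega R).
Variable W : {RV P >-> R}.
Hypotheses (c0 : 0 <= c) (c1 : c < 1) (hw : is_limit_density c W w).

Let total : (1 = c%:E + \int[leb]_(t in pos) (w t)%:E)%E.
Proof.
have [_ _ /(_ setT measurableT)] := hw.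
by rewrite setTI diracT mule1 /= => <-; rewrite probability_setT.
Qed.

Lemma limit_density_w1 : (\int[leb]_(t in pos) (w t)%:E = (1 - c)%:E)%E.
Proof.
have := total; move: (\int[leb]_(t in pos) (w t)%:E)%E => [r| |] //=.
by rewrite -EFinD => -[->]; rewrite addrAC subrr add0r.
Qed.

Lemma limit_density_cv : cv_density w.
Proof.
have [w0 wc _] := hw; split => //.
- apply: subspace_continuous_measurable_fun => //.
  apply: continuous_in_subspaceT => x; rewrite inE posP; exact: wc.
- move=> a b a0; have [ab|ba] := leP a b; last first.
    by exists 0 => x ax xb; have := le_trans ax xb; rewrite leNgt ba.
  have [|m _ Hm] := @EVT_max R w a b ab.
    apply: continuous_in_subspaceT => x; rewrite inE/= in_itv/= => /andP[ax _].
    by apply: wc; exact: lt_le_trans ax.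
  by exists (w m) => x ax xb; apply: Hm; rewrite in_itv/= ax xb.
by rewrite limit_density_w1 ltry.
Qed.

Lemma limit_density_mass : w1 w = (1 - c)%:E.
Proof.
by rewrite /w1 /wint -limit_density_w1; apply: eq_integral => x _; rewrite mul1r.
Qed.

Lemma expectation_exp l : ('E_P[fun o => expR (l * W o)%R] = c%:E + lap w l)%E.
Proof.
have me := measurable_exp l.
have [_ _ wE] := hw.
rewrite unlock.
have := @integral_atom_density R _ c w c0 limit_density_cv wE
  (fun x => expR (l * x)) me (fun x => expR_ge0 _).
rewrite mulr0 expR0 mulr1 => <-.
by rewrite ge0_integral_distribution//; exact/measurable_EFinP.
Qed.

Lemma lambda_c_lc : lambda_c W = lc w.
Proof.
rewrite /lambda_c /lc; congr (ereal_sup (_ @` _)); apply/seteqP; split => l /=.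
  by rewrite expectation_exp; case: (lap w l) => [r _| |] //; exact: ltry.
by rewrite expectation_exp => h; rewrite lte_add_pinfty// ltry.
Qed.

Lemma zeta_zt h : zeta p W h = zt p c w h.
Proof. by rewrite /zeta /zt lambda_c_lc; case: lc => // l; rewrite expectation_exp. Qed.

End limit_density.

Section offspring_facts.
Context {R : realType}.
Variables (p : nat -> R) (c : R).
Hypotheses (p_distr : is_distribution p) (hc : is_extinction_root p c).

Let p0 k : 0 <= p k. Proof. by have [] := p_distr. Qed.

Lemma tgf1_cvg : tgf p ^~ 1 @ \oo --> (1 : R).
Proof.
have [_ /(nneseries_cvg p0)] := p_distr.
by apply: cvg_trans; apply: near_eq_cvg; apply: nearW => K;
  rewrite /tgf /series/= big_mkord; apply: eq_bigr => k _; rewrite expr1n mulr1.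
Qed.

Lemma distr_inner_cvg : inner_cvg p.
Proof.
move=> x x0 x1; apply: (cvg_series_bnd (B := 1)) => [k|n].
  by rewrite mulr_ge0// exprn_ge0.
rewrite -[series _ n]/(pseries p x n) -tgfE.
apply: le_trans (tgf1_le p0 tgf1_cvg n); apply: (tgf_homo p0) => //; exact: ltW.
Qed.

Lemma tgfc_cvg : tgf p ^~ c @ \oo --> c.
Proof.
have [c0 c1 gc] := hc; rewrite -[X in _ --> X]gc.
have -> : tgf p ^~ c = pseries p c by apply/funext => K; rewrite tgfE.
exact: distr_inner_cvg.
Qed.

Lemma extinction0 : c = 0 -> p 0%N = 0.
Proof.
move=> c0; have := tgfc_cvg; rewrite c0 => /(cvg_lim (@Rhausdorff R)) <-.
apply/esym/cvg_lim => //; apply: cvg_near_cst; exists 1%N => // -[//|K] _.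
rewrite /tgf big_ord_recl/= expr0 mulr1 big1 ?addr0// => k _.
by rewrite /bump/= exprS mul0r mulr0.
Qed.

Lemma mean_cvg_fine : (mean p < +oo)%E ->
  (fun K => \sum_(k < K) k%:R * p k) @ \oo --> fine (mean p).
Proof.
move=> mfin; have m0 : (0 <= mean p)%E.
  by apply: nneseries_ge0 => k _ _; rewrite lee_fin mulr_ge0.
have k0 k : 0 <= k%:R * p k by rewrite mulr_ge0.
have mE : mean p \is a fin_num by rewrite ge0_fin_numE.
have := nneseries_cvg k0 (esym (fineK mE)).
by apply: cvg_trans; apply: near_eq_cvg; apply: nearW => K; rewrite /series/= big_mkord.
Qed.

End offspring_facts.

(** * From prescribed trees to the Galton-Watson property *)

Section closures.

Lemma vertices_take t v i : vertices t v -> vertices t (take i v).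
Proof.
elim/last_ind: v => [//|v j IH] tv; have tv' := tree_prefix tv.
have [iv|iv] := leqP i (size v).
  by rewrite -cats1 takel_cat//; exact: IH.
by rewrite take_oversize// size_rcons.
Qed.

Lemma vertices_sibling t u i j : (i <= j)%N ->
  vertices t (rcons u j) -> vertices t (rcons u i).
Proof.
move=> ij tj; have [k tk] := tree_children (tree_prefix tj).
apply/tk; move/tk : tj; case: k {tk} => // k; exact: leq_ltn_trans.
Qed.

Variable V : seq word.

(** The strict prefixes of the words of [V], with the number of children that each
    must have for the words of [V] to be vertices. *)
Definition strict_prefixes : seq word :=
  undup (flatten [seq [seq take i v | i <- iota 0 (size v)] | v <- V]).

Definition prefix_children (u : word) : nat :=
  \max_(v <- V | (size u < size v)%N && (take (size u) v == u)) (nth 0%N v (size u)).+1.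

Lemma strict_prefixesP u :
  reflect (exists2 v, v \in V & (size u < size v)%N && (take (size u) v == u))
    (u \in strict_prefixes).
Proof.
rewrite mem_undup; apply: (iffP flattenP) => [[_ /mapP[v vV ->] /mapP[i]]|[v vV]].
  rewrite mem_iota /= add0n => iv ->; exists v => //.
  by rewrite size_takel ?iv ?eqxx// ltnW.
move=> /andP[uv /eqP uE]; exists [seq take i v | i <- iota 0 (size v)].
  exact: map_f.
by apply/mapP; exists (size u) => //; rewrite mem_iota.
Qed.

Lemma prefix_children_out u : u \notin strict_prefixes -> prefix_children u = 0%N.
Proof.
move=> uP; rewrite /prefix_children big_seq_cond big_pred0// => v.
by apply/negP => /andP[vV uv]; move/strict_prefixesP: uP; apply; exists v.
Qed.

Lemma lt_prefix_children u i v : v \in V -> (size u < size v)%N -> take (size u) v = u ->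
  (i <= nth 0 v (size u))%N -> (i < prefix_children u)%N.
Proof.
move=> vV uv vu iv; apply: leq_trans (_ : _ <= (nth 0 v (size u)).+1)%N _ => //.
by rewrite /prefix_children (leq_bigmax_seq v)// uv vu eqxx.
Qed.

Lemma prefix_children_lt u i : (i < prefix_children u)%N -> exists2 v, v \in V &
  [/\ (size u < size v)%N, take (size u) v = u & (i <= nth 0 v (size u))%N].
Proof.
rewrite ltnNge => /negP H; apply: contrapT => nex; apply: H.
apply/bigmax_leqP_seq => v vV /andP[uv /eqP vu]; rewrite leqNgt ltnS; apply/negP => iv.
by apply: nex; exists v.
Qed.

Lemma fits_prefixes t :
  fits prefix_children strict_prefixes t <-> (forall v, v \in V -> vertices t v).
Proof.
split=> [ft v vV|tV u i _ /prefix_children_lt[v vV [uv vu iv]]].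
  case/lastP E : v => [|u i]; first exact: tree_root.
  have uv : (size u < size v)%N by rewrite E size_rcons.
  have vu : take (size u) v = u by rewrite E -cats1 take_size_cat.
  apply: ft; first by apply/strict_prefixesP; exists v => //; rewrite uv vu eqxx.
  by apply: (lt_prefix_children vV uv vu); rewrite E nth_rcons ltnn eqxx.
apply: (vertices_sibling iv); rewrite -{1}vu -take_nth//.
by apply: vertices_take; exact: tV.
Qed.

Lemma strict_prefixes_rcons u i : rcons u i \in strict_prefixes ->
  u \in strict_prefixes /\ (i < prefix_children u)%N.
Proof.
move=> /strict_prefixesP[v vV]; rewrite size_rcons => /andP[uv /eqP vE].
have uv' := ltnW uv; rewrite (take_nth 0%N uv') in vE.
have [vu vi] := rcons_inj vE.
split; first by apply/strict_prefixesP; exists v => //; rewrite uv' vu eqxx.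
by apply: (lt_prefix_children vV uv' vu); rewrite vi.
Qed.

End closures.

Section generation_step.
Variables (V G : seq word) (h : nat) (n : word -> nat).
Hypotheses (Vh : forall v, v \in V -> (size v <= h)%N).
Hypotheses (uG : uniq G) (Gh : forall u, u \in G -> size u = h).
Hypothesis GV : {subset G <= V}.

Definition step_children (u : word) := if u \in G then n u else prefix_children V u.

Lemma strict_prefixes_size u : u \in strict_prefixes V -> (size u < h)%N.
Proof.
move=> /strict_prefixesP[v vV /andP[uv _]]; exact: leq_trans uv (Vh vV).
Qed.

Lemma strict_prefixes_notin u : u \in strict_prefixes V -> u \notin G.
Proof. by move=> /strict_prefixes_size; apply: contraL => /Gh ->; rewrite ltnn. Qed.

Lemma prescription_prefixes : prescription (prefix_children V) (strict_prefixes V).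
Proof.
split; first exact: undup_uniq.
- exact: prefix_children_out.
- exact: strict_prefixes_rcons.
Qed.

Lemma prescription_step : prescription step_children (strict_prefixes V ++ G).
Proof.
split.
- rewrite cat_uniq undup_uniq uG andbT /=.
  by apply/hasPn => u uG'; apply: contraL uG' => /strict_prefixes_notin.
- move=> u; rewrite mem_cat negb_or /step_children => /andP[uP /negbTE ->].
  exact: prefix_children_out.
move=> u i; rewrite mem_cat => uiD.
suff [uP iu] : u \in strict_prefixes V /\ (i < prefix_children V u)%N.
  by rewrite mem_cat uP /step_children (negbTE (strict_prefixes_notin uP)).
have [uiP|] := boolP (rcons u i \in strict_prefixes V).
  exact: strict_prefixes_rcons.
move: uiD => /orP[->//|uiG] _; have uiV := GV uiG.
have s1 : (size u < size (rcons u i))%N by rewrite size_rcons.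
have s2 : take (size u) (rcons u i) = u by rewrite -cats1 take_size_cat.
split; first by apply/strict_prefixesP; exists (rcons u i) => //; rewrite s1 s2 eqxx.
by apply: (lt_prefix_children uiV s1 s2); rewrite nth_rcons ltnn eqxx.
Qed.

Lemma fits_step t : fits step_children (strict_prefixes V ++ G) t <->
  (forall v, v \in V -> vertices t v) /\
  (forall u, u \in G -> count_ge (n u) (nb_children t u)).
Proof.
split=> [ft|[tV tG] u i].
  have tV v : v \in V -> vertices t v.
    apply: (fits_prefixes V t).1 => u i uP iu; apply: ft.
      by rewrite mem_cat uP.
    by rewrite /step_children (negbTE (strict_prefixes_notin uP)).
  split=> // u uG'; apply/(count_geP _ (tV _ (GV uG'))) => i iu.
  by apply: ft; rewrite ?mem_cat ?uG' ?orbT// /step_children uG'.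
rewrite mem_cat /step_children => uD; case: ifPn => uG' iu.
  by apply: (count_geP (n u) (tV _ (GV uG'))).1 => //; exact: tG.
move: uD; rewrite (negbTE uG') orbF => uP.
exact: ((fits_prefixes V t).2 tV).
Qed.

Context {R : realType}.
Variable Q : nat -> nat -> R.

Lemma step_prod : \prod_(u <- strict_prefixes V ++ G) Q (size u) (step_children u) =
  \prod_(u <- strict_prefixes V) Q (size u) (prefix_children V u) *
  \prod_(u <- G) Q h (n u).
Proof.
rewrite big_cat/=; congr (_ * _); apply: eq_big_seq => u uP; rewrite /step_children.
  by rewrite (negbTE (strict_prefixes_notin uP)).
by rewrite uP Gh.
Qed.

End generation_step.

Lemma count_ge_le m n x : (m <= n)%N -> count_ge n x -> count_ge m x.
Proof.
case: x => [[k|]|] //= mn; first exact: leq_trans.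
by move=> /eqP n0; rewrite n0 leqn0 in mn.
Qed.

Section Galton_Watson_law.
Context {R : realType} {d : measure_display} {Omega : measurableType d}.
Variables (P : probability Omega R) (T : Omega -> tree).
Hypothesis rT : random_tree T.
Variable Q : nat -> nat -> R.
Hypothesis Q_ge0 : forall h k, 0 <= Q h k.
Hypothesis Pr_fits : forall N D, prescription N D ->
  Pr P [set o | fits N D (T o)] = \prod_(u <- D) Q (size u) (N u).

Let M := @measurable d Omega.
Let sM : sigma_algebra setT M := @sigma_algebra_measurable d Omega.

Lemma measurable_count u n : measurable [set o | count_ge n (nb_children (T o) u)].
Proof.
have -> : [set o | count_ge n (nb_children (T o) u)] = [set o |
    (vertices (T o) u -> forall i, (i < n)%N -> vertices (T o) (rcons u i)) /\
    (~ vertices (T o) u -> n = 0%N)].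
  apply/seteqP; split => o /=.
    by move=> H; split=> [tu|/(count_ge_out n) E]; [apply/(count_geP _ tu)|move: H; rewrite E => /eqP].
  move=> [H1 H2]; have [tu|tu] := pselect (vertices (T o) u).
    by apply/(count_geP _ tu); exact: H1.
  by rewrite (count_ge_out n tu) H2.
apply: (sigma_setI sM).
  apply: (sigma_imply2 sM); first exact: measurable_vertex.
  apply: (sigma_forall sM) => i; apply: (sigma_imply sM) => _.
  exact: measurable_vertex.
apply: (sigma_imply2 sM).
  by apply: (sigma_setC sM); exact: measurable_vertex.
have [n0|n0] := pselect (n = 0%N).
  suff -> : (fun _ : Omega => n = 0%N) = setT by exact: measurableT.
  by apply/seteqP; split.
suff -> : (fun _ : Omega => n = 0%N) = set0 by exact: measurable0.
by apply/seteqP; split.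
Qed.

Lemma measurable_all (s : seq word) (F : word -> set Omega) :
  (forall u, measurable (F u)) -> measurable [set o | forall u, u \in s -> F u o].
Proof.
move=> mF; apply: (sigma_forall sM) => u; apply: (sigma_imply sM) => _; exact: mF.
Qed.

Section one_generation.
Variables (h : nat) (G : seq word).
Hypotheses (uG : uniq G) (Gh : forall u, u \in G -> size u = h).

Definition all_in (V : seq word) : set Omega :=
  [set o | forall v, v \in V -> vertices (T o) v].
Definition all_ge (n : word -> nat) : set Omega :=
  [set o | forall u, u \in G -> count_ge (n u) (nb_children (T o) u)].

Lemma measurable_all_in V : measurable (all_in V).
Proof. by apply: measurable_all => u; exact: measurable_vertex. Qed.

Lemma measurable_all_ge n : measurable (all_ge n).
Proof. by apply: measurable_all => u; exact: measurable_count. Qed.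

(** The words of V and G are vertices exactly if their strict prefixes have enough
    children; requiring [n u] children of the vertices of G adds factors to the
    product formula for this prescribed tree. *)
Lemma Pr_step V n : (forall v, v \in V -> (size v <= h)%N) ->
  Pr P (all_in V `&` (all_in G `&` all_ge n)) =
  (\prod_(u <- G) Q h (n u)) * Pr P (all_in V `&` all_in G).
Proof.
move=> Vh; pose V' := V ++ G.
have V'h v : v \in V' -> (size v <= h)%N.
  by rewrite mem_cat => /orP[/Vh|/Gh ->].
have GV' : {subset G <= V'} by move=> u uG'; rewrite mem_cat uG' orbT.
have VG o : (all_in V `&` all_in G) o <-> all_in V' o.
  split=> [[oV oG] v|oV]; first by rewrite mem_cat => /orP[/oV|/oG].
  by split=> v vV; apply: oV; rewrite mem_cat vV ?orbT.
have -> : all_in V `&` (all_in G `&` all_ge n) =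
    [set o | fits (step_children V' G n) (strict_prefixes V' ++ G) (T o)].
  rewrite setIA; apply/seteqP; split => o /=.
    by move=> [/VG oV oG]; apply/(fits_step n V'h Gh GV').
  by move=> /(fits_step n V'h Gh GV') [/VG].
have -> : all_in V `&` all_in G =
    [set o | fits (prefix_children V') (strict_prefixes V') (T o)].
  by apply/seteqP; split => o; [move=> /VG oV; apply/fits_prefixes|move=> /fits_prefixes oV; apply/VG].
rewrite (Pr_fits (prescription_step n V'h uG Gh GV')).
rewrite (Pr_fits (prescription_prefixes V')).
by rewrite (step_prod n V'h Gh) mulrC.
Qed.

(** The events that prescribe vertices generate the past and are stable under
    intersection, so that the previous lemma extends to all events of the past. *)
Lemma Pr_past A n : tree_past T h A -> A `<=` all_in G ->
  Pr P (A `&` all_ge n) = Pr P A * \prod_(u <- G) Q h (n u).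
Proof.
move=> pA AG.
pose gen := [set all_in V | V in [set V : seq word | forall v, v \in V -> (size v <= h)%N]].
have genI : setI_closed gen.
  move=> _ _ [V Vh <-] [V' V'h <-]; exists (V ++ V').
    by move=> v; rewrite mem_cat => /orP[/Vh|/V'h].
  apply/seteqP; split => o /=.
    by move=> H; split => v vV; apply: H; rewrite mem_cat vV ?orbT.
  by move=> [H H'] v; rewrite mem_cat => /orP[/H|/H'].
have genT : gen setT by exists [::] => //; apply/seteqP; split.
have past_gen : tree_past T h `<=` <<s gen >>.
  apply: sub_smallest2r; first exact: smallest_sigma_algebra.
  move=> _ [u uh <-]; exists [:: u].
    by move=> v; rewrite inE => /eqP ->.
  by apply/seteqP; split => o /=; [apply; rewrite inE|move=> H v; rewrite inE => /eqP ->].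
have mB : measurable (all_in G `&` all_ge n).
  by apply: measurableI; [exact: measurable_all_in|exact: measurable_all_ge].
have mG := measurable_all_in G.
have q0 : 0 <= \prod_(u <- G) Q h (n u) by exact: prodr_ge0.
have gm : gen `<=` measurable by move=> _ [V _ <-]; exact: measurable_all_in.
have mA : measurable A.
  by apply: (smallest_sub sM gm); exact: past_gen.
have eq0 := @g_sigma_algebra_measure_unique _ R Omega gen gm (fun=> setT) (fun=> genT) _
  (mrestr P mB) (mscale (NngNum q0) (mrestr P mG)) genI _ _ A (past_gen _ pA).
have {eq0} : mrestr P mB A = mscale (NngNum q0) (mrestr P mG) A.
  apply: eq0.
  - by rewrite bigcup_const//; exists 0%N.
  - move=> _ [V Vh <-]; rewrite /= /mscale/= /mrestr.
    rewrite !PrE; last 2 first.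
    + by apply: measurableI => //; exact: measurable_all_in.
    + by apply: measurableI => //; exact: measurable_all_in.
    by rewrite -EFinM Pr_step.
  - by move=> _; rewrite /= /mrestr setTI -ge0_fin_numE ?fin_num_measure.
rewrite /= /mscale/= /mrestr setIA (setIidl AG) !PrE//; last first.
  by apply: measurableI => //; exact: measurable_all_ge.
by rewrite -EFinM => -[->]; rewrite mulrC.
Qed.

End one_generation.

Variable q : nat -> child_count -> R.
Hypotheses (q_nat : forall h k, q h (count_nat k) = Q h k - Q h k.+1).
Hypotheses (q_absent : forall h, q h count_absent = 0).
Hypotheses (q_infty : forall h, Q h @ \oo --> q h count_infty).

Lemma count_natP t u k : vertices t u -> nb_children t u = count_nat k <->
  count_ge k (nb_children t u) /\ ~ count_ge k.+1 (nb_children t u).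
Proof.
move=> tu; case: nb_childrenP => [//|k' _ _|_ _] /=; split => //.
- by move=> [->]; rewrite leqnn ltnn.
- move=> [kk' k'k]; congr count_nat; apply/eqP; rewrite eqn_leq kk' andbT leqNgt.
  exact/negP.
- by move=> [_ []].
Qed.

Lemma count_inftyP t u : vertices t u -> nb_children t u = count_infty <->
  forall k, count_ge k (nb_children t u).
Proof.
move=> tu; case: nb_childrenP => [//|k' _ _|_ _] /=; split => //.
by move=> /(_ k'.+1); rewrite ltnn.
Qed.

(** Exact numbers of children from lower bounds, one vertex at a time: a finite
    number is a difference of two lower bounds, an infinite one a decreasing limit. *)
Lemma Pr_exact h (x : word -> child_count) G A (a : R) : uniq G -> measurable A ->
  A `<=` all_in G ->
  (forall n, Pr P (A `&` all_ge G n) = a * \prod_(u <- G) Q h (n u)) ->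
  Pr P (A `&` [set o | forall u, u \in G -> nb_children (T o) u = x u]) =
  a * \prod_(u <- G) q h (x u).
Proof.
elim: G A a => [|u G IH] A a.
  move=> _ mA _ /(_ (fun=> 0%N)); rewrite !big_nil => <-; congr (Pr P (_ `&` _)).
  by apply/seteqP; split => o _ v.
move=> /= /andP[uG uniqG] mA AG HA.
have Au o : A o -> vertices (T o) u by move=> /AG; apply; rewrite mem_head.
pose A' := A `&` [set o | nb_children (T o) u = x u].
have -> : A `&` [set o | forall v, v \in u :: G -> nb_children (T o) v = x v] =
    A' `&` [set o | forall v, v \in G -> nb_children (T o) v = x v].
  apply/seteqP; split => o /=.
    move=> [Ao H]; split; last by move=> v vG; apply: H; rewrite inE vG orbT.
    by split => //; apply: H; rewrite mem_head.
  by move=> [[Ao ou] H]; split => // v; rewrite inE => /orP[/eqP ->|/H].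
rewrite big_cons mulrA; apply: IH => //.
- by apply: measurableI => //; exact: rT.
- by move=> o [/AG H _] v vG; apply: H; rewrite inE vG orbT.
move=> n.
pose ge k := A `&` [set o | count_ge k (nb_children (T o) u)] `&` all_ge G n.
have mge k : measurable (ge k).
  apply: measurableI; last exact: measurable_all_ge.
  by apply: measurableI => //; exact: measurable_count.
have Pge k : Pr P (ge k) = a * Q h k * \prod_(v <- G) Q h (n v).
  have := HA (fun v => if v == u then k else n v).
  have nG v : v \in G -> (if v == u then k else n v) = n v.
    by move=> vG; case: eqP => // vu; rewrite -vu vG in uG.
  rewrite big_cons eqxx mulrA (eq_big_seq (fun v => Q h (n v))); last first.
    by move=> v vG; rewrite /= nG.
  move=> <-; congr (Pr P _); apply/seteqP; split => o.
    move=> [[Ao k1] oG]; split => // v; rewrite inE => /orP[/eqP ->|vG].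
      by rewrite eqxx.
    by rewrite nG//; exact: oG.
  move=> [Ao oG]; split; first by split => //=; have := oG u (mem_head _ _); rewrite eqxx.
  by move=> v vG; rewrite -(nG v vG); apply: oG; rewrite inE vG orbT.
case E : (x u) => [[k|]|].
- have -> : A' `&` all_ge G n = ge k `\` ge k.+1.
    apply/seteqP; split => o /=.
      move=> [[Ao ou] oG]; rewrite E in ou.
      have [k1 k2] := (count_natP k (Au _ Ao)).1 ou.
      by split => // -[[]].
    move=> [[[Ao k1] oG] k2]; split => //; split => //; rewrite E.
    by apply/(count_natP k (Au _ Ao)); split => // k3; apply: k2.
  have sub : ge k.+1 `<=` ge k.
    move=> o [[Ao k1] oG]; split => //; split => //.
    exact: count_ge_le (leqnSn k) k1.
  have := Pr_split P (mge k) (mge k.+1); rewrite (setIidr sub) !Pge.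
  move=> H; have {}H : Pr P (ge k `\` ge k.+1) = a * Q h k * \prod_(v <- G) Q h (n v)
    - a * Q h k.+1 * \prod_(v <- G) Q h (n v) by rewrite H addrAC subrr add0r.
  by rewrite H (q_nat h k) mulrBr mulrBl.
- have -> : A' `&` all_ge G n = set0.
    apply/seteqP; split => // o [[/Au Ao /=]]; rewrite E.
    by case: nb_childrenP.
  by rewrite Pr_set0 q_absent mulr0 mul0r.
have -> : A' `&` all_ge G n = \bigcap_k ge k.
  apply/seteqP; split => o.
    move=> [[Ao ou] oG] k _; rewrite /= E in ou; split => //; split => //.
    exact: (count_inftyP (Au _ Ao)).1.
  move=> H; have [[Ao _] oG] := H 0%N I; split => //; split => //; rewrite /= E.
  apply/(count_inftyP (Au _ Ao)) => k; by have [[_]] := H k I.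
have c1 : (P \o ge) @ \oo --> P (\bigcap_k ge k).
  apply: nonincreasing_cvg_mu => //.
  - by rewrite -ge0_fin_numE ?fin_num_measure.
  - exact: bigcapT_measurable.
  - move=> i j ij; apply/subsetPset => o [[Ao k1] oG]; split => //; split => //.
    exact: count_ge_le ij k1.
have c2 : (fun k => Pr P (ge k)) @ \oo --> a * q h count_infty * \prod_(v <- G) Q h (n v).
  under eq_fun do rewrite Pge.
  by apply: cvgMl; apply: cvgMr; exact: q_infty.
rewrite PrE in c1; last exact: bigcapT_measurable.
have /fine_cvg c3 := c1.
by rewrite -(cvg_lim (@Rhausdorff R) c2) -(cvg_lim (@Rhausdorff R) c3).
Qed.

Lemma is_inhom_GW_fits : is_inhom_GW P q T.
Proof.
split=> // h A G x pA uG Gh AG.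
have AG' : A `<=` all_in G by move=> o Ao v vG; exact: AG.
have mA : measurable A.
  apply: (smallest_sub sM) pA => _ [u _ <-]; exact: measurable_vertex.
rewrite !PrE//; last first.
  apply: measurableI => //; apply: measurable_all => u; exact: rT.
rewrite (@Pr_exact h x G A (Pr P A))// => n.
exact: Pr_past.
Qed.

End Galton_Watson_law.

(** * Identification of the limit *)

Section critical_values.
Context {R : realType}.
Variables (p : nat -> R) (c : R) (w : R -> R).
Notation mu := (fine (mean p)).
Notation lap := (lap w).
Notation zt := (zt p c w).
Hypotheses (p0 : forall k, 0 <= p k) (c0 : 0 <= c).
Hypothesis cp0 : c = 0 -> p 0%N = 0.
Hypotheses (mu1 : 1 < mu) (dw : cv_density w).
Hypothesis c1 : c < 1.
Hypothesis tgf1 : tgf p ^~ 1 @ \oo --> (1 : R).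
Hypothesis tgfc : tgf p ^~ c @ \oo --> c.
Hypothesis w_mass : w1 w = (1 - c)%:E.
Hypothesis explore1_le : first_generation_le p c w.
Hypothesis mean_cvg : (fun K => \sum_(k < K) k%:R * p k) @ \oo --> mu.
Hypothesis radius : gf_ereal p (cvg_radius p) = +oo%E.

(** A finite critical value is an exponential moment of W of an order at which it is
    finite, so that the functional equation holds for it. *)
Lemma zt_moment h : (zt h < +oo)%E -> exists l, [/\ 0 < l, (lap l < +oo)%E,
  zt h = (moment p c w l 0)%:E & zt h.+1 = (moment p c w l 1)%:E].
Proof.
have lc0 := lc_gt0 p0 c0 cp0 mu1 dw tgf1 tgfc w_mass explore1_le mean_cvg radius.
rewrite /zt; case E : (lc w) lc0 => [l| |] //; rewrite lte_fin => l0 zfin.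
have mu0 : 0 < mu by exact: lt_trans mu1.
have l'0 : 0 < l / mu ^+ h by rewrite divr_gt0// exprn_gt0.
have lfin : (lap (l / mu ^+ h) < +oo)%E by move: zfin; case: (lap _) => // r _; exact: ltry.
have f0 : lap (l / mu ^+ h) \is a fin_num by rewrite ge0_fin_numE// (lap_ge0 dw).
have f1 : lap (l / mu ^+ h / mu) \is a fin_num.
  by apply: (lap_fin dw _ lfin); rewrite ler_pdivrMr// ler_peMr ?ltW.
exists (l / mu ^+ h); split => //.
  by rewrite /moment expr0 divr1 EFinD (fineK f0).
by rewrite /moment expr1 EFinD (fineK f1) exprSr invfM mulrA.
Qed.

Lemma zt_gt0 h : (0 < zt h)%E.
Proof.
have [zfin|] := ltP (zt h) +oo%E; last by apply: lt_le_trans; rewrite ltry.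
have [l [l0 lfin -> _]] := zt_moment zfin.
by rewrite lte_fin; exact: moment_gt0.
Qed.

Lemma zt_fin h : (zt h < +oo)%E -> (zt h.+1 < +oo)%E.
Proof. by move=> /zt_moment[l [_ _ _ ->]]; exact: ltry. Qed.

Lemma zt_step h : (zt h < +oo)%E ->
  tgf p ^~ (fine (zt h.+1)) @ \oo --> fine (zt h).
Proof. by move=> /zt_moment[l [l0 lfin -> ->]]; exact: moment_step. Qed.

End critical_values.

Section limit_law.
Context {R : realType}.
Variable p : nat -> R.
Hypothesis p_distr : is_distribution p.
Variables (z : nat -> \bar R).
Hypotheses (z_gt0 : forall h, (0 < z h)%E).
Hypothesis z_step : forall h, (z h < +oo)%E -> tgf p ^~ (fine (z h.+1)) @ \oo --> fine (z h).

Let p0 k : 0 <= p k. Proof. by have [] := p_distr. Qed.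

(** The offspring laws of tau^infty as a function of the values [z] of [zeta]. *)
Definition limit_law (h : nat) (x : child_count) : R :=
  if z h == +oo%E then (count_val R x == supp_sup p)%:R
  else if x is Some (Some k) then fine (z h.+1) ^+ k * p k / fine (z h)
  else 0.

Lemma supp_sup_ge0 : (0 <= supp_sup p)%E.
Proof.
have [k pk] : exists k, 0 < p k.
  apply: contrapT => H; have p_eq0 k : p k = 0.
    apply/eqP; rewrite eq_le p0 andbT leNgt; apply/negP => pk; apply: H; by exists k.
  have e1 : limn (tgf p ^~ 1) = 1 by exact/cvg_lim/tgf1_cvg.
  have e0 : tgf p ^~ 1 = cst 0.
    by apply/funext => K; rewrite /tgf big1// => k _; rewrite p_eq0 mul0r.
  by move: e1; rewrite e0 lim_cst// => /eqP; rewrite eq_sym oner_eq0.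
apply: (@le_trans _ _ k%:R%:E); first by rewrite lee_fin.
by apply: ereal_sup_ubound; exists k.
Qed.

Lemma supp_supS k : (k%:R%:E < supp_sup p)%E = (k.+1%:R%:E <= supp_sup p)%E.
Proof.
apply/idP/idP; last by apply: lt_le_trans; rewrite lte_fin ltr_nat.
move=> /ereal_sup_gt[_ [m pm <-]]; rewrite lte_fin ltr_nat => km.
apply: (@le_trans _ _ m%:R%:E); first by rewrite lee_fin ler_nat.
by apply: ereal_sup_ubound; exists m.
Qed.

Lemma limit_law_nat h k :
  limit_law h (count_nat k) = limQ p z h k - limQ p z h k.+1.
Proof.
rewrite /limit_law /limQ; case: ifPn => _ /=.
  rewrite -supp_supS; have [|//|//] := ltgtP k%:R%:E (supp_sup p) => //= _;
    by rewrite ?subrr ?subr0.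
by rewrite /tgf big_ord_recr/= mulrDl [p k * _]mulrC; ring.
Qed.

Lemma limit_law_absent h : limit_law h count_absent = 0.
Proof.
rewrite /limit_law; case: ifPn => //= _; case: eqP => // E.
by have := supp_sup_ge0; rewrite -E lee_fin ler0N1.
Qed.

Lemma limit_law_infty h : limQ p z h @ \oo --> limit_law h count_infty.
Proof.
rewrite /limit_law /limQ; case: ifPn => [_|zh] /=.
  case: eqP => [<-|/eqP boo].
    by under eq_fun do rewrite leey; exact: cvg_cst.
  have [k bk] : exists k : nat, (supp_sup p < k%:R%:E)%E.
    have := supp_sup_ge0; case: (supp_sup p) boo => [r _ _| |//]; last by rewrite eqxx.
    by exists (Num.truncn r).+1; rewrite lte_fin truncnS_gt.
  apply: cvg_near_cst; exists k => // m /= km; rewrite leNgt.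
  by rewrite (lt_le_trans bk)// lee_fin ler_nat.
have zfin : (z h < +oo)%E by rewrite ltey.
have H : (fun k => 1 - tgf p k (fine (z h.+1)) / fine (z h)) @ \oo -->
    1 - fine (z h) / fine (z h).
  by apply: cvgB; [exact: cvg_cst|apply: cvgMl; exact: z_step].
suff E : 0 = 1 - fine (z h) / fine (z h) by rewrite E.
by rewrite divff ?subrr// gt_eqF// fine_gt0// z_gt0.
Qed.

Lemma limQ_ge0 h k : 0 <= limQ p z h k.
Proof.
rewrite /limQ; case: ifPn => // zh.
have zfin : (z h < +oo)%E by rewrite ltey.
have z0 h' : 0 <= fine (z h') by rewrite fine_ge0// ltW.
rewrite subr_ge0 ler_pdivrMr ?mul1r; last by rewrite fine_gt0// z_gt0.
exact: (tgf_le_lim p0 k (z0 h.+1) (@z_step h zfin)).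
Qed.

End limit_law.

Unset Implicit Arguments.

Theorem corollary8p8 (R : realType) (p : nat -> R)
  (* the offspring distribution *)
  (p_distr : is_distribution p)
  (p_nondegenerate : (supp_inf p < supp_sup p)%E)
  (p_mean_finite : (mean p < +oo)%E)
  (p_supercritical : (1 < mean p)%E)
  (p_radius : gf_ereal p (cvg_radius p) = +oo%E)
  (* the extinction probability, the norming constants, W and its density w *)
  (c : R) (hc : is_extinction_root p c)
  (a : nat -> R) (ha : seneta_heyde p c a)
  (d0 : measure_display) (Omega0 : measurableType d0)
  (P0 : probability Omega0 R) (tau : Omega0 -> tree) (htau : is_GW P0 p tau)
  (W : {RV P0 >-> R}) (hW : is_SH_limit a tau W)
  (w : R -> R) (hw : is_limit_density c W w)
  (* the trees tau^theta, theta > 0, with their sets of type s vertices *)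
  (d_ : R -> measure_display) (Omega_ : forall theta, measurableType (d_ theta))
  (P_ : forall theta, probability (Omega_ theta) R)
  (tau_ : forall theta, Omega_ theta -> tree)
  (S_ : forall theta, Omega_ theta -> set word)
  (htau_ : forall theta, 0 < theta ->
     is_tau_theta (P_ theta) p c w theta (tau_ theta) (S_ theta))
  (* a random tree, the limit in distribution of tau^theta *)
  (d : measure_display) (Omega : measurableType d) (P : probability Omega R)
  (T : Omega -> tree) (hT : random_tree T)
  (tau_cvg : local_cvg_in_law (pinfty_nbhs R) P_ tau_ P T) :
  (* T is distributed as tau^infty *)
  is_inhom_GW P (tau_infty_law p W) T.
Proof.
have p0 k : 0 <= p k by have [] := p_distr.
have [c0 c1 _] := hc.
have mu_fin : mean p \is a fin_num.
  by rewrite ge0_fin_numE// ltW// (lt_trans _ p_supercritical).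
have mu1 : 1 < fine (mean p) by rewrite -lte_fin fineK.
have mu0 : 0 < fine (mean p) by exact: lt_trans mu1.
have dw := limit_density_cv hw; have w_mass := limit_density_mass hw.
have tgf1 := tgf1_cvg p_distr; have tgfc := tgfc_cvg p_distr hc.
have cp0 := extinction0 p_distr hc; have pin := distr_inner_cvg p_distr.
have muc := mean_cvg_fine p_distr p_mean_finite.
have Pr1 theta A : measurable A -> Pr (P_ theta) A <= 1.
  by move=> mA; rewrite -(Pr_setT (P_ theta)); exact: Pr_le.
have rT_ theta : 0 < theta -> random_tree (tau_ theta).
  by move=> /htau_[[]].
have gen1 : first_generation_le p c w.
  move=> K theta theta0.
  have le1 := root_explore_le K p0 pin c0 c1 mu0 theta0 dw (htau_ theta theta0)
    (fun=> 0%N) 1%N.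
  apply: le_trans le1 _.
  rewrite ler_piMl ?(ltW (cvd_gt0 dw theta0))// Pr1//.
  by apply: measurable_at_least; exact: rT_.
pose z := zt p c w.
have z_gt0 h : (0 < z h)%E by exact: zt_gt0.
have z_step h : (z h < +oo)%E -> tgf p ^~ (fine (z h.+1)) @ \oo --> fine (z h).
  exact: zt_step.
have -> : tau_infty_law p W = limit_law p z.
  apply/funext => h; apply/funext => x.
  by rewrite /tau_infty_law /limit_law !(zeta_zt p c0 hw).
apply: (@is_inhom_GW_fits _ _ _ P T hT (limQ p z)).
- exact: limQ_ge0.
- move=> N D ND; pose H := (\max_(u <- D) size u).+1.
  have DH u : u \in D -> (size u < H)%N by move=> uD; rewrite ltnS leq_bigmax_seq.
  have -> : [set o | fits N D (T o)] = At T N 0 H.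
    by apply/seteqP; split => o /=; rewrite (fits_at_least _ ND DH).
  (* the limit at infinity only involves positive theta *)
  pose PF theta := if 0 < theta then Pr (P_ theta) (At (tau_ theta) N 0 H) else 0.
  have PFE theta : 0 < theta -> PF theta = Pr (P_ theta) (At (tau_ theta) N 0 H).
    by rewrite /PF => ->.
  have PF0 theta : 0 <= PF theta by rewrite /PF; case: ifP => // _; exact: Pr_ge0.
  have PF1 theta : PF theta <= 1.
    rewrite /PF; case: ifP => // theta0; apply: Pr1.
    by apply: measurable_at_least; exact: rT_.
  have PFcvg : PF @ +oo --> Pr P (At T N 0 H).
    apply: cvg_trans (Pr_At_cvg rT_ hT tau_cvg ND DH).
    apply: near_eq_cvg; exists 0; split => // theta theta0.
    by rewrite PFE.
  have PFle K theta : 0 < theta ->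
      explore p c N K H root_st (mass p w theta H) <= PF theta * w theta.
    by move=> theta0; rewrite PFE//; apply: root_explore_le => //; exact: htau_.
  have PFcompl K theta : 0 < theta ->
      explore p c (fun=> 0%N) K H root_st (mass p w theta H) <=
      explore p c N K H root_st (mass p w theta H) + (1 - PF theta) * w theta.
    by move=> theta0; rewrite PFE//; apply: root_explore_compl_le => //; exact: htau_.
  have [lam [lam0 lamfin lamz lamy lamlow]] :=
    tilts p0 c0 cp0 mu1 dw tgf1 tgfc w_mass gen1 muc p_radius.
  have cv1 := tail_prod_cvg p0 c0 cp0 mu1 dw tgf1 tgfc w_mass gen1 ND DH PF0 PF1 PFcvg
    PFle PFcompl lam0 lamfin lamy lamlow.
  have cv2 : (fun n => tail_prod p c w N D (lam n)) @ \oo -->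
      \prod_(u <- D) limQ p z (size u) (N u).
    apply: cvg_big => [|u _]; first exact: mul_continuous.
    apply: (@tailQ_cvg _ p p0 tgf1 (fun n => moment p c w (lam n))).
    + by move=> n h; exact: moment_gt0.
    + by move=> n h; exact: moment_step.
    + move=> h; apply: cvg_trans (@lamz h); apply: near_eq_cvg; apply: nearW => n.
      rewrite /moment EFinD fineK//; apply: (lap_fin dw _ (lamfin n)).
      by rewrite ler_pdivrMr ?exprn_gt0// ler_peMr ?(ltW (lam0 n))// exprn_ege1// ltW.
    + exact: z_gt0.
    + exact: zt_fin.
    + exact/ltW/z_gt0.
  by rewrite -(cvg_lim (@Rhausdorff R) cv1) -(cvg_lim (@Rhausdorff R) cv2).
- by move=> h k; exact: limit_law_nat.
- by move=> h; exact: limit_law_absent.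
- by move=> h; exact: limit_law_infty.
Qed.
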